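(* Let $A$ be a locally finite, connected graded algebra generated in degree 1, and let $d\ge2$. Then $A$ is a bi-Koszul algebra (determined by $\varDelta_d$) if and only if there exists a reduced $A_\infty$-algebra $(E(A);\{m_i\})$ which is $[m_2,m_3]$-finitely generated by $E^1(A)$, $E^2(A)$ and $E^3(A)$, with $E^1(A)=E^1_1(A)$, $E^2(A)=E^2_d(A)\oplus E^2_{d+1}(A)$ and $E^3(A)=E^3_{2d}(A)$.
   Context: Fix a field $\mathbb F$; $A=\mathbb F\oplus A_1\oplus A_2\oplus\cdots$, and $\mathbb F$ also denotes the trivial graded left module $A/A_{\ge 1}$. Put $E(A)=\bigoplus_{p,j}E^p_j(A)$ with $E^p_j(A)=\underline{\mathrm{Ext}}^p_A(\mathbb F,\mathbb F)_{-j}$, where $\underline{\mathrm{Ext}}$ is the derived functor of $\underline{\mathrm{Hom}}_A(M,N)=\bigoplus_n\mathrm{Hom}_{Gr(A)}(M,N[n])$ (degree-zero graded maps, $N[n]_j=N_{n+j}$); $p$ is the cohomological degree and $j$ the lower grading; $E^p(A)=\bigoplus_j E^p_j(A)$. For $d\ge2$ let $\varDelta_d(3k)=(2dk,2dk)$, $\varDelta_d(3k+1)=(2dk+1,2dk+1)$, $\varDelta_d(3k+2)=(2dk+d,2dk+d+1)$ for $k\ge 0$. $A$ is a bi-Koszul algebra determined by $\varDelta_d$ if the trivial module $\mathbb F$ has a minimal graded free resolution $P$ in which $P_n$ is generated in degrees $\varDelta_d(n)$ (the pair viewed as a set) for all $n\ge0$. An $A_\infty$-algebra is a $\mathbb Z$-graded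 vector space $E$ with linear maps $m_n:E^{\otimes n}\to E$ of degree $2-n$ ($n\ge1$) such that for all $n\ge1$, $\sum(-1)^{i+jt}m_{i+1+j}(1^{\otimes i}\otimes m_t\otimes 1^{\otimes j})=0$, the sum over $n=i+t+j$, $i,j\ge0$, $t\ge1$. All $A_\infty$-algebras are strictly unital ($1\in E$ is a two-sided unit for $m_2$, and $m_n(x_1,\dots,x_n)=0$ for $n\ne2$ if some $x_i=1$). An $A_\infty$-algebra $(E(A);\{m_i\})$ always means an $A_\infty$-Ext-algebra structure, i.e. one obtained by the minimality theorem (Kadeishvili) from the differential graded algebra $\mathrm{End}_A(P)$, $P$ a free resolution of ${}_A\mathbb F$: thus $m_1=0$, $m_2$ is the Yoneda product, every $m_n$ preserves the lower grading, and $E(A)$ is quasi-isomorphic to $\mathrm{End}_A(P)$. Reduced (with respect to $d$). For a bigraded $E=\bigoplus E^p_j$ put $E^{[r]}=\bigoplus_{k\ge0}E^{3k+r}$ ($r=0,1,2$), $E^{[2]}_{(d)}=\bigoplus_k E^{3k+2}_{2dk+d}$, $E^{[2]}_{(d+1)}=\bigoplus_kE^{3k+2}_{2dk+d+1}$, where $E^{[2]}=E^{[2]}_{(d)}\oplus E^{[2]}_{(d+1)}$. $E$ is reduced if $m_n=0$ for $n\notin\{2,3,4,d,d+1\}$ and the multiplications are zero on all tensor products of these pieces except possibly on the following (including all permutations of the factors; lists are merged when indices coincide), with values in the indicated piece: $m_2$: $E^{[0]}E^{[0]}\to E^{[0]}$; $E^{[0]}E^{[1]}$ and $E^{[2]}_{(d)}E^{[2]}_{(d+1)}\to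 E^{[1]}$; $E^{[0]}E^{[2]}\to E^{[2]}$. $m_3$: $E^{[0]}E^{[2]}_{(d)}E^{[2]}_{(d)}\to E^{[0]}$; $E^{[1]}E^{[2]}_{(d)}E^{[2]}_{(d)}\to E^{[1]}$; $E^{[0]}E^{[1]}E^{[2]}_{(d)}$ and $E^{[2]}E^{[2]}_{(d)}E^{[2]}_{(d)}\to E^{[2]}$. $m_4$: $E^{[2]}_{(d)}E^{[2]}_{(d)}E^{[2]}_{(d)}E^{[2]}_{(d)}\to E^{[0]}$; $E^{[1]}E^{[2]}_{(d)}E^{[2]}_{(d)}E^{[2]}_{(d)}\to E^{[2]}$. $m_d$: ($d-1$ factors $E^{[1]}$ and one $E^{[2]}_{(d+1)}$) $\to E^{[0]}$; ($d$ factors $E^{[1]}$) $\to E^{[2]}$. $m_{d+1}$: ($d$ factors $E^{[1]}$ and one $E^{[2]}_{(d)}$) $\to E^{[0]}$; ($d+1$ factors $E^{[1]}$) $\to E^{[2]}$. An $A_\infty$-algebra $E$ is $[m_{n_1},\dots,m_{n_t}]$-finitely generated by $E^1,\dots,E^l$ if for every $p>l$, $E^p=\sum m_{n_i}(E^{k_1}\otimes\cdots\otimes E^{k_{n_i}})$, the sum over $1\le i\le t$ and $k_1,\dots,k_{n_i}\ge1$ with $k_1+\cdots+k_{n_i}+2-n_i=p$. *)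

(* Defs.v *)
From HB Require Import structures.
From Stdlib Require List.
From mathcomp Require Import all_boot all_order all_algebra.
From mathcomp Require Import boolp classical_sets functions.

Set Implicit Arguments.
Unset Strict Implicit.
Unset Printing Implicit Defensive.

Import GRing.Theory.
Local Open Scope classical_set_scope.
Local Open Scope ring_scope.

(* The sign (-1)^z, for an integer z, in an arbitrary ring. *)
Definition sgn (R : pzRingType) (z : int) : R := (-1) ^+ `|z|%N.

Section Span.
Variables (R : pzRingType) (V : lmodType R).

Definition lspan (S : set V) : set V :=
  [set v | exists (n : nat) (a : 'I_n -> R) (x : 'I_n -> V),
     (forall k, S (x k)) /\ v = \sum_k a k *: x k].

Definition lspanb (S : set V) : {pred V} := fun v => `[< lspan S v >].

Lemma lspanb_closed (S : set V) : submod_closed (lspanb S).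
Proof.
split=> [|c u v] /=.
  apply/asboolP; exists 0%N, (fun=> 0), (fun=> 0).
  by split=> [[]//|]; rewrite big_ord0.
move=> /asboolP[m [a [x [Sx ->]]]] /asboolP[n [b [y [Sy ->]]]].
apply/asboolP; exists (m + n)%N.
exists (fun k : 'I_(m + n) =>
  match fintype.split k with inl i => c * a i | inr j => b j end).
exists (fun k : 'I_(m + n) =>
  match fintype.split k with inl i => x i | inr j => y j end).
split=> [k|]; first by case: (fintype.split k).
rewrite big_split_ord /= scaler_sumr.
congr (_ + _); apply: eq_bigr => k _.
  by rewrite -[lshift n k]/(unsplit (inl k)) unsplitK scalerA.
by rewrite -[rshift m k]/(unsplit (inr k)) unsplitK.
Qed.

HB.instance Definition _ (S : set V) :=
  GRing.isSubmodClosed.Build R V (lspanb S) (lspanb_closed S).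

Definition lspan_sub (S : set V) := {v : V | lspanb S v}.

HB.instance Definition _ (S : set V) := SubType.copy (lspan_sub S) {v : V | lspanb S v}.
HB.instance Definition _ (S : set V) := SubChoice.copy (lspan_sub S) {v : V | lspanb S v}.
HB.instance Definition _ (S : set V) :=
  [SubChoice_isSubLmodule of lspan_sub S by <:].

End Span.

Section Cohomology.
Variables (R : pzRingType) (V : lmodType R) (Z B : set V).

Definition coboundary : {pred lspan_sub Z} := fun z => lspanb B (val z).

Lemma coboundary_closed : submod_closed coboundary.
Proof.
split=> [|c u v]; rewrite -!topredE /= /coboundary.
  by rewrite raddf0 -[lspanb _ _]/(0 \in lspanb B) rpred0.
rewrite linearP -![lspanb _ _]/(_ \in lspanb B) => Bu Bv.
by rewrite rpredD // rpredZ.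
Qed.

HB.instance Definition _ :=
  GRing.isSubmodClosed.Build R (lspan_sub Z) coboundary coboundary_closed.

Definition cohomology := @Quotient.quot (lspan_sub Z) coboundary.
HB.instance Definition _ := GRing.Zmodule.on cohomology.
HB.instance Definition _ :
    EqQuotient _ (@Quotient.equiv (lspan_sub Z) coboundary) cohomology :=
  EqQuotient.on cohomology.

Local Notation pi := (\pi_cohomology%qT : lspan_sub Z -> cohomology).

Lemma pi_is_additive : {morph pi : x y / x + y}.
Proof. exact: Quotient.pi_add. Qed.

Definition scale_cohomology (c : R) (x : cohomology) : cohomology :=
  pi (c *: repr x).

Lemma scale_pi c z : scale_cohomology c (pi z) = pi (c *: z).
Proof.
apply/eqP; rewrite -Quotient.idealrBE -scalerBr rpredZ //.
by rewrite Quotient.idealrBE reprK.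
Qed.

Lemma pi_surjective x : exists z, x = pi z.
Proof. by exists (repr x); rewrite reprK. Qed.

Lemma scale_cohomologyA a b x :
  scale_cohomology a (scale_cohomology b x) = scale_cohomology (a * b) x.
Proof. by have [z ->] := pi_surjective x; rewrite !scale_pi scalerA. Qed.

Lemma scale_cohomology1 : left_id 1 scale_cohomology.
Proof. by move=> x; have [z ->] := pi_surjective x; rewrite scale_pi scale1r. Qed.

Lemma scale_cohomologyDr : right_distributive scale_cohomology +%R.
Proof.
move=> c x y; have [z ->] := pi_surjective x; have [t ->] := pi_surjective y.
by rewrite -pi_is_additive !scale_pi scalerDr pi_is_additive.
Qed.

Lemma scale_cohomologyDl x : {morph scale_cohomology^~ x : a b / a + b}.
Proof.
move=> a b; have [z ->] := pi_surjective x.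
by rewrite !scale_pi scalerDl pi_is_additive.
Qed.

HB.instance Definition _ := GRing.Zmodule_isLmodule.Build R cohomology
  scale_cohomologyA scale_cohomology1 scale_cohomologyDr scale_cohomologyDl.

(* Only meaningful on cocycles, i.e. on elements of the span of [Z]. *)
Definition coh_class (v : V) : cohomology := pi (insubd 0 v).

Lemma coh_classP u v : lspan Z u -> lspan Z v ->
  coh_class u = coh_class v <-> lspan B (u - v).
Proof.
move=> /asboolP Zu /asboolP Zv; have Bc w : lspan B (val w) <-> w \in coboundary.
  by split=> /asboolP.
rewrite -[u in u - v](insubdK (0 : lspan_sub Z) Zu).
rewrite -[v in _ - v](insubdK (0 : lspan_sub Z) Zv) -raddfB Bc.
by rewrite Quotient.idealrBE; split=> [/eqP|/eqP].
Qed.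

Lemma coh_class_surj x : exists2 v, lspan Z v & x = coh_class v.
Proof.
have [z ->] := pi_surjective x; exists (val z); first exact/asboolP/(valP z).
by rewrite /coh_class valKd.
Qed.

Lemma coh_class_linear a u v : lspan Z u -> lspan Z v ->
  coh_class (a *: u + v) = a *: coh_class u + coh_class v.
Proof.
move=> /asboolP Zu /asboolP Zv; rewrite -[RHS]/(scale_cohomology _ _ + _).
rewrite scale_pi -pi_is_additive; congr (pi _); apply: val_inj.
by rewrite linearP /= !insubdK ?rpredD ?rpredZ.
Qed.

End Cohomology.

Section Grading.
Variables (I : eqType) (V : zmodType) (gr : I -> set V).

(* V is the (internal) direct sum of the additive subgroups [gr i]. *)
Definition is_grading : Prop :=
  [/\ forall i, gr i 0,
      forall i x y, gr i x -> gr i y -> gr i (x - y),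
      forall v, exists (s : seq I) (c : I -> V),
        (forall i, gr i (c i)) /\ v = \sum_(i <- s) c i
    & forall (s : seq I) (c : I -> V), uniq s -> (forall i, gr i (c i)) ->
        \sum_(i <- s) c i = 0 -> forall i, i \in s -> c i = 0].

End Grading.

Section GradedAlgebra.
Variables (F : fieldType) (A : algType F) (gr : nat -> set A).

Definition graded_algebra : Prop :=
  [/\ is_grading gr,
      forall i (c : F) a, gr i a -> gr i (c *: a),
      gr 0%N 1
    & forall i j a b, gr i a -> gr j b -> gr (i + j)%N (a * b)].

Definition connected_algebra : Prop :=
  gr 0%N = [set a | exists c : F, a = c%:A].

Definition locally_finite : Prop :=
  forall i, exists s : seq A, gr i `<=` lspan [set a | a \in s].

Definition generated_in_degree1 : Prop :=
  lspan [set \prod_(a <- s) a | s in [set s : seq A | forall a, a \in s -> gr 1%N a]]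
  = setT.

(* A-linear maps from a left A-module to the trivial module A / A_{>=1}. *)
Definition trivial_hom (M : lmodType A) (phi : M -> F^o) : Prop :=
  [/\ forall x y, phi (x + y) = phi x + phi y,
      forall (c : F) x, phi (c%:A *: x) = c * phi x
    & forall i a x, (0 < i)%N -> gr i a -> phi (a *: x) = 0].

Definition is_basis (M : lmodType A) (X : set M) : Prop :=
  lspan X = setT /\
  forall (s : seq M) (c : M -> A), uniq s -> (forall x, x \in s -> X x) ->
    \sum_(x <- s) c x *: x = 0 -> forall x, x \in s -> c x = 0.

(* A graded free resolution ... -> P_1 -> P_0 -> F -> 0 of the trivial module,
   presented through its total module, the direct sum of the P_n:
   [res_gr (n, i)] is the component of P_n of internal degree i, and P_n is
   zero for n < 0.  A basis of bihomogeneous elements is the same as a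
   homogeneous basis of every P_n. *)
Record resolution := Resolution {
  res_mod :> lmodType A;
  res_gr : int * int -> set res_mod;
  res_d : {linear res_mod -> res_mod};
  res_aug : res_mod -> F^o;
  res_grading : is_grading res_gr;
  res_gr_scale : forall i a n j x, gr i a -> res_gr (n, j) x ->
    res_gr (n, i%:Z + j) (a *: x);
  res_nonneg : forall n j x, (n < 0)%R -> res_gr (n, j) x -> x = 0;
  res_free : exists2 X : set res_mod,
    X `<=` [set x | exists nj, res_gr nj x] & is_basis X;
  res_d_degree : forall n j x, res_gr (n, j) x -> res_gr (n - 1, j) (res_d x);
  res_aug_hom : trivial_hom res_aug;
  res_aug_degree : forall nj x, nj <> (0, 0) -> res_gr nj x -> res_aug x = 0;
  res_aug_surj : exists x, res_aug x = 1;
  res_aug_d : forall x, res_aug (res_d x) = 0;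
  res_dd : forall x, res_d (res_d x) = 0;
  res_exact0 : forall j x, res_gr (0, j) x -> res_aug x = 0 ->
    exists2 y, res_gr (1, j) y & res_d y = x;
  res_exact : forall n j x, (0 < n)%R -> res_gr (n, j) x -> res_d x = 0 ->
    exists2 y, res_gr (n + 1, j) y & res_d y = x
}.

Arguments res_gr : clear implicits.
Arguments res_d : clear implicits.
Arguments res_aug : clear implicits.

(* d P is contained in A_{>=1} P *)
Definition minimal_resolution (P : resolution) : Prop :=
  forall x : P, lspan [set y : P | exists i a z,
    [/\ (0 < i)%N, gr i a & y = a *: z]] (res_d P x).

Definition res_term (P : resolution) (n : nat) : set P :=
  lspan [set x : P | exists j, res_gr P (n%:Z, j) x].
Arguments res_term : clear implicits.

Definition bi_Koszul_degrees (d n : nat) : nat * nat :=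
  let k := (n %/ 3)%N in
  match (n %% 3)%N with
  | 0 => (2 * d * k, 2 * d * k)
  | 1 => (2 * d * k + 1, 2 * d * k + 1)
  | _ => (2 * d * k + d, 2 * d * k + d + 1)
  end%N.

Definition bi_Koszul (d : nat) : Prop :=
  exists2 P : resolution, minimal_resolution P &
    forall n : nat, let D := bi_Koszul_degrees d n in
      res_term P n =
      lspan (res_gr P (n%:Z, D.1%:Z) `|` res_gr P (n%:Z, D.2%:Z)).

Section Ext.
Variable P : resolution.

(* Hom_A(P_p, F)_{-j}: the maps P_p -> F sending degree j to degree 0, extended
   by zero to the other summands of P. *)
Definition cochain (pj : int * int) : set (P -> F^o) :=
  [set phi | trivial_hom phi /\
     forall ni x, ni <> pj -> res_gr P ni x -> phi x = 0].

Definition cocycle (pj : int * int) : set (P -> F^o) :=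
  [set phi | cochain pj phi /\ forall x, phi (res_d P x) = 0].

Definition Ext : Type :=
  @cohomology F (P -> F^o)
    [set phi | exists pj, cocycle pj phi]
    [set phi \o res_d P | phi in [set phi | exists pj, cochain pj phi]].

HB.instance Definition _ := GRing.Lmodule.on Ext.

Definition Ext_class (phi : P -> F^o) : Ext := coh_class _ _ phi.

(* E^p_j(A), as a subspace of E(A) *)
Definition Ext_gr (pj : int * int) : set Ext := Ext_class @` cocycle pj.

Definition Ext_one : Ext := Ext_class (res_aug P).

(* The piece Hom_A(P,P)^p of cohomological degree p and lower grading j, as
   A-linear endomorphisms of the total module of P. *)
Definition End_gr (pj : int * int) : set (P -> P) :=
  [set g | linear g /\
     forall n i x, res_gr P (n, i) x -> res_gr P (n - pj.1, i - pj.2) (g x)].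

Definition End_d (p : int) (g : P -> P) : P -> P :=
  fun x => res_d P (g x) - sgn A p *: g (res_d P x).

End Ext.
End GradedAlgebra.

Arguments res_gr {F A gr} P _ : rename.
Arguments res_d {F A gr} P : rename.
Arguments res_aug {F A gr} P _ : rename.
Arguments Ext_gr {F A gr} P _.
Arguments Ext_one {F A gr} P.
Arguments End_gr {F A gr} P _.
Arguments End_d {F A gr} P _ _.

(* A family of n-ary operations is one function on sequences, its n-th member
   being the restriction to sequences of size n.  Bidegrees are pairs
   (cohomological degree, lower grading); [List.Forall2 gr ds xs] says that xs
   is a sequence of homogeneous elements of bidegrees ds. *)
Section Operations.
Variables (R : pzRingType) (F : pzRingType) (E : lmodType F) (V : lmodType R).
Variable (s : F -> R).

Definition multilinear (g : seq E -> V) : Prop :=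
  forall xs ys (c : F) x y,
    g (xs ++ (c *: x + y) :: ys) =
    s c *: g (xs ++ x :: ys) + g (xs ++ y :: ys).

(* The sum over n = i + t + j of (-1)^(i + j t) g (1^i (x) m_t (x) 1^j),
   evaluated at xs; moving m_t, of degree 2 - t, past the first i arguments
   contributes the Koszul sign (-1)^(t (|x_1| + ... + |x_i|)). *)
Definition insertion_sum (m : seq E -> E) (g : seq E -> V)
    (ds : seq (int * int)) (xs : seq E) : V :=
  let n := size xs in
  \sum_(i < n) \sum_(1 <= t < (n - i).+1)
    let j := (n - i - t)%N in
    sgn R ((i + j * t)%N%:Z + t%:Z * (\sum_(e <- take i ds) e).1) *:
    g (take i xs ++ m (take t (drop i xs)) :: drop (i + t) xs).

End Operations.

Section AInfinity.
Variables (F : fieldType) (E : lmodType F).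
Variables (gr : int * int -> set E) (one : E) (m : seq E -> E).

(* Strictly unital A-infinity algebras with a lower grading preserved by all
   multiplications. *)
Definition A_infinity_algebra : Prop :=
  [/\ is_grading gr /\ (forall pj (c : F) x, gr pj x -> gr pj (c *: x)),
      multilinear id m,
      forall ds xs, (0 < size xs)%N -> List.Forall2 gr ds xs ->
        gr (\sum_(e <- ds) e + (2 - (size xs)%:Z, 0)) (m xs),
      forall ds xs, (0 < size xs)%N -> List.Forall2 gr ds xs ->
        insertion_sum m m ds xs = 0
    & [/\ gr (0, 0) one,
          forall x, m [:: one; x] = x /\ m [:: x; one] = x
        & forall xs, size xs <> 2 -> one \in xs -> m xs = 0]].

(* E^p *)
Definition coh_part (p : int) : set E :=
  lspan [set x | exists j, gr (p, j) x].

Definition finitely_generated (ns : seq nat) (l : nat) : Prop :=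
  forall p : nat, (l < p)%N ->
    coh_part p%:Z =
    lspan [set y | exists (ks : seq nat) (xs : seq E),
      [/\ size xs \in ns, all (leq 1) ks,
          (sumn ks)%:Z + 2 - (size xs)%:Z = p%:Z,
          List.Forall2 (fun k => coh_part k%:Z) ks xs
        & y = m xs]].

End AInfinity.

(* E^[0], E^[1], E^[2]_(d) and E^[2]_(d+1) *)
Inductive piece := E0 | E1 | E2d | E2d1.

Lemma piece_comparable : comparable piece.
Proof. by move=> [] []; first [by left | by right]. Qed.
HB.instance Definition _ := hasDecEq.Build piece (compareP piece_comparable).

Section Reduced.
Variables (F : fieldType) (E : lmodType F) (d : nat).
Variables (gr : int * int -> set E) (m : seq E -> E).

(* E^[r] *)
Definition residue_part (r : nat) : set E :=
  lspan [set x | exists (k : nat) (j : int), gr ((3 * k + r)%N%:Z, j) x].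

Definition E2_part (e : nat) : set E :=
  lspan [set x | exists k : nat,
    gr ((3 * k + 2)%N%:Z, (2 * d * k + e)%N%:Z) x].

Definition piece_part (a : piece) : set E :=
  match a with
  | E0 => residue_part 0
  | E1 => residue_part 1
  | E2d => E2_part d
  | E2d1 => E2_part d.+1
  end.

(* The pairs (w, r) such that m_(size w) may be nonzero on the tensor product
   of the pieces in w, in any order, with values in E^[r]. *)
Definition reduced_table : seq (seq piece * nat) :=
  [:: ([:: E0; E0], 0%N);
      ([:: E0; E1], 1%N); ([:: E2d; E2d1], 1%N);
      ([:: E0; E2d], 2%N); ([:: E0; E2d1], 2%N);
      ([:: E0; E2d; E2d], 0%N);
      ([:: E1; E2d; E2d], 1%N);
      ([:: E0; E1; E2d], 2%N);
      ([:: E2d; E2d; E2d], 2%N); ([:: E2d1; E2d; E2d], 2%N);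
      ([:: E2d; E2d; E2d; E2d], 0%N);
      ([:: E1; E2d; E2d; E2d], 2%N);
      (rcons (nseq d.-1 E1) E2d1, 0%N);
      (nseq d E1, 2%N);
      (rcons (nseq d E1) E2d, 0%N);
      (nseq d.+1 E1, 2%N)].

Definition allowed (w : seq piece) (r : nat) : Prop :=
  exists2 e, e \in reduced_table & perm_eq w e.1 /\ r = e.2.

Definition reduced : Prop :=
  [/\ residue_part 2 = lspan (E2_part d `|` E2_part d.+1),
      forall xs, (0 < size xs)%N -> size xs \notin [:: 2; 3; 4; d; d.+1] ->
        m xs = 0,
      forall w xs, (0 < size xs)%N -> List.Forall2 piece_part w xs ->
        (forall r, ~ allowed w r) -> m xs = 0
    & forall w xs r, List.Forall2 piece_part w xs -> allowed w r ->
        residue_part r (m xs)].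

End Reduced.

Section ExtAInfinity.
Variables (F : fieldType) (A : algType F) (gr : nat -> set A).
Variables (P : resolution gr) (m : seq (Ext P) -> Ext P).

(* A-infinity morphisms from (E(A), m) to the differential graded algebra
   End_A(P), whose product is composition: in
     sum (-1)^(i + j t) f_(i+1+j) (1^i (x) m_t (x) 1^j)
       = sum (-1)^s m_r (f_(i_1) (x) ... (x) f_(i_r)),
     s = (r-1)(i_1 - 1) + (r-2)(i_2 - 1) + ... + (i_(r-1) - 1),
   only r = 1, 2 remain on the right.  For r = 2 and i_1 = a, i_2 = n - a,
   the Koszul sign of f_(n-a), of degree 1 - (n - a), is added. *)
Definition A_infinity_morphism_to_End (f : seq (Ext P) -> (P -> P)) : Prop :=
  [/\ multilinear (fun c : F => c%:A : A) f,
      forall ds xs, (0 < size xs)%N -> List.Forall2 (Ext_gr P) ds xs ->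
        End_gr P (\sum_(e <- ds) e + (1 - (size xs)%:Z, 0)) (f xs),
      forall ds xs, (0 < size xs)%N -> List.Forall2 (Ext_gr P) ds xs ->
        let n := size xs in
        insertion_sum m f ds xs =
        End_d P ((\sum_(e <- ds) e).1 + 1 - n%:Z) (f xs) +
        \sum_(1 <= a < n)
          sgn A (a%:Z - 1 + (1 - (n - a)%N%:Z) * (\sum_(e <- take a ds) e).1) *:
          (f (take a xs) \o f (drop a xs))
    & f [:: Ext_one P] = id /\
      forall xs, (1 < size xs)%N -> Ext_one P \in xs -> f xs = 0].

Definition quasi_isomorphism_to_End (f : seq (Ext P) -> (P -> P)) : Prop :=
  forall p j,
    (forall g, End_gr P (p, j) g -> End_d P p g = 0 ->
       exists x h, [/\ Ext_gr P (p, j) x, m [:: x] = 0,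
         End_gr P (p - 1, j) h & g = f [:: x] + End_d P (p - 1) h]) /\
    (forall x h, Ext_gr P (p, j) x -> m [:: x] = 0 ->
       End_gr P (p - 1, j) h -> f [:: x] = End_d P (p - 1) h ->
       exists2 y, Ext_gr P (p - 1, j) y & m [:: y] = x).

(* The A-infinity structures on E(A) given by the minimality theorem: m_1 = 0
   and there is a quasi-isomorphism to End_A(P) inducing on cohomology the
   canonical identification H(End_A(P)) = H(Hom_A(P, F)) = E(A), which sends
   the class of g to the class of res_aug \o g.  In particular m_2 is the
   Yoneda product. *)
Definition A_infinity_Ext_algebra : Prop :=
  [/\ A_infinity_algebra (Ext_gr P) (Ext_one P) m,
      forall x, m [:: x] = 0
    & exists f, [/\ A_infinity_morphism_to_End f,
        quasi_isomorphism_to_End f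
      & forall x, Ext_class (res_aug P \o f [:: x]) = x]].

End ExtAInfinity.

(* Main.v *)
(* The minimal resolution P has an F-linear contraction s vanishing on a basis.
   Extending it A-linearly gives a homotopy T that transfers End_A(P) to E(A) by
   Merkulov's recursion, with explicit m_2 and m_3. Any A-infinity structure on an
   Ext-algebra supported in the degrees of a bi-Koszul algebra is reduced, because
   no other product has a target of an admissible bidegree. For the generation,
   each E^p_j is finite-dimensional, so it suffices that a combination v of the
   generators of bidegree (p, j) of P vanishes as soon as all the products do on
   v. The lifts to P of the classes of E^{3k} have no common zero on the part of P
   of level 3k+1, nor in low internal degrees on level 3k+2; composing them with
   lifts of classes of E^1, E^2, E^3 and with T gives the claim.

   Conversely, the shape of the nonzero products preserves the admissible
   bidegrees, so that finite generation confines the support of E(A) to them, by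
   induction on the cohomological degree. A minimal resolution Q is built from
   minimal sets of generators of the successive syzygies; comparing it with P, a
   generator of Q of bidegree (n, j) yields a nonzero class in E^n_j, hence Q has
   its generators in the required degrees. *)

From HB Require Import structures.
From Stdlib Require List.
Require Import Defs.
From mathcomp Require Import all_boot all_order all_algebra.
From mathcomp Require Import zify.
From mathcomp Require Import boolp classical_sets functions.

Set Implicit Arguments.
Unset Strict Implicit.
Unset Printing Implicit Defensive.

Import Order.TTheory GRing.Theory Num.Theory.
Local Open Scope classical_set_scope.
Local Open Scope ring_scope.

(** * Spans, gradings and complements *)

(** A-linear maps out of P are built by one recursion along the levels of the generators, and
    identities between them are proved by checking that recursion ([rec_unique]). Signs are produced
    by conjugating with the involution (-1)^n on P_n, which keeps the recursions meaningful for
    inhomogeneous arguments; the signs of the definition are recovered at the end. The hardest case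
    of the generation is E^{3k+3}. There the boundary x = d v has internal degree exactly 2dk+2d on
    level 3k+2, just beyond the range where the lifts of E^{3k} have no common zero, and its
    coefficients lie in A_d or A_{d-1} according to the degree of the generator. An F-linear
    functional th of A lowers the degree: a coefficient in A_{d-1} becomes the scalar th(a), one in
    A_d becomes an element of A_1, by writing it through the generators of level 1 and applying th
    to the left factors. The resulting element xi is homogeneous of degree 2dk+d+1, hence in the
    good range. The homotopy T that computes m_3 also measures how far a composite of lifts is from
    the lift of the product, and this makes the lifts vanish on xi. *)

Section AdditiveMaps.
Variables (U V : zmodType) (g : U -> V).

(** Additivity is a bare predicate because the maps at hand (augmentations, cochains, elements of
    End_A(P)) are plain functions, mostly without bundled structure. *)
Definition addm := forall x y, g (x + y) = g x + g y.

Hypothesis gD : addm.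

Lemma addm0 : g 0 = 0.
Proof. by apply: (addrI (g 0)); rewrite -gD !addr0. Qed.

Lemma addmN x : g (- x) = - g x.
Proof. by apply: (addrI (g x)); rewrite -gD !subrr addm0. Qed.

Lemma addmB x y : g (x - y) = g x - g y.
Proof. by rewrite gD addmN. Qed.

Lemma addm_sum I (r : seq I) (P : pred I) (f : I -> U) :
  g (\sum_(i <- r | P i) f i) = \sum_(i <- r | P i) g (f i).
Proof. exact: (big_morph g gD addm0). Qed.

End AdditiveMaps.

Section LinearSpan.
Variables (R : pzRingType) (V : lmodType R).

Definition submod (W : set V) :=
  W 0 /\ forall c u v, W u -> W v -> W (c *: u + v).

Section Submod.
Variable W : set V.
Hypothesis hW : submod W.

Lemma submodD u v : W u -> W v -> W (u + v).
Proof. by move=> Wu Wv; rewrite -[u]scale1r; apply: hW.2. Qed.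

Lemma submodZ c u : W u -> W (c *: u).
Proof. by move=> Wu; rewrite -[_ *: _]addr0; apply: hW.2 => //; case: hW. Qed.

Lemma submodN u : W u -> W (- u).
Proof. by move=> Wu; rewrite -scaleN1r; apply: submodZ. Qed.

Lemma submodB u v : W u -> W v -> W (u - v).
Proof. by move=> Wu Wv; apply: submodD => //; apply: submodN. Qed.

Lemma submod_sum (I : eqType) (r : seq I) (P : pred I) (f : I -> V) :
  (forall i, i \in r -> P i -> W (f i)) -> W (\sum_(i <- r | P i) f i).
Proof.
move=> h; rewrite big_seq_cond; apply: (big_ind W) => //.
- by case: hW.
- by move=> *; apply: submodD.
- by move=> i /andP[? ?]; apply: h.
Qed.

End Submod.

Lemma lspan_submod (S : set V) : submod (lspan S).
Proof.
have [h0 h1] := @lspanb_closed _ _ S.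
split=> [|c u v /asboolP Su /asboolP Sv]; first exact/asboolP.
by apply/asboolP; apply: h1.
Qed.

Lemma sub_lspan (S : set V) : S `<=` lspan S.
Proof.
move=> x Sx; exists 1%N, (fun=> 1), (fun=> x); split=> //.
by rewrite big_ord1 scale1r.
Qed.

Lemma lspan_min (S W : set V) : submod W -> S `<=` W -> lspan S `<=` W.
Proof.
move=> hW SW v [n [a [x [Sx ->]]]]; apply: (submod_sum hW) => k _ _.
exact/(submodZ hW)/SW.
Qed.

End LinearSpan.

Section Components.
Variables (I : choiceType) (V : zmodType) (gr : I -> set V).

(** [is_grading] allows repeated indices and arbitrary values of [c] off [s]; asking for [uniq s]
    and for [c] to vanish off [s] makes [c] depend on [v] alone. *)
Definition hdecomp (s : seq I) (c : I -> V) (v : V) :=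
  [/\ uniq s, forall k, gr k (c k), forall k, k \notin s -> c k = 0
    & v = \sum_(k <- s) c k].

Definition hcomp (i : I) (v : V) : V :=
  xget 0 [set x | exists s c, hdecomp s c v /\ x = c i].

Definition hsupp (v : V) : seq I :=
  xget [::] [set s | exists c, hdecomp s c v].

Hypothesis hg : is_grading gr.

Lemma gr0 i : gr i 0. Proof. by case: hg. Qed.
Lemma grB i x y : gr i x -> gr i y -> gr i (x - y).
Proof. by case: hg => _ h _ _; apply: h. Qed.
Lemma grN i x : gr i x -> gr i (- x).
Proof. by move=> h; rewrite -sub0r; apply: grB => //; apply: gr0. Qed.
Lemma grD i x y : gr i x -> gr i y -> gr i (x + y).
Proof. by move=> hx hy; rewrite -[y]opprK; apply/grB/grN. Qed.
Lemma gr_sum i (J : eqType) (r : seq J) (P : pred J) (f : J -> V) :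
  (forall k, k \in r -> P k -> gr i (f k)) -> gr i (\sum_(k <- r | P k) f k).
Proof.
move=> h; rewrite big_seq_cond; apply: (big_ind (gr i)).
- exact: gr0.
- exact: grD.
- by move=> k /andP[? ?]; apply: h.
Qed.

Lemma big_widen_zero (s u : seq I) (c : I -> V) : uniq s -> uniq u ->
  {subset s <= u} -> (forall k, k \notin s -> c k = 0) ->
  \sum_(k <- u) c k = \sum_(k <- s) c k.
Proof.
move=> us uu su c0; rewrite (bigID (mem s)) /= [X in _ + X]big1 => [|k]; last exact: c0.
rewrite addr0 -big_filter; apply: perm_big; apply: uniq_perm => //.
  exact: filter_uniq.
by move=> k; rewrite mem_filter; apply/andP/idP => [[]//|ks]; split=> //; apply: su.
Qed.

Lemma hdecomp_exists v : exists s c, hdecomp s c v.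
Proof.
case: hg => g0 gB /(_ v)[s [c [gc ->]]] _.
(* An index contributes once per occurrence in [s], hence the multiplicity. *)
exists (undup s), (fun k => c k *+ count_mem k s); split.
- exact: undup_uniq.
- move=> k; elim: (count_mem k s) => [|n IH]; rewrite ?mulr0n ?mulrS //.
  exact: grD.
- by move=> k; rewrite mem_undup => /count_memPn ->.
- by rewrite -big_undup_iterop_count; apply: eq_bigr => i _; rewrite Monoid.iteropE iter_addr_0.
Qed.

Lemma hdecomp_unique s c s' c' v i : hdecomp s c v -> hdecomp s' c' v -> c i = c' i.
Proof.
move=> [us gc c0 ev] [us' gc' c0' ev']; set u := undup (s ++ s').
have [iu|niu] := boolP (i \in u); last first.
  by move: niu; rewrite mem_undup mem_cat negb_or => /andP[/c0 -> /c0' ->].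
case: hg => _ _ _ /(_ u (fun k => c k - c' k)) h; apply: subr0_eq; apply: h => //.
- exact: undup_uniq.
- by move=> k; apply: grB.
rewrite sumrB (@big_widen_zero s) -?ev ?(@big_widen_zero s') -?ev' ?subrr ?undup_uniq //.
all: by move=> k ks; rewrite mem_undup mem_cat ks ?orbT.
Qed.

Lemma hcompE s c v i : hdecomp s c v -> hcomp i v = c i.
Proof.
move=> h; apply: xget_unique; first by exists s, c.
by move=> y [s' [c' [h' ->]]]; apply: hdecomp_unique h' h.
Qed.

Lemma hcompP i v : gr i (hcomp i v).
Proof. by have [s [c h]] := hdecomp_exists v; rewrite (hcompE _ h); case: h. Qed.

Lemma hsuppP v : hdecomp (hsupp v) (hcomp^~ v) v.
Proof.
have [c h] : exists c, hdecomp (hsupp v) c v.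
  apply: (@xgetPex _ [::] [set s | exists c, hdecomp s c v]).
  exact: hdecomp_exists.
have e : hcomp^~ v = c by apply: funext => i; apply: hcompE h.
by rewrite e.
Qed.

Lemma hsupp_uniq v : uniq (hsupp v). Proof. by case: (hsuppP v). Qed.

Lemma hsumE v : v = \sum_(k <- hsupp v) hcomp k v.
Proof. by case: (hsuppP v). Qed.

Lemma hcomp_out v k : k \notin hsupp v -> hcomp k v = 0.
Proof. by case: (hsuppP v) => _ _ h _ /h. Qed.

Lemma hdecomp_hom i v : gr i v -> hdecomp [:: i] (fun k => if k == i then v else 0) v.
Proof.
move=> gv; split=> //.
- by move=> k; case: eqP => [->|_] //; apply: gr0.
- by move=> k; rewrite inE => /negPf ->.
- by rewrite big_seq1 eqxx.
Qed.

Lemma hcomp_hom i k v : gr i v -> hcomp k v = if k == i then v else 0.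
Proof. by move=> /hdecomp_hom h; rewrite (hcompE _ h). Qed.

Lemma hcomp_id i v : gr i v -> hcomp i v = v.
Proof. by move=> h; rewrite (hcomp_hom _ h) eqxx. Qed.

Lemma gr_disjoint i k v : gr i v -> gr k v -> i != k -> v = 0.
Proof. by move=> hi hk /negPf ik; rewrite -(hcomp_id hi) (hcomp_hom _ hk) ik. Qed.

Lemma hcompD i : addm (hcomp i).
Proof.
move=> x y; set u := undup (hsupp x ++ hsupp y).
apply: (@hcompE u (fun k => hcomp k x + hcomp k y)); split.
- exact: undup_uniq.
- by move=> k; apply: grD; apply: hcompP.
- move=> k; rewrite mem_undup mem_cat negb_or => /andP[kx ky].
  by rewrite !hcomp_out // addr0.
rewrite big_split /= {1}[x]hsumE {1}[y]hsumE.
congr (_ + _); apply/esym/big_widen_zero; rewrite ?undup_uniq ?hsupp_uniq //.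
- by move=> k ks; rewrite mem_undup mem_cat ks.
- exact: hcomp_out.
- by move=> k ks; rewrite mem_undup mem_cat ks orbT.
- exact: hcomp_out.
Qed.

Lemma homog_ind (W : set V) : W 0 -> (forall u v, W u -> W v -> W (u + v)) ->
  (forall i v, gr i v -> W v) -> forall v, W v.
Proof.
move=> W0 WD Wg v; rewrite [v]hsumE; apply: (big_ind W) => // i _.
exact/Wg/hcompP.
Qed.

Lemma eq_homog (W : zmodType) (f g : V -> W) : addm f -> addm g ->
  (forall i v, gr i v -> f v = g v) -> forall v, f v = g v.
Proof.
move=> fD gD h; apply: homog_ind => [|u v eu ev|]; first by rewrite !addm0.
- by rewrite fD gD eu ev.
- exact: h.
Qed.

(** Assembles maps given degree by degree. The sum may run over any duplicate-free list containing
    the support ([hglue_widen]), which is what additivity needs. *)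
Definition hglue (W : zmodType) (U : I -> V -> W) (v : V) : W :=
  \sum_(k <- hsupp v) U k (hcomp k v).

Lemma hglue_widen (W : zmodType) (U : I -> V -> W) v s : (forall k, addm (U k)) ->
  uniq s -> {subset hsupp v <= s} -> hglue U v = \sum_(k <- s) U k (hcomp k v).
Proof.
move=> UD us sv; rewrite [RHS](bigID (mem (hsupp v))) /= [X in _ + X]big1 => [|k kv].
  rewrite addr0 -big_filter; apply: perm_big; apply: uniq_perm => //.
  - exact: hsupp_uniq.
  - exact: filter_uniq.
  by move=> k; rewrite mem_filter; apply/idP/andP => [ks|[]//]; split=> //; apply: sv.
by rewrite hcomp_out // addm0.
Qed.

Lemma hglueD (W : zmodType) (U : I -> V -> W) : (forall k, addm (U k)) -> addm (hglue U).
Proof.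
move=> UD x y; set u := undup (hsupp x ++ hsupp y ++ hsupp (x + y)).
rewrite !(@hglue_widen _ U _ u) ?undup_uniq //; last 3 first.
- by move=> k ks; rewrite mem_undup !mem_cat ks ?orbT.
- by move=> k ks; rewrite mem_undup !mem_cat ks ?orbT.
- by move=> k ks; rewrite mem_undup !mem_cat ks ?orbT.
by rewrite -big_split; apply: eq_bigr => k _; rewrite hcompD UD.
Qed.

Lemma hglue_hom (W : zmodType) (U : I -> V -> W) i v : (forall k, addm (U k)) ->
  gr i v -> hglue U v = U i v.
Proof.
move=> UD gv; rewrite (@hglue_widen _ U _ (undup (i :: hsupp v))) ?undup_uniq //; last first.
  by move=> k ks; rewrite mem_undup inE ks orbT.
rewrite (bigD1_seq i) ?undup_uniq ?mem_undup ?inE ?eqxx //= hcomp_id // big1 ?addr0 // => k ki.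
by rewrite (hcomp_hom _ gv) (negPf ki) addm0.
Qed.

End Components.

Lemma hcomp_map (I J : choiceType) (V W : zmodType) (gV : I -> set V) (gW : J -> set W)
    (g : V -> W) (f : I -> J) i v : is_grading gV -> is_grading gW -> addm g ->
  injective f -> (forall k x, gV k x -> gW (f k) (g x)) ->
  hcomp gW (f i) (g v) = g (hcomp gV i v).
Proof.
move=> hV hW gD finj hgf; apply: (@eq_homog _ _ _ hV _ (hcomp gW (f i) \o g) (g \o hcomp gV i)).
- by move=> x y /=; rewrite gD hcompD.
- by move=> x y /=; rewrite hcompD // gD.
move=> k x gx /=; rewrite (hcomp_hom hW _ (hgf _ _ gx)) (hcomp_hom hV _ gx) (inj_eq finj).
by case: ifP => // _; rewrite addm0.
Qed.

Section Complements.
Variables (F : fieldType) (V : lmodType F).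

(** A maximal subspace containing [W0] and meeting [K] trivially is a complement of [K]: a vector
    outside C + K could still be adjoined. *)
Lemma exists_complement (K W0 : set V) : submod K -> submod W0 ->
  (forall v, W0 v -> K v -> v = 0) ->
  exists C, [/\ submod C, W0 `<=` C, forall v, C v -> K v -> v = 0
    & forall v, exists2 c, C c & K (v - c)].
Proof.
move=> hK hW0 h0.
pose good (C : set V) := [/\ submod C, W0 `<=` C & forall v, C v -> K v -> v = 0].
(* Chains include the empty one, whose union [set0] is not a subspace; hence the extra disjunct. *)
have [|C [PC maxC]] := @Zorn_bigcup V [set C | C = set0 \/ good C].
  move=> D DP Dtot.
  have [[X0 [DX0 gX0]]|none] := pselect (exists X, D X /\ good X); last first.
    left; apply/seteqP; split=> // x [X DX Xx].
    have [X0|gX] := DP _ DX; first by rewrite X0 in Xx.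
    by case: none; exists X.
  right; have gX X x : D X -> X x -> good X.
    by move=> DX Xx; have [X_0|//] := DP _ DX; rewrite X_0 in Xx.
  split.
  - split=> [|c u v [X DX Xu] [Y DY Yv]]; first by exists X0 => //; case: gX0 => -[].
    have [XY|YX] := Dtot _ _ DX DY.
    + by exists Y => //; have [[_ h] _ _] := gX _ _ DY Yv; apply: h => //; apply: XY.
    + by exists X => //; have [[_ h] _ _] := gX _ _ DX Xu; apply: h => //; apply: YX.
  - by move=> x Wx; exists X0 => //; case: gX0 => _ + _; apply.
  - by move=> v [X DX Xv]; have [_ _] := gX _ _ DX Xv; apply.
have gC : good C.
  case: PC => // C0; case: (maxC W0); last by right; split.
  rewrite C0; split=> [x []|h] //; have h1 : W0 0 := hW0.1; exact: (h _ h1).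
case: gC => sC W0C CK; exists C; split=> // v.
have [//|nv] := pselect (exists2 c, C c & K (v - c)).
pose B := [set x : V | exists2 c, C c & exists a, x = c + a *: v].
have CB : C `<=` B by move=> x Cx; exists x => //; exists 0; rewrite scale0r addr0.
have Bv : B v by exists 0; [case: sC|exists 1; rewrite scale1r add0r].
case: (maxC B).
  split=> // BC; apply: nv; exists v; first exact: BC.
  by rewrite subrr; case: hK.
right; split.
- split=> [|c u w [x Cx [a ->]] [y Cy [b ->]]]; first by apply: CB; case: sC.
  exists (c *: x + y); first by apply: sC.2.
  by exists (c * a + b); rewrite scalerDl scalerDr scalerA addrACA.
- by move=> x /W0C/CB.
move=> x [c Cc [a ->]] Kx; have [a0|a0] := eqVneq a 0.
  by move: Kx; rewrite a0 scale0r addr0; apply: CK.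
case: nv; exists (- a^-1 *: c); first exact: (submodZ sC).
by rewrite scaleNr opprK addrC -[v]scale1r -[1](mulVf a0) -scalerA -scalerDr; apply: (submodZ hK).
Qed.

(** [t] is the coordinate along [w] relative to a complement of the line of [w] that contains
    [W]. *)
Lemma separating_functional (W : set V) w : submod W -> ~ W w ->
  exists t : V -> F, [/\ forall c u v, t (c *: u + v) = c * t u + t v,
    forall v, W v -> t v = 0 & t w = 1].
Proof.
move=> hW nW; pose K := [set x : V | exists a, x = a *: w].
have w0 : w != 0 by apply/eqP => w0; apply: nW; rewrite w0; case: hW.
have [|v|C [sC WC CK CV]] := @exists_complement K W _ hW.
- split; first by exists 0; rewrite scale0r.
  by move=> c _ _ [a ->] [b ->]; exists (c * a + b); rewrite scalerDl scalerA.
- move=> Wv [a ev]; have [a0|a0] := eqVneq a 0; first by rewrite ev a0 scale0r.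
  by case: nW; rewrite -[w]scale1r -(mulVf a0) -scalerA -ev; apply: (submodZ hW).
pose t v := xget 0 [set a | C (v - a *: w)].
have tE v a : C (v - a *: w) -> t v = a.
  move=> Ca; apply: xget_unique => // b Cb; apply/eqP; rewrite -subr_eq0.
  have : (b - a) *: w = 0.
    apply: CK; last by exists (b - a).
    have -> : (b - a) *: w = (v - a *: w) - (v - b *: w).
      by rewrite scalerBl opprB [RHS]addrC addrA subrK.
    exact: (submodB sC).
  by move/eqP; rewrite scaler_eq0 (negPf w0) orbF.
have tP v : C (v - t v *: w).
  have [c Cc [a ea]] := CV v; have h : C (v - a *: w) by rewrite -ea opprB addrC subrK.
  by rewrite (tE _ _ h).
exists t; split=> [c u v|v Wv|].
- apply: tE; rewrite scalerDl opprD addrACA -scalerA -scalerBr.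
  by apply: sC.2; apply: tP.
- by apply: tE; rewrite scale0r subr0; apply: WC.
- by apply: tE; rewrite scale1r subrr; case: sC.
Qed.

End Complements.

(** * Free modules and the augmentation *)

Section LinearMaps.
Variables (R : pzRingType) (U V : lmodType R) (g : U -> V).
Hypothesis gl : linear g.

Lemma lin_addm : addm g.
Proof. by move=> x y; have := gl 1 x y; rewrite !scale1r. Qed.

Lemma linZ a x : g (a *: x) = a *: g x.
Proof. by rewrite -[a *: x]addr0 gl (addm0 lin_addm) addr0. Qed.

End LinearMaps.

Lemma lin_add (R : pzRingType) (U V : lmodType R) (g h : U -> V) :
  linear g -> linear h -> linear (fun x => g x + h x).
Proof. by move=> gl hl a x y; rewrite gl hl scalerDr addrACA. Qed.

Lemma lin_opp (R : pzRingType) (U V : lmodType R) (g : U -> V) :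
  linear g -> linear (fun x => - g x).
Proof. by move=> gl a x y; rewrite gl opprD scalerN. Qed.

Lemma lin_sub (R : pzRingType) (U V : lmodType R) (g h : U -> V) :
  linear g -> linear h -> linear (fun x => g x - h x).
Proof. by move=> gl hl; apply/lin_add/lin_opp. Qed.

Lemma lin_comp (R : pzRingType) (U V W : lmodType R) (g : V -> W) (h : U -> V) :
  linear g -> linear h -> linear (g \o h).
Proof. by move=> gl hl a x y; rewrite /= hl gl. Qed.

Section FreeModules.
Variables (F : fieldType) (A : algType F) (M : lmodType A) (X : set M).

Definition comb (N : lmodType A) (h : M -> N) (r : seq (A * M)) : N :=
  \sum_(p <- r) p.1 *: h p.2.

Definition onX (r : seq (A * M)) := forall p, p \in r -> X p.2.

(** Linear extension from the basis, read off any expression in basis elements; [comb0] makes the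
    choice irrelevant. *)
Definition ext (N : lmodType A) (h : M -> N) (x : M) : N :=
  xget 0 [set y | exists r, [/\ onX r, x = comb id r & y = comb h r]].

Hypothesis hX : is_basis X.

Lemma comb_cat (N : lmodType A) (h : M -> N) r r' : comb h (r ++ r') = comb h r + comb h r'.
Proof. exact: big_cat. Qed.

Lemma comb_scale (N : lmodType A) (h : M -> N) a r :
  comb h [seq (a * p.1, p.2) | p <- r] = a *: comb h r.
Proof. by rewrite /comb big_map scaler_sumr; apply: eq_bigr => p _; rewrite scalerA. Qed.

Lemma onX_cat r r' : onX r -> onX r' -> onX (r ++ r').
Proof. by move=> h h' p; rewrite mem_cat => /orP[/h|/h']. Qed.

Lemma onX_scale a r : onX r -> onX [seq (a * p.1, p.2) | p <- r].
Proof. by move=> h p /mapP[q /h hq ->]. Qed.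

(** Independence in [is_basis] concerns duplicate-free lists, so the coefficients of a repeated
    basis element are added up. *)
Lemma comb_merge (N : lmodType A) (h : M -> N) r :
  comb h r = \sum_(b <- undup (map snd r)) (\sum_(p <- r | p.2 == b) p.1) *: h b.
Proof.
under eq_bigr do rewrite scaler_suml big_mkcond /=.
rewrite exchange_big /= /comb; apply: eq_big_seq => p pr.
rewrite (bigD1_seq p.2) ?undup_uniq ?mem_undup ?map_f //= eqxx big1 ?addr0 // => b.
by rewrite eq_sym => /negPf ->.
Qed.

Lemma comb0 (N : lmodType A) (h : M -> N) r : onX r -> comb id r = 0 -> comb h r = 0.
Proof.
move=> Xr; rewrite !comb_merge => e; case: hX => _ /(_ _ _ _ _ e) h0.
rewrite big_seq big1 // => b br; rewrite h0 ?scale0r ?undup_uniq //.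
by move=> x; rewrite mem_undup => /mapP[p pr ->]; apply: Xr.
Qed.

Lemma comb_exists x : exists2 r, onX r & x = comb id r.
Proof.
have [n [a [y [Xy ->]]]] : lspan X x by rewrite hX.1.
exists [seq (a k, y k) | k <- enum 'I_n]; first by move=> p /mapP[k _ ->]; apply: Xy.
by rewrite /comb big_map big_enum.
Qed.

Lemma extE (N : lmodType A) (h : M -> N) r : onX r -> ext h (comb id r) = comb h r.
Proof.
move=> Xr; apply: xget_unique; first by exists r.
move=> y [r' [Xr' e ->]]; apply/eqP; rewrite -subr_eq0 -scaleN1r -comb_scale -comb_cat.
apply/eqP/comb0; first exact/onX_cat/onX_scale.
by rewrite comb_cat comb_scale scaleN1r e subrr.
Qed.

Lemma ext_linear (N : lmodType A) (h : M -> N) : linear (ext h).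
Proof.
move=> a x y; have [r Xr ->] := comb_exists x; have [r' Xr' ->] := comb_exists y.
rewrite -comb_scale -comb_cat !extE ?comb_cat ?comb_scale //.
exact/onX_cat/Xr'/onX_scale.
Qed.

Lemma ext_basis (N : lmodType A) (h : M -> N) b : X b -> ext h b = h b.
Proof.
move=> Xb; have Xr : onX [:: (1, b)] by move=> p; rewrite inE => /eqP ->.
by have := extE h Xr; rewrite /comb !big_seq1 !scale1r.
Qed.

Lemma eq_on_basis (N : lmodType A) (g h : M -> N) : linear g -> linear h ->
  (forall b, X b -> g b = h b) -> g =1 h.
Proof.
move=> gl hl e x; have [r Xr ->] := comb_exists x.
rewrite /comb !(addm_sum (lin_addm _)) //; apply: eq_big_seq => p pr.
by rewrite !linZ // e //; apply: Xr.
Qed.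

Definition coord (b x : M) : A := ext (fun y => (y == b)%:R : A^o) x.

Lemma coord_linear b : linear (coord b : M -> A^o).
Proof. exact: ext_linear. Qed.

Lemma coordD b : addm (coord b). Proof. exact: (lin_addm (coord_linear b)). Qed.
Lemma coordZ b a x : coord b (a *: x) = a * coord b x.
Proof. exact: (linZ (coord_linear b)). Qed.

Lemma coord_basis b b' : X b' -> coord b b' = (b' == b)%:R.
Proof. exact: (ext_basis (fun y => (y == b)%:R : A^o)). Qed.

Definition csupp (x : M) : seq M :=
  xget [::] [set s | [/\ uniq s, forall b, b \in s -> X b,
    forall b, X b -> b \notin s -> coord b x = 0 & x = \sum_(b <- s) coord b x *: b]].

Lemma csuppP x : [/\ uniq (csupp x), forall b, b \in csupp x -> X b,
  forall b, X b -> b \notin csupp x -> coord b x = 0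
  & x = \sum_(b <- csupp x) coord b x *: b].
Proof.
apply: (@xgetPex _ [::] [set s | [/\ uniq s, forall b, b \in s -> X b,
    forall b, X b -> b \notin s -> coord b x = 0 & x = \sum_(b <- s) coord b x *: b]]).
have [r Xr ->] := comb_exists x; exists (undup (map snd r)).
have cE b : X b -> coord b (comb id r) = \sum_(p <- r | p.2 == b) p.1.
  move=> Xb; rewrite /coord extE // /comb [RHS]big_mkcond /=; apply: eq_bigr => p _.
  by rewrite -[_ *: _]/(_ * _); case: eqP => _; rewrite ?mulr1 ?mulr0.
have uX b : b \in undup (map snd r) -> X b.
  by rewrite mem_undup => /mapP[p pr ->]; apply: Xr.
split=> //; first exact: undup_uniq.
- move=> b Xb nb; rewrite cE // big_seq_cond big1 // => p /andP[pr /eqP pb].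
  by move: nb; rewrite mem_undup -pb map_f.
- rewrite {1}comb_merge; apply: eq_big_seq => b bs; rewrite cE //; exact: uX.
Qed.

Lemma csupp_uniq x : uniq (csupp x). Proof. by case: (csuppP x). Qed.
Lemma csuppX x b : b \in csupp x -> X b. Proof. by case: (csuppP x) => _ + _ _; apply. Qed.
Lemma csumE x : x = \sum_(b <- csupp x) coord b x *: b. Proof. by case: (csuppP x). Qed.

Lemma coord_out x b : X b -> b \notin csupp x -> coord b x = 0.
Proof. by case: (csuppP x) => _ _ h _; apply: h. Qed.

Lemma coord0_eq0 x : (forall b, X b -> coord b x = 0) -> x = 0.
Proof.
move=> h; rewrite [x]csumE big_seq big1 // => b /csuppX/h ->.
exact: scale0r.
Qed.

Lemma basis_neq0 b : X b -> b != 0.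
Proof.
move=> Xb; apply/eqP => b0; have := coord_basis b Xb.
by rewrite eqxx {2}b0 (addm0 (@coordD b)) => /esym/eqP; rewrite oner_eq0.
Qed.

(** The maps [k b] are merely additive, so the result need not be A-linear; this is how F-linear
    functionals of A act on coordinates. *)
Definition cmap (N : lmodType A) (k : M -> A -> A) (h : M -> N) (x : M) : N :=
  \sum_(b <- csupp x) k b (coord b x) *: h b.

Section CoordinateMap.
Variables (N : lmodType A) (k : M -> A -> A) (h : M -> N).
Hypothesis kD : forall b, addm (k b).

Lemma cmap_widen x s : uniq s -> (forall b, b \in s -> X b) ->
  {subset csupp x <= s} -> cmap k h x = \sum_(b <- s) k b (coord b x) *: h b.
Proof.
move=> us sX xs; rewrite [RHS](bigID (mem (csupp x))) /= [X in _ + X]big_seq_cond.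
rewrite [X in _ + X]big1 => [|b /andP[bs nb]].
  rewrite addr0 -big_filter; apply: perm_big; apply: uniq_perm.
  - exact: csupp_uniq.
  - exact: filter_uniq.
  by move=> b; rewrite mem_filter; apply/idP/andP => [bx|[]//]; split=> //; apply: xs.
by rewrite coord_out ?(addm0 (kD b)) ?scale0r //; apply: sX.
Qed.

Lemma cmapD : addm (cmap k h).
Proof.
move=> x y; set u := undup (csupp x ++ csupp y ++ csupp (x + y)).
have uX b : b \in u -> X b.
  by rewrite mem_undup !mem_cat => /or3P[] /csuppX.
rewrite !(@cmap_widen _ u) ?undup_uniq //; last 3 first.
- by move=> b bs; rewrite mem_undup !mem_cat bs ?orbT.
- by move=> b bs; rewrite mem_undup !mem_cat bs ?orbT.
- by move=> b bs; rewrite mem_undup !mem_cat bs ?orbT.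
by rewrite -big_split; apply: eq_bigr => b _; rewrite coordD kD scalerDl.
Qed.

Lemma cmap_basis a b : X b -> cmap k h (a *: b) = k b a *: h b.
Proof.
move=> Xb; have uX b' : b' \in undup (b :: csupp (a *: b)) -> X b'.
  by rewrite mem_undup inE => /orP[/eqP ->|/csuppX].
rewrite (@cmap_widen _ (undup (b :: csupp (a *: b)))) ?undup_uniq //; last first.
  by move=> b' bs; rewrite mem_undup inE bs orbT.
rewrite (bigD1_seq b) ?undup_uniq ?mem_undup ?inE ?eqxx //=.
rewrite coordZ coord_basis // eqxx mulr1 big1 ?addr0 // => b' nb.
by rewrite coordZ coord_basis // eq_sym (negPf nb) mulr0 (addm0 (kD _)) scale0r.
Qed.

End CoordinateMap.

Lemma coord_cmap (k : M -> A -> A) x b : (forall b, addm (k b)) -> X b ->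
  coord b (cmap k id x) = k b (coord b x).
Proof.
move=> kD Xb; rewrite (addm_sum (@coordD b)).
have [bs|nb] := boolP (b \in csupp x); last first.
  rewrite coord_out // (addm0 (kD b)) big_seq big1 // => b' bs'.
  rewrite coordZ (coord_basis _ (csuppX bs')).
  have /negPf -> : b' != b by apply: contraNneq nb => <-.
  by rewrite mulr0.
rewrite (bigD1_seq b) ?csupp_uniq //= coordZ (coord_basis _ Xb) eqxx mulr1.
rewrite big_seq_cond big1 ?addr0 // => b' /andP[bs' nb].
by rewrite coordZ (coord_basis _ (csuppX bs')) (negPf nb) mulr0.
Qed.

Lemma lin_cmap (N : lmodType A) (k : M -> A -> A) (g : M -> N) x : linear g ->
  g (cmap k id x) = cmap k g x.
Proof.
move=> gl; rewrite (addm_sum (lin_addm gl)).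
by apply: eq_bigr => b _; rewrite linZ.
Qed.

End FreeModules.

Section Augmentation.
Variables (F : fieldType) (A : algType F) (gr : nat -> set A).
Hypotheses (hgr : graded_algebra gr) (hconn : connected_algebra gr).

Let hg : is_grading gr. Proof. by case: hgr. Qed.

(** The projection A -> A / A_{>=1} = F; connectedness makes the defining set non-empty. *)
Definition augA (a : A) : F := xget 0 [set c | hcomp gr 0%N a = c%:A].

Lemma alg_inj (c c' : F) : c%:A = c'%:A :> A -> c = c'.
Proof.
move/eqP; rewrite -subr_eq0 -scalerBl scaler_eq0 oner_eq0 orbF subr_eq0.
by move/eqP.
Qed.

Lemma augAE a : hcomp gr 0%N a = (augA a)%:A.
Proof.
apply: (@xgetPex _ 0 [set c | hcomp gr 0%N a = c%:A]).
by have := hcompP hg 0%N a; rewrite hconn => -[c ->]; exists c.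
Qed.

Lemma gr_alg c : gr 0%N c%:A. Proof. by rewrite hconn; exists c. Qed.

Lemma gr0_augA a : gr 0%N a -> a = (augA a)%:A.
Proof. by move=> ga; rewrite -augAE hcomp_id. Qed.

Lemma augA_alg c : augA c%:A = c.
Proof. by apply/esym/alg_inj/(gr0_augA (gr_alg c)). Qed.

Lemma augA1 : augA 1 = 1. Proof. by rewrite -[X in augA X]scale1r augA_alg. Qed.

Lemma augAD : addm augA.
Proof. by move=> a b; apply: alg_inj; rewrite scalerDl -!augAE hcompD. Qed.

Lemma augA_pos i a : (0 < i)%N -> gr i a -> augA a = 0.
Proof.
move=> i0 ga; apply: alg_inj; rewrite -augAE (hcomp_hom hg _ ga) scale0r.
by case: eqP i0 => // <-.
Qed.

Lemma augA_algM c a : augA (c%:A * a) = c * augA a.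
Proof.
move: a; apply: (eq_homog hg) => [x y|x y|i a ga].
- by rewrite mulrDr augAD.
- by rewrite augAD mulrDr.
case: i ga => [/gr0_augA ->|i ga].
  by rewrite -scalerAl mul1r scalerA !augA_alg.
have ga' : gr i.+1 (c%:A * a) by case: hgr => _ _ _ /(_ 0%N i.+1); apply=> //; apply: gr_alg.
by rewrite !(@augA_pos i.+1) ?mulr0.
Qed.

Lemma augAM a b : augA (a * b) = augA a * augA b.
Proof.
move: a; apply: (eq_homog hg) => [x y|x y|i a ga].
- by rewrite mulrDl augAD.
- by rewrite augAD mulrDl.
case: i ga => [/gr0_augA ->|i ga]; first by rewrite augA_algM augA_alg.
rewrite [in RHS](@augA_pos i.+1) // mul0r; move: b.
apply: (eq_homog hg) => [x y|x y|j b gb] //.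
- by rewrite mulrDr augAD.
- by rewrite addr0.
by apply: (@augA_pos (i.+1 + j)) => //; case: hgr => _ _ _; apply.
Qed.

Lemma trivial_homZ (M : lmodType A) (phi : M -> F^o) a x :
  trivial_hom gr phi -> phi (a *: x) = augA a * phi x.
Proof.
move=> [pD pZ p0]; move: a; apply: (eq_homog hg) => [a b|a b|i a ga].
- by rewrite scalerDl pD.
- by rewrite augAD mulrDl.
case: i ga => [/gr0_augA ->|i ga]; first by rewrite pZ augA_alg.
by rewrite (p0 i.+1) // (@augA_pos i.+1) // mul0r.
Qed.

Lemma mul_alg (a : A) (c : F) : a * c%:A = c *: a.
Proof. by rewrite -scalerAr mulr1. Qed.

Lemma alg_mul (a : A) (c : F) : c%:A * a = c *: a.
Proof. by rewrite -scalerAl mul1r. Qed.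

End Augmentation.

(** * Contractions of resolutions *)

(** [t] inverts [f] from its image to a complement of the kernel containing [W0], and vanishes on a
    complement of the image. *)
Lemma linear_section (F : fieldType) (V V' : lmodType F) (f : V -> V') (W0 : set V) :
  linear f -> submod W0 -> (forall v, W0 v -> f v = 0 -> v = 0) ->
  exists t : V' -> V, [/\ linear t, forall v, f (t (f v)) = f v
    & forall v, W0 v -> t (f v) = v].
Proof.
move=> fl sW0 W00; have fD := lin_addm fl.
have sK : submod [set v | f v = 0].
  split=> [|c u v fu fv] /=; first exact: addm0.
  by rewrite fl fu fv scaler0 addr0.
have sI : submod (range f).
  split=> [|c _ _ [u _ <-] [v _ <-]]; first by exists 0 => //; apply: addm0.
  by exists (c *: u + v) => //; rewrite fl.
have s0 : submod [set 0 : V'].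
  by split=> [|c u v -> ->] //=; rewrite scaler0 addr0.
have [C [sC WC CK CV]] := exists_complement sK sW0 W00.
have [|C' [sC' _ CK' CV']] := exists_complement sI s0; first by move=> v ->.
pose t y := xget 0 [set c | C c /\ C' (y - f c)].
have tE y c : C c -> C' (y - f c) -> t y = c.
  move=> Cc Cy; apply: xget_unique => // c' [Cc' Cy']; apply: subr0_eq.
  apply: CK; first exact: (submodB sC).
  rewrite /= (addmB fD); apply: CK'; last by exists (c' - c) => //; rewrite (addmB fD).
  have -> : f c' - f c = (y - f c) - (y - f c') by rewrite opprB [RHS]addrC addrA subrK.
  exact: (submodB sC').
have tP y : C (t y) /\ C' (y - f (t y)).
  have [c' Cc' [v _ fv]] := CV' y; have [c Cc /= fvc] := CV v.
  have h : C' (y - f c).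
    suff -> : f c = y - c' by rewrite opprB addrC subrK.
    by rewrite -fv; apply/eqP; rewrite eq_sym -subr_eq0 -(addmB fD) fvc.
  by rewrite (tE _ _ Cc h).
exists t; split=> [c u v|v|v Wv].
- have [Cu Cu'] := tP u; have [Cv Cv'] := tP v.
  apply: tE; first exact: sC.2.
  by rewrite fl opprD addrACA -scalerBr; apply: sC'.2.
- have [Cv Cv'] := tP (f v); apply/eqP; rewrite eq_sym -subr_eq0; apply/eqP/CK' => //.
  by exists (v - t (f v)) => //; rewrite (addmB fD).
- by apply: tE; [apply: WC|rewrite subrr; case: sC'].
Qed.

(* The A-module M, seen as a vector space over the ground field. *)
Definition rscal (F : fieldType) (A : algType F) (M : lmodType A) : Type := M.

Section RestrictScalars.
Variables (F : fieldType) (A : algType F) (M : lmodType A).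

HB.instance Definition _ := GRing.Zmodule.on (rscal M).

Definition rscale (c : F) (x : rscal M) : rscal M := c%:A *: (x : M).

Lemma rscaleA a b x : rscale a (rscale b x) = rscale (a * b) x.
Proof. by rewrite /rscale scalerA -scalerAl mul1r scalerA. Qed.
Lemma rscale1 : left_id 1 rscale.
Proof. by move=> x; rewrite /rscale !scale1r. Qed.
Lemma rscaleDr : right_distributive rscale +%R.
Proof. by move=> c x y; rewrite /rscale scalerDr. Qed.
Lemma rscaleDl x : {morph rscale^~ x : a b / a + b}.
Proof. by move=> a b; rewrite /rscale !scalerDl. Qed.

HB.instance Definition _ := GRing.Zmodule_isLmodule.Build F (rscal M)
  rscaleA rscale1 rscaleDr rscaleDl.

End RestrictScalars.

Definition flin (F : fieldType) (A : algType F) (M N : lmodType A) (g : M -> N) :=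
  forall (c : F) x y, g (c%:A *: x + y) = c%:A *: g x + g y.

Lemma flin_linear (F : fieldType) (A : algType F) (M N : lmodType A) (g : M -> N) :
  flin g -> linear (g : rscal M -> rscal N).
Proof. by []. Qed.

Lemma linear_flin (F : fieldType) (A : algType F) (M N : lmodType A) (g : M -> N) :
  linear g -> flin g.
Proof. by move=> gl c x y; rewrite gl. Qed.

Lemma flin_addm (F : fieldType) (A : algType F) (M N : lmodType A) (g : M -> N) :
  flin g -> addm g.
Proof. by move/flin_linear/lin_addm. Qed.

Lemma flinZ (F : fieldType) (A : algType F) (M N : lmodType A) (g : M -> N) c x :
  flin g -> g (c%:A *: x) = c%:A *: g x.
Proof. by move=> gf; rewrite -[_ *: x]addr0 gf (addm0 (flin_addm gf)) addr0. Qed.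

Section Contraction.
Variables (F : fieldType) (A : algType F) (gr : nat -> set A).
Hypotheses (hgr : graded_algebra gr) (hconn : connected_algebra gr).
Variable P : resolution gr.

Local Notation d := (res_d P).
Local Notation aug := (res_aug P).

Lemma res_d_linear : linear d. Proof. by move=> a x y; rewrite linearP. Qed.
Lemma res_d_addm : addm d. Proof. by move=> x y; rewrite linearD. Qed.

Lemma res_augD : addm aug. Proof. by case: (res_aug_hom P). Qed.
Lemma res_augZ a x : aug (a *: x) = augA gr a * aug x.
Proof. exact: (trivial_homZ hgr hconn _ _ (res_aug_hom P)). Qed.
Lemma res_aug_alg c x : aug (c%:A *: x) = c * aug x.
Proof. by rewrite res_augZ (augA_alg hgr hconn). Qed.

Lemma res_gr_alg c nj x : res_gr P nj x -> res_gr P nj (c%:A *: x).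
Proof.
case: nj => n j h; rewrite -[j]add0r; apply: (res_gr_scale (i := 0%N)) h.
exact: gr_alg.
Qed.

Lemma res_gr_neg n j x : n < 0 -> res_gr P (n, j) x -> x = 0.
Proof. exact: res_nonneg. Qed.

(** An F-linear homotopy d s + s d = id - aug x0 on the augmented complex, where [x0] lifts 1. The
    side conditions s s = 0 and s x0 = 0 are used repeatedly to cancel terms of the recursions. *)
Record contraction (s : P -> P) (x0 : P) : Prop := Contraction {
  ctr_flin : flin s;
  ctr_gr : forall n j x, res_gr P (n, j) x -> res_gr P (n + 1, j) (s x);
  ctr_s : forall x, s (s x) = 0;
  ctr_x0 : s x0 = 0;
  ctr_x0_gr : res_gr P (0, 0) x0;
  ctr_x0_aug : aug x0 = 1;
  ctr_homotopy : forall x, d (s x) = x - (aug x)%:A *: x0 - s (d x)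
}.

Lemma exists_aug1 : exists2 x0, res_gr P (0, 0) x0 & aug x0 = 1.
Proof.
have hg := res_grading P; have [x ex] := res_aug_surj P.
exists (hcomp (res_gr P) (0, 0) x); first exact: hcompP.
rewrite -ex; move: x {ex}; apply: (eq_homog hg) => [x y|x y|nj x gx].
- by rewrite hcompD // res_augD.
- by rewrite res_augD.
rewrite (hcomp_hom hg _ gx); case: eqP => [//|ne].
by rewrite (addm0 res_augD) (res_aug_degree _ gx) // => e; case: ne.
Qed.

(** With [t] a section of d over F, [z] projects onto the image of d and s = t z. As z t vanishes on
    boundaries, s s = 0; as t (d b) = b on [X0], also z b = 0. *)
Lemma exists_contraction (X0 : set P) :
  (forall b, X0 b -> exists nj, res_gr P nj b) -> (forall b, X0 b -> aug b = 0) ->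
  (forall v : rscal P, lspan (X0 : set (rscal P)) v -> d v = 0 -> v = 0) ->
  exists s x0, contraction s x0 /\ forall b, X0 b -> s b = 0.
Proof.
move=> X0h X0aug X0d; have hg := res_grading P.
have [x0 gx0 ax0] := exists_aug1.
have dl : linear (d : rscal P -> rscal P) by apply/flin_linear/linear_flin/res_d_linear.
have [t0 [t0l dt0 t0W]] := linear_section dl (lspan_submod _) X0d.
(* [t0] need not respect bidegrees: only its component one level up is kept, which is still a
   section since d is homogeneous. *)
pose U (nj : int * int) (y : P) : P := hcomp (res_gr P) (nj.1 + 1, nj.2) (t0 y).
have UD k : addm (U k) by move=> x y; rewrite /U (lin_addm t0l) hcompD.
pose t := hglue (res_gr P) U.
have tD : addm t by apply: hglueD.
have t_hom nj y : res_gr P nj y -> t y = hcomp (res_gr P) (nj.1 + 1, nj.2) (t0 y).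
  by move=> gy; rewrite /t (hglue_hom hg UD gy).
have t_flin : flin t.
  move=> c x y; rewrite tD; congr (_ + _); move: x.
  apply: (eq_homog hg) => [x z|x z|nj x gx].
  - by rewrite scalerDr tD.
  - by rewrite tD scalerDr.
  rewrite (t_hom nj) ?(t_hom nj x) //; last exact: res_gr_alg.
  rewrite -[c%:A *: x]/(c *: (x : rscal P)) (linZ t0l).
  move: (t0 x); apply: (eq_homog hg) => [u v|u v|k u gu].
  - by rewrite scalerDr hcompD.
  - by rewrite hcompD // scalerDr.
  rewrite (hcomp_hom hg _ gu) (hcomp_hom hg _ (res_gr_alg c gu)).
  by case: ifP => // _; rewrite scaler0.
have t_gr n j x : res_gr P (n, j) x -> res_gr P (n + 1, j) (t x).
  by move=> gx; rewrite (t_hom _ _ gx); apply: hcompP.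
have d_hom (nj : int * int) x : hcomp (res_gr P) (nj.1 - 1, nj.2) (d x)
    = d (hcomp (res_gr P) nj x).
  apply: (@hcomp_map _ _ _ _ _ (res_gr P) d (fun nj => (nj.1 - 1, nj.2))) => //.
  - exact: res_d_addm.
  - by move=> [n j] [n' j'] /= [/addIr -> ->].
  - by move=> [n j] y; apply: res_d_degree.
have dtd x : d (t (d x)) = d x.
  move: x; apply: (eq_homog hg) => [x y|x y|[n j] x gx].
  - by rewrite linearD tD linearD.
  - by rewrite linearD.
  rewrite (t_hom _ _ (res_d_degree gx)) -d_hom /= dt0 subrK.
  by rewrite hcomp_id //; apply: res_d_degree.
have tdX0 b : X0 b -> t (d b) = b.
  move=> X0b; have [[n j] gb] := X0h _ X0b.
  rewrite (t_hom _ _ (res_d_degree gb)) /= subrK t0W ?hcomp_id //.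
  exact: sub_lspan.
have aug_t x : aug (t x) = 0.
  move: x; apply: (@eq_homog _ _ _ hg _ (fun x => aug (t x)) (fun=> 0)) => [x y|x y|[n j] x gx].
  - by rewrite tD res_augD.
  - by rewrite addr0.
  have [n0|n0] := eqVneq (n + 1, j) (0, 0); last first.
    by apply: (res_aug_degree _ (t_gr _ _ _ gx)) => e; rewrite e eqxx in n0.
  rewrite (@res_gr_neg n j x) //; last by case: n0; lia.
  by rewrite (addm0 tD) (addm0 res_augD).
pose z x := x - t (d x) - (aug x)%:A *: x0.
have zD : addm z.
  move=> x y; rewrite /z linearD tD res_augD !scalerDl /=.
  by rewrite !opprD [RHS]addrACA; congr (_ + _); apply: addrACA.
have dx0 : d x0 = 0 by apply: (@res_gr_neg _ _ _ _ (res_d_degree gx0)).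
have z_im x : exists y, z x = d y.
  move: x; apply: (homog_ind hg).
  - by exists 0; rewrite linear0 (addm0 zD).
  - by move=> u v [y ey] [y' ey']; exists (y + y'); rewrite zD linearD ey ey'.
  move=> [n j] x gx; have [n0|n0|n0] := ltgtP n 0.
  - by exists 0; rewrite (res_gr_neg n0 gx) (addm0 zD) linear0.
  - have ax : aug x = 0 by apply: (res_aug_degree _ gx) => -[e]; rewrite e ltxx in n0.
    rewrite /z ax !scale0r subr0.
    have g1 : res_gr P (n, j) (x - t (d x)).
      by apply: grB => //; rewrite -[n](subrK 1); apply/t_gr/res_d_degree.
    have [|y _ <-] := res_exact n0 g1; last by exists y.
    by rewrite linearB dtd subrr.
  - move: gx; rewrite n0 => gx; have dx : d x = 0.
      exact: (@res_gr_neg _ _ _ _ (res_d_degree gx)).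
    rewrite /z dx (addm0 tD) subr0.
    have g1 : res_gr P (0, j) (x - (aug x)%:A *: x0).
      have [j0|j0] := eqVneq j 0; first by rewrite j0 in gx *; apply: grB => //; apply: res_gr_alg.
      rewrite (res_aug_degree _ gx) ?scale0r ?scale0r ?subr0 //.
      by case=> e; rewrite e eqxx in j0.
    have [|y _ <-] := res_exact0 g1; last by exists y.
    by rewrite (addmB res_augD) res_aug_alg ax0 mulr1 subrr.
pose s x := t (z x).
have z_flin : flin z.
  move=> c x y; rewrite zD; congr (_ + _); rewrite /z linearZ (flinZ _ _ t_flin) res_aug_alg.
  by rewrite !scalerBr scalerA -scalerAl mul1r scalerA.
exists s, x0; split; first split=> //.
- by move=> c x y; rewrite /s z_flin t_flin.
- move=> n j x gx; apply/t_gr; apply: grB => //.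
    by apply: grB => //; rewrite -[n](subrK 1); apply/t_gr/res_d_degree.
  have [e|ne] := eqVneq (n, j) (0, 0); first by rewrite e; apply: res_gr_alg.
  rewrite (res_aug_degree _ gx) ?scale0r ?scale0r; first exact: gr0.
  by move=> e; rewrite e eqxx in ne.
- move=> x; rewrite /s; have [y ->] := z_im x.
  by rewrite /z dtd subrr aug_t !scale0r subr0 (addm0 tD).
- rewrite /s /z dx0 (addm0 tD) subr0 ax0 !scale1r subrr; exact: addm0.
- move=> x; have [y ey] := z_im x.
  rewrite /s ey dtd -ey {2}/z res_dd (addm0 tD) res_aug_d !scale0r !subr0.
  by rewrite /z addrAC.
- move=> b X0b; rewrite /s /z tdX0 // subrr X0aug // !scale0r subr0; exact: addm0.
Qed.

Section ContractionTheory.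
Variables (s : P -> P) (x0 : P).
Hypothesis hs : contraction s x0.

Lemma ctr_addm : addm s. Proof. exact/flin_addm/(ctr_flin hs). Qed.

Lemma ctr_aug x : aug (s x) = 0.
Proof.
have hg := res_grading P; move: x.
apply: (@eq_homog _ _ _ hg _ (fun x => aug (s x)) (fun=> 0)) => [x y|x y|[n j] x gx].
- by rewrite ctr_addm res_augD.
- by rewrite addr0.
have [n0|n0] := eqVneq (n + 1, j) (0, 0); last first.
  by apply: (res_aug_degree _ (ctr_gr hs gx)) => e; rewrite e eqxx in n0.
rewrite (@res_gr_neg n j x) //; last by case: n0; lia.
by rewrite (addm0 ctr_addm) (addm0 res_augD).
Qed.

Lemma ctr_dx0 : d x0 = 0.
Proof. exact: (@res_gr_neg _ _ _ _ (res_d_degree (ctr_x0_gr hs))). Qed.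

End ContractionTheory.
End Contraction.

(** * Koszul signs and recursion along the levels *)

Section Signs.
Variable R : pzRingType.

Lemma sgnE (z : int) : sgn R z = (-1) ^+ odd `|z|%N.
Proof. by rewrite /sgn signr_odd. Qed.

Lemma sgnD (a b : int) : sgn R (a + b) = sgn R a * sgn R b.
Proof. by rewrite !sgnE -signr_addb; congr (_ ^+ nat_of_bool _); lia. Qed.

Lemma sgnN (a : int) : sgn R (- a) = sgn R a.
Proof. by rewrite /sgn abszN. Qed.

Lemma sgnS (a : int) : sgn R (a + 1) = - sgn R a.
Proof. by rewrite sgnD /sgn expr1 mulrN1. Qed.

Lemma sgnB1 (a : int) : sgn R (a - 1) = - sgn R a.
Proof. by rewrite sgnD sgnN /sgn expr1 mulrN1. Qed.

Lemma sgn_sq (a : int) : sgn R a * sgn R a = 1.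
Proof. by rewrite -sgnD sgnE (_ : odd _ = false) //; lia. Qed.

Lemma sgn0 : sgn R 0 = 1. Proof. by []. Qed.

Lemma sgn_double (a c : int) : sgn R (a + c + c) = sgn R a.
Proof. by rewrite -addrA sgnD [X in _ * X]sgnE (_ : odd _ = false) ?mulr1 //; lia. Qed.

End Signs.

Lemma sgn_alg (F : fieldType) (A : algType F) (z : int) : sgn A z = (sgn F z)%:A.
Proof. by rewrite !sgnE; case: odd; rewrite ?expr1 ?expr0 ?scale1r ?scaleN1r. Qed.

Section Parity.
Variables (F : fieldType) (A : algType F) (gr : nat -> set A).
Hypotheses (hgr : graded_algebra gr) (hconn : connected_algebra gr).
Variable P : resolution gr.

Let hg : is_grading (res_gr P) := res_grading P.

(** The involution (-1)^n on P_n. Conjugation by it multiplies a map of cohomological degree p by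
    (-1)^p, so Koszul signs need no mention of degrees; d and every contraction anticommute with
    it. *)
Definition parity (x : P) : P :=
  hglue (res_gr P) (fun nj y => sgn A nj.1 *: y) x.

Let UD (k : int * int) : addm (fun y : P => sgn A k.1 *: y).
Proof. by move=> x y; rewrite scalerDr. Qed.

Lemma parityD : addm parity. Proof. exact: hglueD. Qed.

Lemma parity_hom n j x : res_gr P (n, j) x -> parity x = sgn A n *: x.
Proof. by move=> gx; rewrite /parity (hglue_hom hg UD gx). Qed.

Lemma parity_linear : linear parity.
Proof.
move=> a x y; rewrite parityD; congr (_ + _).
move: x; apply: (eq_homog hg) => [u v|u v|[n j] x gx].
- by rewrite scalerDr parityD.
- by rewrite parityD scalerDr.
have hgA : is_grading gr by case: hgr.
move: a; apply: (eq_homog hgA) => [a b|a b|i a ga].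
- by rewrite scalerDl parityD.
- by rewrite scalerDl.
rewrite (parity_hom (res_gr_scale ga gx)) (parity_hom gx) !scalerA !sgnE.
by case: odd; rewrite ?expr1 ?expr0 ?mulN1r ?mulrN1 ?mul1r ?mulr1.
Qed.

Lemma parity_gr nj x : res_gr P nj x -> res_gr P nj (parity x).
Proof.
case: nj => n j gx; rewrite (parity_hom gx) sgn_alg.
exact: (res_gr_alg hconn).
Qed.

Lemma parityK x : parity (parity x) = x.
Proof.
move: x; apply: (@eq_homog _ _ _ hg _ (parity \o parity) id) => [x y|x y|[n j] x gx] //=.
- by rewrite !parityD.
by rewrite (parity_hom gx) (linZ parity_linear) (parity_hom gx) scalerA sgn_sq scale1r.
Qed.

Lemma d_parity x : res_d P (parity x) = - parity (res_d P x).
Proof.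
move: x; apply: (@eq_homog _ _ _ hg) => [x y|x y|[n j] x gx] //=.
- by rewrite parityD linearD.
- by rewrite linearD parityD opprD.
by rewrite (parity_hom gx) (parity_hom (res_d_degree gx)) linearZ sgnB1 scaleNr opprK.
Qed.

Lemma aug_parity x : res_aug P (parity x) = res_aug P x.
Proof.
move: x; apply: (@eq_homog _ _ _ hg) => [x y|x y|[n j] x gx] //=.
- by rewrite parityD res_augD.
- by rewrite res_augD.
rewrite (parity_hom gx) sgn_alg (res_aug_alg hgr hconn).
have [->|n0] := eqVneq n 0; first by rewrite sgn0 mul1r.
by rewrite (res_aug_degree _ gx) ?mulr0 // => -[e]; rewrite e eqxx in n0.
Qed.

Lemma s_parity s x0 x : contraction s x0 -> s (parity x) = - parity (s x).
Proof.
move=> hs; have sD := ctr_addm hs.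
move: x; apply: (@eq_homog _ _ _ hg) => [x y|x y|[n j] x gx] //=.
- by rewrite parityD sD.
- by rewrite sD parityD opprD.
rewrite (parity_hom gx) (parity_hom (ctr_gr hs gx)) sgnS scaleNr opprK.
by rewrite sgn_alg (flinZ _ _ (ctr_flin hs)).
Qed.

End Parity.

Section ResolutionBasis.
Variables (F : fieldType) (A : algType F) (gr : nat -> set A).
Hypotheses (hgr : graded_algebra gr) (hconn : connected_algebra gr).
Variables (P : resolution gr) (X : set P).
Hypothesis hXh : X `<=` [set x | exists nj, res_gr P nj x].
Hypothesis hX : is_basis X.

Let hg : is_grading (res_gr P) := res_grading P.
Let hgA : is_grading gr. Proof. by case: hgr. Qed.

Definition deg (b : P) : int * int := xget (0, 0) [set nj | res_gr P nj b].
Definition lev (b : P) : nat := `|(deg b).1|%N.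

Lemma degP b : X b -> res_gr P (deg b) b.
Proof. by move=> /hXh h; apply: (@xgetPex _ (0, 0) [set nj | res_gr P nj b]). Qed.

Lemma deg_unique nj b : X b -> res_gr P nj b -> deg b = nj.
Proof.
move=> Xb gb; apply/eqP/negPn/negP => ne.
by have := basis_neq0 hX Xb; rewrite (gr_disjoint hg (degP Xb) gb ne) eqxx.
Qed.

Lemma degE b : X b -> (deg b).1 = (lev b)%:Z.
Proof.
move=> Xb; rewrite /lev; have [//|n0] := lerP 0 (deg b).1; first by lia.
have := basis_neq0 hX Xb; rewrite (@res_nonneg _ _ _ P (deg b).1 (deg b).2 b) ?eqxx //.
by case: (deg b) (degP Xb).
Qed.

Lemma degP' b : X b -> res_gr P ((deg b).1, (deg b).2) b.
Proof. by move=> /degP; case: (deg b). Qed.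

Lemma eq_on_hbasis (W : zmodType) (f g : P -> W) : addm f -> addm g ->
  (forall i a b, gr i a -> X b -> f (a *: b) = g (a *: b)) -> f =1 g.
Proof.
move=> fD gD h x; rewrite [x](csumE hX) !addm_sum //; apply: eq_big_seq => b bx.
have Xb := csuppX hX bx; move: (coord X b x).
apply: (eq_homog hgA) => [u v|u v|i a ga]; rewrite ?scalerDl ?fD ?gD //.
exact: h ga Xb.
Qed.

(** Internal degrees of P are integers, those of A naturals: in a negative difference of degrees a
    coefficient has component 0. *)
Definition hcompZ (z : int) (a : A) : A :=
  match z with Posz i => hcomp gr i a | Negz _ => 0 end.

Definition grZ (z : int) : set A :=
  match z with Posz i => gr i | Negz _ => [set 0] end.

Lemma grZ_ge0 z a : 0 <= z -> grZ z a -> gr `|z|%N a.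
Proof. by case: z. Qed.

Lemma grZ_lt0 z a : z < 0 -> grZ z a -> a = 0.
Proof. by case: z. Qed.

Lemma coord_hcomp n j b x : X b -> coord X b (hcomp (res_gr P) (n, j) x) =
  if n == (deg b).1 then hcompZ (j - (deg b).2) (coord X b x) else 0.
Proof.
move=> Xb; have hZ0 z : hcompZ z 0 = 0 by case: z => //= i; rewrite (addm0 (hcompD hgA i)).
move: x; apply: eq_on_hbasis => [x y|x y|i a b' ga Xb'].
- by rewrite (hcompD hg) (coordD hX).
- rewrite (coordD hX); case: ifP => _; rewrite ?addr0 //.
  by case: (j - _) => i /=; rewrite ?(hcompD hgA) ?addr0.
have gab : res_gr P ((deg b').1, i%:Z + (deg b').2) (a *: b').
  exact/res_gr_scale/degP'.
rewrite (hcomp_hom hg _ gab) xpair_eqE (fun_if (coord X b)) (addm0 (coordD hX b)).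
rewrite !(coordZ hX) !(coord_basis hX _ Xb').
have [->|ne] := eqVneq b' b; last by rewrite /= mulr0 hZ0 !if_same.
rewrite mulr1; case: eqP => // _ /=; case: eqP => [->|ne].
  by rewrite addrK /= hcomp_id.
case e : (j - _) => [k|k] //=; rewrite (hcomp_hom hgA _ ga).
by case: eqP => // ki; case: ne; rewrite -ki -e subrK.
Qed.

Lemma coord_grZ n j b x : X b -> res_gr P (n, j) x -> grZ (j - (deg b).2) (coord X b x).
Proof.
move=> Xb gx; rewrite -(hcomp_id hg gx) coord_hcomp //.
case: eqP => _; case: (_ - _) => k //=; first exact: hcompP.
exact: gr0.
Qed.

Lemma coord_lev n j b x : X b -> res_gr P (n, j) x -> n != (deg b).1 -> coord X b x = 0.
Proof. by move=> Xb gx /negPf ne; rewrite -(hcomp_id hg gx) coord_hcomp // ne. Qed.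

Lemma coord_low n j b x : X b -> res_gr P (n, j) x -> j < (deg b).2 -> coord X b x = 0.
Proof. by move=> Xb gx lt; apply: grZ_lt0 (coord_grZ Xb gx); rewrite subr_lt0. Qed.

Lemma coord_alg n j b x : X b -> res_gr P (n, j) x -> j = (deg b).2 ->
  coord X b x = (augA gr (coord X b x))%:A.
Proof. by move=> Xb gx e; apply: gr0_augA => //; have := coord_grZ Xb gx; rewrite e subrr. Qed.

(** An element of bidegree (n, j) involves only generators of level n and internal degree at most j,
    since A lives in degrees >= 0. *)
Lemma lin_eq_gr (N : lmodType A) (g h : P -> N) n j x : linear g -> linear h ->
  res_gr P (n, j) x ->
  (forall b, X b -> (deg b).1 = n -> (deg b).2 <= j -> g b = h b) -> g x = h x.
Proof.
move=> gl hl gx e; rewrite [x](csumE hX) !(addm_sum (lin_addm _)) //.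
apply: eq_big_seq => b bx; have Xb := csuppX hX bx; rewrite !linZ //.
have [nb|nb] := eqVneq n (deg b).1; last by rewrite (coord_lev Xb gx nb) !scale0r.
have [jb|jb] := lerP (deg b).2 j; last by rewrite (coord_low Xb gx jb) !scale0r.
by rewrite e.
Qed.

Lemma lin_degree (Q : resolution gr) (g : P -> Q) p q n i x : linear g ->
  (forall b, X b -> (deg b).1 = n -> res_gr Q ((deg b).1 - p, (deg b).2 - q) (g b)) ->
  res_gr P (n, i) x -> res_gr Q (n - p, i - q) (g x).
Proof.
move=> gl hb gx; have hgQ := res_grading Q.
rewrite [x](csumE hX) (addm_sum (lin_addm gl)).
apply: (gr_sum hgQ) => b bx _; have Xb := csuppX hX bx; rewrite (linZ gl).
have [nb|nb] := eqVneq n (deg b).1; last first.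
  by rewrite (coord_lev Xb gx nb) scale0r; apply: gr0.
have [jb|jb] := lerP (deg b).2 i; last first.
  by rewrite (coord_low Xb gx jb) scale0r; apply: gr0.
have ga := grZ_ge0 _ (coord_grZ Xb gx); rewrite subr_ge0 in ga.
have := res_gr_scale (ga jb) (hb _ Xb (esym nb)); rewrite nb.
by rewrite gez0_abs ?subr_ge0 // addrA subrK.
Qed.

Lemma gr_low n j x : (forall b, X b -> (deg b).1 = n -> j < (deg b).2) ->
  res_gr P (n, j) x -> x = 0.
Proof.
move=> h gx; apply: (coord0_eq0 hX) => b Xb.
have [nb|nb] := eqVneq n (deg b).1; last exact: coord_lev gx nb.
by apply: coord_low gx _ => //; apply: h.
Qed.

Section Rec.
Variables (Q : resolution gr) (s : Q -> Q) (x0 : Q).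
Hypothesis hs : contraction s x0.

Local Notation d := (res_d P).
Local Notation sg := (@parity F A gr _).

(** The recursion g(b) = beta b + s (sg (g (sg (d b)))) on generators, well founded because d b is
    one level lower; m bounds the unfoldings, and lev b + 1 of them suffice. Lifts of cochains and
    homotopies both have this shape. *)
Fixpoint rec_iter (beta : P -> Q) (m : nat) : P -> Q :=
  if m is m'.+1
  then ext X (fun b => beta b + s (sg (rec_iter beta m' (sg (d b)))))
  else fun=> 0.

Definition rec (beta : P -> Q) : P -> Q :=
  ext X (fun b => rec_iter beta (lev b).+1 b).

Let sD : addm s := ctr_addm hs.
Let sgl := parity_linear hgr.
Let sgD R : addm (@parity F A gr R) := @parityD F A gr R.

Lemma rec_iter_linear beta m : linear (rec_iter beta m).
Proof.
case: m => [|m] /=; last exact: ext_linear.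
by move=> a x y; rewrite scaler0 addr0.
Qed.

Lemma rec_linear beta : linear (rec beta).
Proof. exact: ext_linear. Qed.

Lemma sgd_gr b : X b -> res_gr P ((lev b)%:Z - 1, (deg b).2) (sg (d b)).
Proof. by move=> Xb; rewrite -degE //; apply/(parity_gr hconn)/res_d_degree/degP'. Qed.

Lemma sgd_lev0 b : X b -> lev b = 0%N -> sg (d b) = 0.
Proof. by move=> /sgd_gr + e; rewrite e; apply: res_nonneg. Qed.

Lemma lin_eq_sgd (g h : P -> Q) b : X b -> linear g -> linear h ->
  (forall b', X b' -> (lev b').+1 = lev b -> g b' = h b') -> g (sg (d b)) = h (sg (d b)).
Proof.
move=> Xb gl hl e; apply: (lin_eq_gr gl hl (sgd_gr Xb)) => b' Xb' l _.
by apply: e => //; move: l; rewrite degE //; lia.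
Qed.

Lemma rec_iterS beta m b : X b ->
  rec_iter beta m.+1 b = beta b + s (sg (rec_iter beta m (sg (d b)))).
Proof. by move=> Xb; rewrite /= (ext_basis hX). Qed.

Lemma recE beta b : X b -> rec beta b = beta b + s (sg (rec beta (sg (d b)))).
Proof.
move=> Xb; rewrite {1}/rec (ext_basis hX) // (rec_iterS _ _ Xb); congr (_ + s (sg _)).
apply: (lin_eq_sgd Xb) => [||b' Xb' l]; try exact: rec_iter_linear.
  exact: rec_linear.
by rewrite /rec (ext_basis hX) // l.
Qed.

Lemma rec_unique0 (g : P -> Q) : linear g ->
  (forall b, X b -> g b = s (sg (g (sg (d b))))) -> forall x, g x = 0.
Proof.
move=> gl e; have z : linear (fun _ : P => 0 : Q) by move=> a x y; rewrite scaler0 addr0.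
have h n b : X b -> lev b = n -> g b = 0.
  elim/ltn_ind: n b => n IH b Xb lb; rewrite e //.
  rewrite (lin_eq_sgd Xb gl z) ?(addm0 (@sgD _)) ?(addm0 sD) // => b' Xb' l.
  by apply: (IH (lev b')) => //; rewrite -lb -l.
by apply: (eq_on_basis hX gl z) => b Xb; apply: h.
Qed.

(** The tool for identities between maps: a linear map obeying the recursion on generators is the
    recursive one, the difference of two solutions being zero by induction on the level. *)
Lemma rec_unique beta (g : P -> Q) : linear g ->
  (forall b, X b -> g b = beta b + s (sg (g (sg (d b))))) -> g =1 rec beta.
Proof.
move=> gl e x; apply/eqP; rewrite -subr_eq0; apply/eqP.
apply: (@rec_unique0 (fun x => g x - rec beta x)) => [a u v|b Xb].
  by rewrite gl rec_linear opprD addrACA -scalerBr.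
rewrite (e _ Xb) (recE _ Xb) opprD addrACA subrr add0r.
by rewrite (addmB (@sgD _)) (addmB sD).
Qed.

Lemma rec_flin c beta beta' x :
  rec (fun b => c%:A *: beta b + beta' b) x = c%:A *: rec beta x + rec beta' x.
Proof.
have sgc (R : resolution gr) (c' : F) (y : R) : sg (c'%:A *: y) = c'%:A *: sg y.
  exact: linZ.
symmetry; move: x; apply: rec_unique => [a x y|b Xb].
  have swap (z : Q) : c%:A *: (a *: z) = a *: (c%:A *: z).
    by rewrite !scalerA mul_alg alg_mul.
  by rewrite !rec_linear !scalerDr swap addrACA.
rewrite !(recE _ Xb) sgD sD sgc (flinZ _ _ (ctr_flin hs)) scalerDr; exact: addrACA.
Qed.

Lemma eq_rec beta beta' x : (forall b, X b -> beta b = beta' b) -> rec beta x = rec beta' x.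
Proof.
move=> e; move: x; apply: rec_unique; first exact: rec_linear.
by move=> b Xb; rewrite (recE _ Xb) e.
Qed.

Lemma rec_degree p q beta n i x :
  (forall b, X b -> res_gr Q ((deg b).1 - p, (deg b).2 - q) (beta b)) ->
  res_gr P (n, i) x -> res_gr Q (n - p, i - q) (rec beta x).
Proof.
move=> hb; have h m b : X b -> lev b = m ->
    res_gr Q ((deg b).1 - p, (deg b).2 - q) (rec beta b).
  elim: m b => [|m IH] b Xb lb; rewrite (recE _ Xb).
    rewrite sgd_lev0 // (addm0 (lin_addm (rec_linear _))) (addm0 (@sgD _)) (addm0 sD) addr0.
    exact: hb.
  apply: (grD (res_grading Q)); first exact: hb.
  have -> : (deg b).1 - p = (lev b)%:Z - 1 - p + 1 by rewrite degE //; lia.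
  apply/(ctr_gr hs)/(parity_gr hconn)/lin_degree; [exact: rec_linear| |exact: sgd_gr].
  by move=> b' Xb' l; apply: IH => //; move: l; rewrite degE // lb; lia.
by apply: lin_degree => [|b Xb _]; [exact: rec_linear|exact: h].
Qed.

(** Both s and d anticommute with the involution, and in the recursion these two signs cancel. *)
Lemma rec_parity beta x : flin beta ->
  sg (rec beta (sg x)) = rec (fun b => sg (beta (sg b))) x.
Proof.
move=> bf; move: x; apply: rec_unique => [a x y|b Xb]; first by rewrite sgl rec_linear sgl.
have e2 : (sgn F (deg b).1)%:A * (sgn F (deg b).1)%:A = 1 :> A.
  by rewrite alg_mul scalerA sgn_sq scale1r.
have sb : sg b = (sgn F (deg b).1)%:A *: b by rewrite (parity_hom (degP' Xb)) sgn_alg.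
have sdb : sg (d b) = - ((sgn F (deg b).1)%:A *: d b).
  by rewrite -linearZ -sb d_parity opprK.
rewrite sb (linZ (rec_linear beta)) (recE _ Xb) (flinZ _ _ bf) !(linZ (@sgl _)) sgD scalerDr.
congr (_ + _); have ss y : sg (s (sg y)) = - s y.
  by rewrite (s_parity _ hs) (addmN (@sgD _)) (parityK hgr).
rewrite ss !(parityK hgr) sdb (addmN (lin_addm (rec_linear _))) (linZ (rec_linear _)).
by rewrite (addmN sD) opprK (flinZ _ _ (ctr_flin hs)) scalerA e2 scale1r.
Qed.

End Rec.
End ResolutionBasis.

(** * Lifts and homotopies *)

Section HomComplex.
Variables (F : fieldType) (A : algType F) (gr : nat -> set A).
Hypotheses (hgr : graded_algebra gr) (hconn : connected_algebra gr).
Variables (P : resolution gr) (X : set P).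
Hypothesis hXh : X `<=` [set x | exists nj, res_gr P nj x].
Hypothesis hX : is_basis X.
Variables (Q : resolution gr) (s : Q -> Q) (x0 : Q).
Hypothesis hs : contraction s x0.

Local Notation sg := (@parity F A gr _).
Local Notation aug := (res_aug _).
Let sD : addm s := ctr_addm hs.
Let sF : flin s := ctr_flin hs.
Let sgl := parity_linear hgr.
Let sgD R : addm (@parity F A gr R) := @parityD F A gr R.
Let recl (beta : P -> Q) := rec_linear hX s beta.
Let recE' (beta : P -> Q) b (Xb : X b) := recE hgr hconn hXh hX s beta Xb.
Let rec_unique' := @rec_unique _ _ _ hgr hconn _ _ hXh hX _ _ _ hs.
Let rec_unique0' := @rec_unique0 _ _ _ hgr hconn _ _ hXh hX _ _ _ hs.

(* The differential of Hom_A(P, Q): conjugating by the parity sg yields the Koszul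
   sign of g, whatever its degree. *)
Definition dif (g : P -> Q) (x : P) : Q := res_d Q (g x) - sg (g (sg (res_d P x))).
(** [htp] is an A-linear homotopy contracting Hom_A(P, Q) onto the lifts of cochains, and [lift]
    extends a cochain to a map P -> Q over the augmentation; [dif_htp] is the homotopy identity. *)
Definition htp (u : P -> Q) : P -> Q := rec X s (fun b => s (u b)).
Definition lift (phi : P -> F^o) : P -> Q := rec X s (fun b => (phi b : F)%:A *: x0).

Lemma htp_linear u : linear (htp u). Proof. exact: recl. Qed.
Lemma lift_linear phi : linear (lift phi). Proof. exact: recl. Qed.

Lemma dif_linear g : linear g -> linear (dif g).
Proof.
by move=> gl a x y; rewrite /dif gl !linearP sgl gl sgl opprD addrACA -scalerBr.
Qed.

Lemma htpE u b : X b -> htp u b = s (u b) + s (sg (htp u (sg (res_d P b)))).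
Proof. by move=> Xb; rewrite /htp recE'. Qed.

Lemma liftE phi b : X b -> lift phi b = (phi b : F)%:A *: x0 + s (sg (lift phi (sg (res_d P b)))).
Proof. by move=> Xb; rewrite /lift recE'. Qed.

Lemma aug_linear (g : P -> Q) (phi : P -> F^o) : linear g -> trivial_hom gr phi ->
  (forall b, X b -> aug (g b) = phi b) -> forall x, aug (g x) = phi x.
Proof.
move=> gl hphi e; have [pD _ _] := hphi.
apply: (eq_on_hbasis hgr hX) => [x y|x y|i a b ga Xb]; first by rewrite (lin_addm gl) res_augD.
  exact: pD.
by rewrite (linZ gl) (res_augZ hgr hconn) (trivial_homZ hgr hconn) // e.
Qed.

Lemma aug_htp u x : aug (htp u x) = 0.
Proof.
apply: (@aug_linear _ (fun=> 0) (@htp_linear u)) => [|b Xb].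
  by split=> *; rewrite ?addr0 ?mulr0.
by rewrite htpE // res_augD !(ctr_aug hs) addr0.
Qed.

Lemma aug_lift phi x : trivial_hom gr phi -> aug (lift phi x) = phi x.
Proof.
move=> hphi; apply: (aug_linear (@lift_linear phi) hphi) => b Xb.
by rewrite liftE // res_augD (ctr_aug hs) addr0 (res_aug_alg hgr hconn) (ctr_x0_aug hs) mulr1.
Qed.

Lemma s_alg_x0 c : s (c%:A *: x0) = 0.
Proof. by rewrite (flinZ _ _ sF) (ctr_x0 hs) scaler0. Qed.

Lemma s_htp u b : X b -> s (htp u b) = 0.
Proof. by move=> Xb; rewrite htpE // sD !(ctr_s hs) addr0. Qed.

Lemma s_lift phi b : X b -> s (lift phi b) = 0.
Proof. by move=> Xb; rewrite liftE // sD (ctr_s hs) s_alg_x0 addr0. Qed.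

(** The form in which s s = 0 is used: [htp] sees [u] only through s u on generators, so by [s_htp]
    and [s_lift] it kills homotopies and lifts. *)
Lemma htp_kill u : (forall b, X b -> s (u b) = 0) -> forall x, htp u x = 0.
Proof.
by move=> h; apply: rec_unique0' => [|b Xb]; [exact: htp_linear|rewrite htpE // h // add0r].
Qed.

Lemma eq_htp u v x : (forall b, X b -> u b = v b) -> htp u x = htp v x.
Proof. by move=> e; apply: (eq_rec hgr hconn hXh hX hs) => b Xb; rewrite e. Qed.

Lemma htp_flin c u v x : htp (fun y => c%:A *: u y + v y) x = c%:A *: htp u x + htp v x.
Proof.
rewrite /htp -(rec_flin hgr hconn hXh hX hs); apply: (eq_rec hgr hconn hXh hX hs) => b Xb.
by rewrite sF.
Qed.

Lemma lift_flin c (u v : P -> F^o) x :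
  lift (fun y => c * u y + v y) x = c%:A *: lift u x + lift v x.
Proof.
rewrite /lift -(rec_flin hgr hconn hXh hX hs); apply: (eq_rec hgr hconn hXh hX hs) => b Xb.
by rewrite !scalerDl scalerA alg_mul scalerA.
Qed.

Lemma lift_opp (phi : P -> F^o) x : lift (fun y => - phi y) x = - lift phi x.
Proof.
symmetry; move: x; apply: rec_unique' => [a x y|b Xb]; first by rewrite lift_linear opprD scalerN.
rewrite liftE // opprD -scaleNr -scaleNr; congr (_ + _).
by rewrite -(addmN sD) -(addmN (@sgD _)).
Qed.

Lemma htp_parity u x : linear u -> sg (htp u (sg x)) = - htp (fun y => sg (u (sg y))) x.
Proof.
move=> ul; rewrite /htp (rec_parity hgr hconn hXh hX hs); last first.
  by move=> c y z; rewrite ul sF.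
symmetry; move: x; apply: rec_unique' => [a x y|b Xb]; first by rewrite recl opprD scalerN.
rewrite recE' // (s_parity _ hs) opprD; congr (_ + _); first by rewrite opprK.
by rewrite -(addmN sD) -(addmN (@sgD _)).
Qed.

Lemma lift_parity (phi : P -> F^o) x : trivial_hom gr phi ->
  sg (lift phi (sg x)) = lift (fun y => phi (sg y)) x.
Proof.
move=> [pD pZ _]; rewrite /lift (rec_parity hgr hconn hXh hX hs); last first.
  by move=> c y z; rewrite pD pZ !scalerDl scalerA alg_mul scalerA.
apply: (eq_rec hgr hconn hXh hX hs) => b Xb.
by rewrite (linZ (@sgl _)) (parity_hom (ctr_x0_gr hs)) sgn0 scale1r.
Qed.

Lemma parity_d (R : resolution gr) (x : R) : sg (res_d R x) = - res_d R (sg x).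
Proof. by rewrite d_parity opprK. Qed.

Lemma d_sg_dif g y : linear g ->
  res_d Q (sg (g (sg (res_d P y)))) = - sg (dif g (sg (res_d P y))).
Proof.
move=> gl; rewrite d_parity /dif (d_parity (res_d P y)) res_dd (addm0 (@sgD _)) oppr0.
by rewrite (addm0 (@sgD _)) (addm0 (lin_addm gl)) (addm0 (@sgD _)) subr0.
Qed.

(** The negative of the defect w = dif T u + T dif u - u satisfies, on generators, the recursion
    defining the lift of aug u; the homotopy identity of s cancels the other terms. *)
Lemma dif_htp u x : linear u ->
  dif (htp u) x + htp (dif u) x = u x - lift (fun y => aug (u y)) x.
Proof.
move=> ul; pose w x := dif (htp u) x + htp (dif u) x - u x.
have hl := @htp_linear; have dl := dif_linear (@htp_linear u).
have wl : linear w.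
  exact/lin_sub/ul/lin_add/hl/dl.
suff h : forall x, - w x = lift (fun y => aug (u y)) x by rewrite -h opprK /w addrC subrK.
apply: rec_unique' => [a y z|b Xb]; first by rewrite wl opprD scalerN.
set y := sg (res_d P b).
have eD : dif (htp u) b = u b - (aug (u b) : F)%:A *: x0 - s (res_d Q (u b))
   + s (sg (dif (htp u) y)).
  rewrite {1}/dif {1}htpE // -/y linearD !(ctr_homotopy hs) (aug_parity hgr hconn) aug_htp.
  rewrite !scale0r subr0 /y d_sg_dif // (addmN sD) opprK -/y.
  by rewrite -[LHS]addrA; congr (_ + _); rewrite addrAC subrr add0r.
have eH : htp (dif u) b = s (res_d Q (u b)) - s (sg (u y)) + s (sg (htp (dif u) y)).
  by rewrite htpE // /dif -/y (addmB sD).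
have eW : - w y = u y - dif (htp u) y - htp (dif u) y.
  by rewrite /w opprB opprD addrA.
have -> : s (sg (- w y)) = s (sg (u y)) - s (sg (dif (htp u) y)) - s (sg (htp (dif u) y)).
  rewrite eW (addmB (@sgD _) (u y - dif (htp u) y)) (addmB (@sgD _) (u y)).
  by rewrite (addmB sD (sg (u y) - sg (dif (htp u) y))) (addmB sD (sg (u y))).
rewrite {1}/w eD eH.
set a := (_ *: x0); set p := s (sg (u y)); set q := s (sg (dif _ _)).
set r := s (sg (htp _ _)); set k := s (res_d _ _); move: (u b) => ub.
rewrite -[RHS]opprK; congr (- _).
rewrite (addrAC _ (- k)) -(addrA k) (addrA _ k) subrK -!addrA (addrC ub) -!addrA.
by rewrite addNr addr0 !opprD !opprK (addrCA q).
Qed.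

(** The differential of a lift satisfies the recursion with zero initial term; the augmentation term
    of the homotopy disappears because [phi] kills boundaries. *)
Lemma dif_lift phi x : trivial_hom gr phi -> (forall y, phi (res_d P y) = 0) ->
  dif (lift phi) x = 0.
Proof.
move=> hphi phid; move: x.
have ll := @lift_linear phi; apply: rec_unique0'; first exact: dif_linear.
move=> b Xb; set y := sg (res_d P b).
rewrite {1}/dif {1}liftE // -/y linearD !(ctr_homotopy hs) linearZ /= (ctr_dx0 hs) scaler0 add0r.
rewrite (aug_parity hgr hconn) aug_lift // /y parity_d.
have [pD _ _] := hphi; rewrite (addmN pD) phid oppr0 !scale0r subr0 -parity_d.
rewrite d_sg_dif // (addmN sD) opprK -/y. by rewrite addrAC subrr add0r.
Qed.

End HomComplex.

Section MinimalResolution.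
Variables (F : fieldType) (A : algType F) (gr : nat -> set A).
Hypotheses (hgr : graded_algebra gr) (hconn : connected_algebra gr).
Variables (P : resolution gr) (X : set P).
Hypothesis hXh : X `<=` [set x | exists nj, res_gr P nj x].
Hypothesis hX : is_basis X.
Hypothesis hmin : minimal_resolution P.

Local Notation d := (res_d P).

Lemma augA_lin c a b : augA gr (c%:A * a + b) = c * augA gr a + augA gr b.
Proof. by rewrite (augAD hgr hconn) (augA_algM hgr hconn). Qed.

Lemma min_coord x b : augA gr (coord X b (d x)) = 0.
Proof.
apply: (@lspan_min _ P _ [set y | augA gr (coord X b y) = 0] _ _ _ (hmin x)).
  split=> [|a u v /= hu hv]; first by rewrite /= (addm0 (coordD hX b)) (addm0 (augAD hgr hconn)).
  by rewrite (coordD hX) (coordZ hX) (augAD hgr hconn) (augAM hgr hconn) hu hv mulr0 addr0.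
move=> _ [i [a [z [i0 ga ->]]]] /=.
by rewrite (coordZ hX) (augAM hgr hconn) (augA_pos hgr hconn i0 ga) mul0r.
Qed.

Lemma trivial_min (phi : P -> F^o) x : trivial_hom gr phi -> phi (d x) = 0.
Proof.
move=> hphi; have [pD _ p0] := hphi.
apply: (@lspan_min _ P _ [set y | phi y = 0] _ _ _ (hmin x)).
  split=> [|a u v /= hu hv]; first exact: addm0.
  by rewrite pD (trivial_homZ hgr hconn) // hu hv mulr0 addr0.
by move=> _ [i [a [z [i0 ga ->]]]] /=; rewrite (p0 i).
Qed.

(** A level 0 generator of nonzero internal degree would be the boundary of s b, but by minimality
    boundaries have coordinates of zero augmentation. *)
Lemma min_level0 b : X b -> (deg b).1 = 0 -> (deg b).2 = 0.
Proof.
move=> Xb e1; have [s [x0 [hs _]]] : exists s x0, contraction (P := P) s x0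
    /\ forall b, (set0 : set P) b -> s b = 0.
  apply: (exists_contraction hgr hconn) => // v.
  by move=> /(lspan_min (W := [set 0])) -> //; split=> //= c u w -> ->; rewrite scaler0 addr0.
apply/eqP/negPn/negP => e2.
have eb : d (s b) = b.
  rewrite (ctr_homotopy hs) (res_aug_degree _ (degP hXh Xb)) => [|e]; last by rewrite e in e2.
  rewrite !scale0r subr0.
  have -> : d b = 0.
    have := res_d_degree (degP' hXh Xb); rewrite e1; exact: res_nonneg.
  by rewrite (addm0 (ctr_addm hs)) subr0.
by have := min_coord (s b) b; rewrite eb (coord_basis hX) // eqxx (augA1 hgr hconn) => /eqP;
   rewrite oner_eq0.
Qed.

Lemma min_cycle_aug s x0 v b : contraction (P := P) s x0 -> d v = 0 -> res_aug P v = 0 ->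
  augA gr (coord X b v) = 0.
Proof.
move=> hs dv av; rewrite -(min_coord (s v) b) (ctr_homotopy hs) dv av.
by rewrite (addm0 (ctr_addm hs)) !scale0r !subr0.
Qed.

(** On generators of positive level the section can be made to undo d: a scalar combination that is
    a cycle is a boundary, so its coordinates vanish by minimality. On level 0 every generator is a
    multiple of [x0], which s kills. *)
Lemma min_contraction : exists s x0, contraction (P := P) s x0 /\ forall b, X b -> s b = 0.
Proof.
have [s' [x0' [hs' _]]] : exists s x0, contraction (P := P) s x0
    /\ forall b, (set0 : set P) b -> s b = 0.
  apply: (exists_contraction hgr hconn) => // v.
  by move=> /(lspan_min (W := [set 0])) -> //; split=> //= c u w -> ->; rewrite scaler0 addr0.
have [|||s [x0 [hs sX]]] := @exists_contraction _ _ _ hgr hconn P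
   [set b | X b /\ (deg b).1 != 0].
- by move=> b [/hXh].
- by move=> b [Xb b0]; apply: (res_aug_degree _ (degP hXh Xb)) => e; rewrite e in b0.
- move=> v vX dv.
  have [av cv] : res_aug P v = 0 /\ forall b, X b -> coord X b v = (augA gr (coord X b v))%:A.
    apply: (@lspan_min _ (rscal P) _ [set v : P | res_aug P v = 0 /\
      forall b, X b -> coord X b v = (augA gr (coord X b v))%:A] _ _ _ vX).
      split=> [|c u w [au cu] [aw cw]].
        split=> [|b Xb]; first exact/addm0/res_augD.
        by rewrite (addm0 (coordD hX b)) (addm0 (augAD hgr hconn)) scale0r.
      split=> [|b Xb]; first by rewrite res_augD (res_aug_alg hgr hconn) au aw mulr0 addr0.
      rewrite (coordD hX) (coordZ hX) augA_lin cu // cw // !(augA_alg hgr hconn).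
      by rewrite alg_mul scalerDl scalerA.
    move=> b [Xb b0]; split.
      by apply: (res_aug_degree _ (degP hXh Xb)) => e; rewrite e in b0.
    move=> b' Xb'; rewrite (coord_basis hX) //; case: eqP => _ /=.
      by rewrite (augA1 hgr hconn) scale1r.
    by rewrite (addm0 (augAD hgr hconn)) scale0r.
  apply: (coord0_eq0 hX) => b Xb; rewrite cv // (min_cycle_aug _ hs') //.
  exact: scale0r.
exists s, x0; split=> // b Xb; have [b0|b0] := eqVneq (deg b).1 0; last exact: sX.
have gb : res_gr P (0, 0) b by have := degP' hXh Xb; rewrite (min_level0 Xb b0) b0.
suff -> : b = (res_aug P b)%:A *: x0 by rewrite (flinZ _ _ (ctr_flin hs)) (ctr_x0 hs) scaler0.
apply/eqP; rewrite -subr_eq0; apply/eqP; set u := b - _.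
have gu : res_gr P (0, 0) u.
  by apply: (grB (res_grading P)) => //; apply: res_gr_alg => //; apply: ctr_x0_gr hs.
have au : res_aug P u = 0.
  by rewrite (addmB (@res_augD _ _ _ P)) (res_aug_alg hgr hconn) (ctr_x0_aug hs) mulr1 subrr.
have du : d u = 0 by have := res_d_degree gu; apply: res_nonneg.
apply: (coord0_eq0 hX) => b' Xb'; have [e|e] := eqVneq 0 (deg b').1; last first.
  exact: coord_lev gu e.
rewrite (coord_alg hgr hconn hXh hX Xb' gu); last by rewrite min_level0.
by rewrite (min_cycle_aug _ hs) // scale0r.
Qed.

End MinimalResolution.

(** * Ext of a minimal resolution *)

Section MinimalExt.
Variables (F : fieldType) (A : algType F) (gr : nat -> set A).
Hypotheses (hgr : graded_algebra gr) (hconn : connected_algebra gr).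
Variable P : resolution gr.
Hypothesis hmin : minimal_resolution P.

Local Notation sg := (@parity F A gr _).
Local Notation cocycles := [set phi : P -> F^o | exists pj, cocycle pj phi].
Let hg : is_grading (res_gr P) := res_grading P.

Lemma trivial_hom_submod : submod [set phi : P -> F^o | trivial_hom gr phi].
Proof.
split=> [|c u v /= [uD uZ u0] [vD vZ v0]].
  by split=> *; rewrite /= ?mulr0 ?addr0.
have E x : (c *: u + v) x = c * u x + v x by [].
split=> [x y|a x|i a x i0 ga]; rewrite !E.
- by rewrite uD vD mulrDr addrACA.
- by rewrite uZ vZ mulrDr mulrCA.
- by rewrite (u0 i) // (v0 i) // mulr0 addr0.
Qed.

Lemma cochain_submod pj : submod [set phi : P -> F^o | cochain pj phi].
Proof.
split=> [|c u v /= [hu u0] [hv v0]].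
  by split=> //; case: trivial_hom_submod.
split; first exact: trivial_hom_submod.2.
move=> ni x ne gx; have -> : (c *: u + v) x = c * u x + v x by [].
by rewrite (u0 ni) // (v0 ni) //= mulr0 addr0.
Qed.

Lemma min_cocycle pj phi : cochain (P := P) pj phi -> cocycle pj phi.
Proof. by move=> h; split=> // x; apply: (trivial_min hgr hconn hmin); case: h. Qed.

Lemma cocycles_trivial phi : lspan cocycles phi -> trivial_hom gr phi.
Proof.
apply: (lspan_min trivial_hom_submod) => psi [pj [[h _] _]]; exact: h.
Qed.

Lemma coboundaries0 phi :
  lspan [set psi \o res_d P | psi in [set psi : P -> F^o | exists pj, cochain pj psi]] phi ->
  phi = 0.
Proof.
have s0 : submod [set 0 : P -> F^o].
  by split=> // c u w -> ->; rewrite /= scaler0 addr0.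
move: phi; apply: (lspan_min s0) => _ [psi [pj [h _]] <-]; apply: funext => x /=.
exact: (trivial_min hgr hconn hmin).
Qed.

Lemma Ext_class_inj phi psi : lspan cocycles phi -> lspan cocycles psi ->
  Ext_class phi = Ext_class psi -> phi = psi.
Proof. by move=> h h' /(coh_classP _ h h') /coboundaries0 /subr0_eq. Qed.

(** By minimality all coboundaries vanish, so a class contains exactly one cochain, and equalities
    in Ext become equalities of functions on P. *)
Definition rep (x : Ext P) : P -> F^o :=
  xget (0 : P -> F^o) [set v | lspan cocycles v /\ x = Ext_class v].

Lemma repP x : lspan cocycles (rep x) /\ x = Ext_class (rep x).
Proof.
apply: (@xgetPex _ 0 [set v | lspan cocycles v /\ x = Ext_class v]).
by have [v hv e] := coh_class_surj x; exists v.
Qed.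

Lemma rep_cocycles x : lspan cocycles (rep x). Proof. exact: (repP x).1. Qed.

Lemma repK x : Ext_class (rep x) = x. Proof. by case: (repP x). Qed.

Lemma rep_trivial x : trivial_hom gr (rep x).
Proof. exact/cocycles_trivial/rep_cocycles. Qed.

Lemma rep_class phi : lspan cocycles phi -> rep (Ext_class phi) = phi.
Proof. by move=> h; apply: Ext_class_inj => //; [apply: rep_cocycles|rewrite repK]. Qed.

Lemma rep_inj x y : rep x = rep y -> x = y.
Proof. by move=> e; rewrite -(repK x) e repK. Qed.

Lemma rep_linear : linear rep.
Proof.
move=> c x y; rewrite -[in LHS](repK x) -[in LHS](repK y).
rewrite -coh_class_linear; try exact: rep_cocycles.
by apply: rep_class; apply: (lspan_submod _).2; apply: rep_cocycles.
Qed.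

Lemma repE c x y z : rep (c *: x + y) z = c * rep x z + rep y z.
Proof. by rewrite rep_linear. Qed.

Lemma repZ c x z : rep (c *: x) z = c * rep x z.
Proof. by rewrite (linZ rep_linear). Qed.

Lemma cochain_cocycles pj phi : cochain pj phi -> lspan cocycles phi.
Proof. by move=> h; apply: sub_lspan; exists pj; apply: min_cocycle. Qed.

Lemma Ext_grP pj x : Ext_gr P pj x <-> cochain pj (rep x).
Proof.
split=> [[phi hphi <-]|h]; last by exists (rep x); [apply: min_cocycle|apply: repK].
by rewrite rep_class; case: hphi => // h _; apply: cochain_cocycles h.
Qed.

Lemma rep_off pj ni x y : Ext_gr P pj x -> res_gr P ni y -> ni != pj -> rep x y = 0.
Proof. by move=> /Ext_grP[_ h] gy /eqP ne; apply: h gy. Qed.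

Lemma Ext_gr_scale pj (c : F) x : Ext_gr P pj x -> Ext_gr P pj (c *: x).
Proof.
rewrite !Ext_grP => h; rewrite (linZ rep_linear).
exact: (submodZ (cochain_submod pj)).
Qed.

Lemma Ext_grading : is_grading (Ext_gr P).
Proof.
split=> [i|i x y /Ext_grP gx /Ext_grP gy|x|s c us gc].
- by apply/Ext_grP; rewrite (addm0 (lin_addm rep_linear)); case: (cochain_submod i).
- by apply/Ext_grP; rewrite (addmB (lin_addm rep_linear)); apply: (submodB (cochain_submod i)).
- have [n [a [y [hy ey]]]] := rep_cocycles x.
  pose pj k : int * int := xget (0, 0) [set pj | cocycle pj (y k)].
  have hpj k : cocycle (pj k) (y k).
    by apply: (@xgetPex _ (0, 0) [set pj | cocycle pj (y k)]); apply: hy.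
  exists (undup [seq pj k | k <- enum 'I_n]).
  exists (fun i => \sum_(k | pj k == i) a k *: Ext_class (y k)); split.
    move=> i; apply/Ext_grP; rewrite (addm_sum (lin_addm rep_linear)).
    apply: (submod_sum (cochain_submod i)) => k _ /eqP <-; have [hk _] := hpj k.
    rewrite (linZ rep_linear) rep_class; last exact: cochain_cocycles hk.
    exact: (submodZ (cochain_submod _)).
  under eq_bigr do rewrite big_mkcond /=.
  rewrite exchange_big /=; apply: rep_inj; rewrite ey (addm_sum (lin_addm rep_linear)).
  apply: eq_bigr => k _; rewrite (bigD1_seq (pj k)) ?undup_uniq //=; last first.
    by rewrite mem_undup map_f // mem_enum.
  rewrite eqxx big1 ?addr0 => [|i ne]; last by rewrite eq_sym (negPf ne).
  rewrite (linZ rep_linear) rep_class //; have [hk _] := hpj k; exact: cochain_cocycles hk.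
move=> e i si; apply: rep_inj; rewrite (addm0 (lin_addm rep_linear)).
apply: funext; apply: (homog_ind hg) => [|u v eu ev|k u gu].
- by have [D _ _] := rep_trivial (c i); apply: addm0.
- by have [D _ _] := rep_trivial (c i); rewrite D eu ev addr0.
have [ki|ki] := eqVneq k i; last exact: (rep_off (gc i) gu ki).
have := congr1 (fun x => rep x u) e.
rewrite (addm_sum (lin_addm rep_linear)) (addm0 (lin_addm rep_linear)) fct_sumE.
rewrite (bigD1_seq i) //= big1 ?addr0 // => k' ne.
by apply: (rep_off (gc k') gu); rewrite ki eq_sym.
Qed.

Definition parityE (x : Ext P) : Ext P := Ext_class (fun y => rep x (sg y)).

Lemma parity_cocycles phi : lspan cocycles phi -> lspan cocycles (fun y => phi (sg y)).
Proof.
have := lspan_submod cocycles => hs.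
apply: (@lspan_min _ _ _ [set phi : P -> F^o | lspan cocycles (fun y => phi (sg y))]).
  split=> [|c u v /= hu hv]; first exact: hs.1.
  exact: hs.2.
move=> psi [pj [[[pD pZ p0] off] dpsi]]; apply: (@cochain_cocycles pj); split.
  split=> [x y|c x|i a x i0 ga].
  - by rewrite (@parityD _ _ _ P) pD.
  - by rewrite (linZ (parity_linear hgr (P := P))) pZ.
  - by rewrite (linZ (parity_linear hgr (P := P))) (p0 i).
move=> ni x ne gx; apply: (off ni) => //; exact: parity_gr.
Qed.

Lemma rep_parity x y : rep (parityE x) y = rep x (sg y).
Proof. by rewrite /parityE rep_class //; apply/parity_cocycles/rep_cocycles. Qed.

Lemma parityE_linear : linear parityE.
Proof.
by move=> c x y; apply/rep_inj/funext => z; rewrite repE !rep_parity repE.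
Qed.

Lemma parityEK x : parityE (parityE x) = x.
Proof. by apply/rep_inj/funext => z; rewrite !rep_parity parityK. Qed.

Lemma parityE_hom p j x : Ext_gr P (p, j) x -> parityE x = sgn F p *: x.
Proof.
move=> gx; apply/rep_inj/funext => z; rewrite rep_parity repZ.
have [pD pZ p0] := rep_trivial x.
move: z; apply: (eq_homog hg) => [u v|u v|[n i] u gu].
- by rewrite parityD pD.
- by rewrite pD mulrDr.
rewrite (parity_hom gu) sgn_alg pZ; have [e|ne] := eqVneq (n, i) (p, j).
  by case: e => -> _.
by rewrite (rep_off gx gu ne) !mulr0.
Qed.

Lemma parityE_gr pj x : Ext_gr P pj x -> Ext_gr P pj (parityE x).
Proof. by case: pj => p j gx; rewrite (parityE_hom gx); apply: Ext_gr_scale. Qed.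

Lemma aug_cochain : cochain (0, 0) (res_aug P).
Proof. by split; [exact: res_aug_hom|move=> ni x ne; apply: res_aug_degree]. Qed.

Lemma rep_one : rep (Ext_one P) = res_aug P.
Proof. exact/rep_class/(cochain_cocycles aug_cochain). Qed.

Lemma Ext_one_gr : Ext_gr P (0, 0) (Ext_one P).
Proof. by apply/Ext_grP; rewrite rep_one; apply: aug_cochain. Qed.

Lemma parityE_one : parityE (Ext_one P) = Ext_one P.
Proof. by rewrite (parityE_hom Ext_one_gr) sgn0 scale1r. Qed.

End MinimalExt.

(** * The transferred A-infinity structure *)

Section Deconcatenation.
Variable T : Type.

(** Sum over all cuts of [xs] into a prefix and a suffix, possibly empty. Its coassociativity
    replaces index manipulations in the A-infinity relations. *)
Definition dec (V : zmodType) (G : seq T -> seq T -> V) (xs : seq T) : V :=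
  \sum_(i < (size xs).+1) G (take i xs) (drop i xs).

Section Values.
Variable V : zmodType.
Implicit Types (G : seq T -> seq T -> V).

Lemma dec_nil G : dec G [::] = G [::] [::].
Proof. by rewrite /dec big_ord1. Qed.

Lemma dec_cons G x xs : dec G (x :: xs) = G [::] (x :: xs) + dec (fun u => G (x :: u)) xs.
Proof. by rewrite /dec big_ord_recl. Qed.

Lemma eq_dec G G' xs : (forall u v, u ++ v = xs -> G u v = G' u v) -> dec G xs = dec G' xs.
Proof. by move=> e; apply: eq_bigr => i _; apply: e; apply: cat_take_drop. Qed.

Lemma decD G G' xs : dec (fun u v => G u v + G' u v) xs = dec G xs + dec G' xs.
Proof. exact: big_split. Qed.

Lemma decN G xs : dec (fun u v => - G u v) xs = - dec G xs.
Proof. by rewrite /dec sumrN. Qed.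

Lemma decB G G' xs : dec (fun u v => G u v - G' u v) xs = dec G xs - dec G' xs.
Proof. by rewrite decD decN. Qed.

Lemma dec0 xs : dec (fun _ _ => 0 : V) xs = 0.
Proof. by rewrite /dec big1. Qed.

Lemma dec_coassoc (H : seq T -> seq T -> seq T -> V) xs :
  dec (fun u v => dec (fun v1 v2 => H u v1 v2) v) xs =
  dec (fun u v => dec (fun u1 u2 => H u1 u2 v) u) xs.
Proof.
elim: xs H => [|x xs IH] H; first by rewrite !dec_nil.
rewrite !dec_cons dec_nil IH -addrA -decD; congr (_ + _).
by apply: eq_dec => u v _; rewrite dec_cons.
Qed.

Lemma dec_cat_cons G xs z ys : dec G (xs ++ z :: ys) =
  dec (fun u v => G u (v ++ z :: ys)) xs + dec (fun u v => G (xs ++ z :: u) v) ys.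
Proof.
elim: xs G => [|x xs IH] G /=; first by rewrite dec_cons dec_nil.
by rewrite !dec_cons IH addrA.
Qed.

Lemma dec_map (f : T -> T) G xs :
  dec G (map f xs) = dec (fun u v => G (map f u) (map f v)) xs.
Proof. by elim: xs G => [|x xs IH] G /=; rewrite ?dec_nil // !dec_cons IH. Qed.


Lemma dec_first G xs : (forall x u v, G (x :: u) v = 0) -> dec G xs = G [::] xs.
Proof.
case: xs => [|x xs] h; first by rewrite dec_nil.
by rewrite dec_cons (eq_dec (G' := fun _ _ => 0)) ?dec0 ?addr0.
Qed.

Lemma dec_last G xs : (forall x u v, G u (x :: v) = 0) -> dec G xs = G xs [::].
Proof.
elim: xs G => [|x xs IH] G h; first by rewrite dec_nil.
by rewrite dec_cons h add0r IH.
Qed.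

End Values.

Lemma dec_addm (V W : zmodType) (g : V -> W) (G : seq T -> seq T -> V) xs :
  addm g -> g (dec G xs) = dec (fun u v => g (G u v)) xs.
Proof. by move=> gD; rewrite /dec addm_sum. Qed.

End Deconcatenation.

Section Multilinear.
Variables (F : fieldType) (E V : lmodType F) (g : seq E -> V).
Hypothesis gm : multilinear id g.

Lemma multilinear_sub xs ys x y :
  g (xs ++ (x - y) :: ys) = g (xs ++ x :: ys) - g (xs ++ y :: ys).
Proof. by have := gm xs ys (-1) y x; rewrite !scaleN1r addrC => ->; rewrite addrC. Qed.

Lemma multilinear0 xs ys : g (xs ++ 0 :: ys) = 0.
Proof. by rewrite -(subrr (0 : E)) multilinear_sub subrr. Qed.

Lemma multilinearZ xs ys c x : g (xs ++ (c *: x) :: ys) = c *: g (xs ++ x :: ys).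
Proof. by rewrite -[c *: x]addr0 gm multilinear0 addr0. Qed.

Lemma multilinear_ind (W : set V) n : submod W -> forall (H : set E),
  (forall x, lspan H x) ->
  (forall xs, size xs = n -> (forall x, x \in xs -> H x) -> W (g xs)) ->
  forall xs, size xs = n -> W (g xs).
Proof.
move=> sW H HT h xs; rewrite -[xs]cats0.
have : forall z, z \in ([::] : seq E) -> H z by [].
elim/last_ind: xs [::] => [|xs x IH] zs hzs; first by move=> e; apply: h.
rewrite cat_rcons => e; pose S := [set x | size (xs ++ x :: zs) = n -> W (g (xs ++ x :: zs))].
suff : S x by apply.
apply: (lspan_min _ _ (HT x)) => [|y Hy]; last first.
  by apply: IH => z; rewrite inE => /orP[/eqP -> //|/hzs].
split=> [_|c u v hu hv e'].
  by rewrite multilinear0; case: sW.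
have {}hu : W (g (xs ++ u :: zs)) by apply: hu; rewrite -e' !size_cat.
have {}hv : W (g (xs ++ v :: zs)) by apply: hv; rewrite -e' !size_cat.
by rewrite gm; apply: sW.2.
Qed.

End Multilinear.

Section Transfer.
Variables (F : fieldType) (A : algType F) (gr : nat -> set A).
Hypotheses (hgr : graded_algebra gr) (hconn : connected_algebra gr).
Variables (P : resolution gr) (X : set P).
Hypothesis hXh : X `<=` [set x | exists nj, res_gr P nj x].
Hypothesis hX : is_basis X.
Hypothesis hmin : minimal_resolution P.
Variables (s : P -> P) (x0 : P).
Hypothesis hs : contraction s x0.

Local Notation E := (Ext P).
Local Notation aug := (res_aug P).
Local Notation sg := (@parity F A gr _).
Local Notation T := (htp X s).
Local Notation ii := (lift X s x0).

Let sgl := parity_linear hgr (P := P).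
Let sgD : addm (@parity F A gr P) := @parityD F A gr P.
Let sgK (x : P) : sg (sg x) = x := parityK hgr x.

Definition cj (g : P -> P) : P -> P := fun x => sg (g (sg x)).

Lemma cj_linear g : linear g -> linear (cj g).
Proof. by move=> gl; apply: (lin_comp sgl); apply: (lin_comp gl sgl). Qed.

(* Merkulov's recursion F = - T (sum of F u o F v), the sign of F u being absorbed
   by the conjugation cj; the fuel n is the size of xs. *)
Fixpoint Fiter (n : nat) (xs : seq E) : P -> P :=
  if n is n'.+1 then
    match xs with
    | [::] => fun=> 0
    | [:: x] => ii (rep x)
    | _ => fun y => - T (fun z => dec (fun u v => cj (Fiter n' u) (Fiter n' v z)) xs) y
    end
  else fun=> 0.

Let eqT u v z : (forall b, X b -> u b = v b) -> - T u z = - T v z.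
Proof. by move=> e; rewrite (eq_htp hgr hconn hXh hX hs _ e). Qed.

Lemma FiterS n x y xs z : Fiter n.+1 [:: x, y & xs] z =
  - T (fun z => dec (fun u v => cj (Fiter n u) (Fiter n v z)) [:: x, y & xs]) z.
Proof. by []. Qed.

Definition Ff (xs : seq E) : P -> P := Fiter (size xs) xs.

(** The quadratic part of the morphism equation. As [Ff [::]] is 0, only cuts into two non-empty
    pieces count. Merkulov's recursion reads F = Fone - T lam, and aug lam yields the operations. *)
Definition lam (xs : seq E) : P -> P := fun z => dec (fun u v => cj (Ff u) (Ff v z)) xs.

Let z_linear : linear (fun _ : P => 0 : P).
Proof. by move=> a x y; rewrite scaler0 addr0. Qed.

Lemma Fiter_linear n xs : linear (Fiter n xs).
Proof.
case: n xs => [|n] [|x [|y xs]] /=; try exact: z_linear; first exact: lift_linear.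
exact/lin_opp/htp_linear.
Qed.

Lemma Ff_linear xs : linear (Ff xs). Proof. exact: Fiter_linear. Qed.
Let Ff0 xs : Ff xs 0 = 0. Proof. exact/addm0/lin_addm/Ff_linear. Qed.

Lemma Fiter_nil n : Fiter n [::] = fun=> 0. Proof. by case: n. Qed.

Lemma Fiter_stable n xs : (size xs <= n)%N -> Fiter n xs = Ff xs.
Proof.
rewrite /Ff; elim/ltn_ind: n xs => [[|n] IH] xs; first by case: xs.
case: xs => [|x [|y xs]] le; [by []|by []|]; apply: funext => z.
have -> : size [:: x, y & xs] = (size xs).+2 by [].
rewrite (FiterS n) (FiterS (size xs).+1); apply: eqT => b Xb.
apply: eq_dec => u v e.
have sz : (size u + size v = (size xs).+2)%N by rewrite -size_cat e.
case: u e sz => [|x' u] e sz; first by rewrite !Fiter_nil.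
case: v e sz => [|y' v] e sz.
  by rewrite !Fiter_nil /cj !(addm0 sgD) !(addm0 (lin_addm (Fiter_linear _ _))).
have n1 : ((size xs).+1 < n.+1)%N by [].
have hu : (size (x' :: u) <= (size xs).+1)%N by move: sz => /=; lia.
have hv : (size (y' :: v) <= (size xs).+1)%N by move: sz => /=; lia.
have hn := leq_trans _ (n1 : ((size xs).+1 <= n)%N).
rewrite (IH n (ltnSn n) _ (hn _ hu)) (IH n (ltnSn n) _ (hn _ hv)).
by rewrite (IH _ n1 _ hu) (IH _ n1 _ hv).
Qed.

Lemma Ff_nil : Ff [::] = fun=> 0. Proof. by []. Qed.
Lemma Ff1 x : Ff [:: x] = ii (rep x). Proof. by []. Qed.

Lemma lamE xs z : lam xs z = dec (fun u v => cj (Ff u) (Ff v z)) xs.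
Proof. by []. Qed.

Lemma lam_nil z : lam [::] z = 0.
Proof. by rewrite /lam dec_nil /cj Ff_nil (addm0 sgD). Qed.

Lemma lam1 x z : lam [:: x] z = 0.
Proof. by rewrite /lam dec_cons dec_nil Ff_nil /cj (addm0 sgD) Ff0 !(addm0 sgD) addr0. Qed.

Lemma lam_linear xs : linear (lam xs).
Proof.
move=> a x y; rewrite /lam /dec scaler_sumr -big_split; apply: eq_bigr => i _.
by rewrite Ff_linear (cj_linear (@Ff_linear _)).
Qed.

Definition Fone (xs : seq E) : P -> P := if xs is [:: x] then ii (rep x) else fun=> 0.

Lemma FfE xs z : Ff xs z = Fone xs z - T (lam xs) z.
Proof.
case: xs => [|x [|y xs]].
- by rewrite (htp_kill hgr hconn hXh hX hs) ?subr0 // => b _; rewrite lam_nil (addm0 (ctr_addm hs)).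
- by rewrite (htp_kill hgr hconn hXh hX hs) ?subr0 // => b _; rewrite lam1 (addm0 (ctr_addm hs)).
have -> : Fone [:: x, y & xs] z = 0 by [].
rewrite sub0r /Ff FiterS; apply: eqT => b _; rewrite /lam.
apply: eq_dec => u v e.
have sz : (size u + size v = (size xs).+2)%N by rewrite -size_cat e.
case: u e sz => [|x' u] e sz; first by rewrite Fiter_nil.
case: v e sz => [|y' v] e sz.
  by rewrite Fiter_nil /cj !(addm0 sgD) !(addm0 (lin_addm (Fiter_linear _ _))) !Ff0.
have hu : (size (x' :: u) <= (size xs).+1)%N by move: sz => /=; lia.
have hv : (size (y' :: v) <= (size xs).+1)%N by move: sz => /=; lia.
by rewrite (Fiter_stable hu) (Fiter_stable hv).
Qed.

Lemma s_Fone xs b : X b -> s (Fone xs b) = 0.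
Proof.
move=> Xb; case: xs => [|x [|y xs]] /=; rewrite ?(addm0 (ctr_addm hs)) //.
exact: (s_lift hgr hconn hXh hX hs).
Qed.

Lemma s_Ff xs b : X b -> s (Ff xs b) = 0.
Proof.
move=> Xb; rewrite FfE (addmB (ctr_addm hs)) s_Fone //.
by rewrite (s_htp hgr hconn hXh hX hs) // subr0.
Qed.

(** The annihilation T F = 0, inherited from s s = 0, is an ingredient of strict unitality. *)
Lemma T_Ff xs z : T (Ff xs) z = 0.
Proof. by apply: (htp_kill hgr hconn hXh hX hs) => b; apply: s_Ff. Qed.

Lemma T_cj_Ff xs z : T (cj (Ff xs)) z = 0.
Proof.
rewrite -[LHS]opprK -(htp_parity hgr hconn hXh hX hs _ (@Ff_linear xs)).
by rewrite T_Ff (addm0 sgD) oppr0.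
Qed.

Lemma aug_Ff xs z : size xs != 1%N -> aug (Ff xs z) = 0.
Proof.
move=> sz; rewrite FfE (addmB (@res_augD _ _ _ P)) (aug_htp hgr hconn hXh hX hs) subr0.
by case: xs sz => [|x [|y xs]] //= _; apply: (addm0 (@res_augD _ _ _ P)).
Qed.

(** On homogeneous x this is the sign (-1)^(|x| + 1), that of moving an odd operation past the
    suspension of x. *)
Definition tau (x : E) : E := - parityE x.

Lemma rep_tau x y : rep (tau x) y = - rep x (sg y).
Proof.
by rewrite /tau (addmN (lin_addm (rep_linear hgr hconn hmin))) -(rep_parity hgr hconn hmin).
Qed.

Lemma cjK g : cj (cj g) = g.
Proof. by apply: funext => x; rewrite /cj !sgK. Qed.

(** The degree of F xs is 1 plus the sum of the |x| - 1, so conjugation and [tau] differ by one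
    sign; for inhomogeneous entries this goes through the recursion. *)
Lemma Ff_tau xs z : cj (Ff (map tau xs)) z = - Ff xs z.
Proof.
move: z; have [n le] := ubnP (size xs); elim: n xs le => // n IH xs le z.
have IH' ys : (size ys < size xs)%N -> forall z, Ff (map tau ys) z = - cj (Ff ys) z.
  move=> lt y; have := IH ys (leq_trans lt le) (sg y); rewrite /cj !sgK => h.
  by rewrite -[LHS]sgK h (addmN sgD).
have lamt : T (cj (lam (map tau xs))) z = T (lam xs) z.
  apply: (eq_htp hgr hconn hXh hX hs) => b Xb.
  rewrite {1}/cj !lamE dec_map (dec_addm _ _ sgD); apply: eq_dec => u v e.
  have sz : (size u + size v = size xs)%N by rewrite -size_cat e.
  case: u e sz => [|x' u] e sz; first by rewrite /cj !Ff_nil !(addm0 sgD).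
  case: v e sz => [|y' v] e sz.
    by rewrite /cj !Ff_nil !(addm0 sgD) !Ff0 !(addm0 sgD).
  have hu : (size (x' :: u) < size xs)%N by move: sz => /=; lia.
  have hv : (size (y' :: v) < size xs)%N by move: sz => /=; lia.
  rewrite /cj (IH' _ hu) (IH' _ hv) /cj !(addmN sgD) !sgK (addmN (lin_addm (@Ff_linear _))).
  by rewrite (addmN sgD) opprK.
rewrite /cj FfE (addmB sgD); have := htp_parity hgr hconn hXh hX hs z (lam_linear (map tau xs)).
rewrite -/(cj (lam (map tau xs))) => ->; rewrite lamt FfE opprB opprK addrC; congr (_ + _).
case: xs {le IH IH' lamt} => [|x [|y xs]] /=; rewrite ?(addm0 sgD) ?oppr0 //.
rewrite (lift_parity hgr hconn hXh hX hs); last exact: rep_trivial.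
rewrite -(lift_opp hgr hconn hXh hX hs); congr (lift _ _ _ _ z); apply: funext => y.
by rewrite rep_tau sgK.
Qed.

End Transfer.

Section HomogeneousSequences.
Variables (F : fieldType) (E : lmodType F) (gE : int * int -> set E).
Hypothesis hg : is_grading gE.

Lemma homog_span x : lspan [set x | exists pj, gE pj x] x.
Proof.
rewrite [x](hsumE hg); apply: (submod_sum (lspan_submod _)) => i _ _.
by apply: sub_lspan; exists i; apply: hcompP.
Qed.

Lemma homog_degrees xs : (forall x, x \in xs -> exists pj, gE pj x) ->
  exists ds, List.Forall2 gE ds xs.
Proof.
elim: xs => [|x xs IH] h; first by exists [::]; constructor.
have [pj gx] := h x (mem_head _ _).
have [|ds hds] := IH; first by move=> y hy; apply: h; rewrite inE hy orbT.
by exists (pj :: ds); constructor.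
Qed.

End HomogeneousSequences.

Lemma Forall2_cat_inv (S T : Type) (R : S -> T -> Prop) ds u v :
  List.Forall2 R ds (u ++ v) -> exists d1 d2,
    [/\ ds = d1 ++ d2, List.Forall2 R d1 u & List.Forall2 R d2 v].
Proof.
elim: u ds => [|x u IH] ds; first by exists [::], ds; split=> //; constructor.
move=> h; inversion h as [|e y ds' xs' ge gs]; subst; have [d1 [d2 [-> h1 h2]]] := IH _ gs.
by exists (e :: d1), d2; split=> //; constructor.
Qed.

Lemma Forall2_size (S T : Type) (R : S -> T -> Prop) ds xs :
  List.Forall2 R ds xs -> size ds = size xs.
Proof. by elim=> //= e x ds' xs' _ _ ->. Qed.

Section TransferEquations.
Variables (F : fieldType) (A : algType F) (gr : nat -> set A).
Hypotheses (hgr : graded_algebra gr) (hconn : connected_algebra gr).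
Variables (P : resolution gr) (X : set P).
Hypothesis hXh : X `<=` [set x | exists nj, res_gr P nj x].
Hypothesis hX : is_basis X.
Hypothesis hmin : minimal_resolution P.
Variables (s : P -> P) (x0 : P).
Hypothesis hs : contraction s x0.

Local Notation E := (Ext P).
Local Notation aug := (res_aug P).
Local Notation sg := (@parity F A gr _).
Local Notation T := (htp X s).
Local Notation ii := (lift X s x0).
Local Notation Ff := (Ff X s x0).
Local Notation lam := (lam X s x0).
Local Notation Fone := (Fone X s x0).
Local Notation cocycles := [set phi : P -> F^o | exists pj, cocycle pj phi].

Let sgl := parity_linear hgr (P := P).
Let sgD : addm (@parity F A gr P) := @parityD F A gr P.
Let sgK (x : P) : sg (sg x) = x := parityK hgr x.
Let Fl := @Ff_linear F A gr P X hX s x0.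
Let FD xs : addm (Ff xs) := lin_addm (Fl xs).
Let Ff0 xs : Ff xs 0 = 0 := addm0 (FD xs).
Let laml := @lam_linear F A gr hgr P X hX s x0.

Lemma dif_add (g h : P -> P) z : dif (fun y => g y + h y) z = dif g z + dif h z.
Proof. by rewrite /dif linearD sgD opprD addrACA. Qed.

Lemma dif_opp (g : P -> P) z : dif (fun y => - g y) z = - dif g z.
Proof. by rewrite /dif linearN (addmN sgD) opprD. Qed.

Lemma eq_dif (g h : P -> P) z : g =1 h -> dif g z = dif h z.
Proof. by move=> e; rewrite /dif !e. Qed.

Lemma dif_cj (g : P -> P) y : linear g -> dif (cj g) y = - cj (dif g) y.
Proof.
move=> gl; rewrite /dif /cj !sgK (addmB sgD) sgK opprB.
by rewrite !d_parity (addmN sgD) sgK (addmN (lin_addm gl)) addrC.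
Qed.

Lemma dif_comp (g h : P -> P) y : linear g ->
  dif (fun z => g (h z)) y = dif g (h y) + cj g (dif h y).
Proof.
move=> gl; rewrite /dif /cj (addmB sgD) sgK (addmB (lin_addm gl)) (addmB sgD).
by rewrite addrA subrK.
Qed.

Lemma T_addm z : addm (fun u : P -> P => T u z).
Proof.
move=> u v; have := htp_flin hgr hconn hXh hX hs 1 u v z; rewrite !scale1r => <-.
by apply: (eq_htp hgr hconn hXh hX hs) => b _; rewrite !scale1r.
Qed.

Lemma T_dec (G : seq E -> seq E -> P -> P) xs z :
  T (fun y => dec (fun u v => G u v y) xs) z = dec (fun u v => T (G u v) z) xs.
Proof.
rewrite -(dec_addm G xs (@T_addm z)); congr (T _ z); apply: funext => y.
by rewrite /dec fct_sumE.
Qed.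

Section Degrees.

Lemma res_gr_eq nj nk (x : P) : res_gr P nj x -> nj = nk -> res_gr P nk x.
Proof. by move=> h <-. Qed.

Lemma End_gr_linear pj g : End_gr P pj g -> linear g. Proof. by case. Qed.

Lemma End_gr_comp pj qk g h : End_gr P pj g -> End_gr P qk h ->
  End_gr P (pj + qk) (fun x => g (h x)).
Proof.
move=> [gl gg] [hl hh]; split=> [a x y|n i x gx]; first by rewrite hl gl.
have -> : n - (pj + qk).1 = n - qk.1 - pj.1 by rewrite /= opprD addrA addrAC.
have -> : i - (pj + qk).2 = i - qk.2 - pj.2 by rewrite /= opprD addrA addrAC.
exact/gg/hh.
Qed.

Lemma End_gr_cj pj g : End_gr P pj g -> End_gr P pj (cj g).
Proof.
move=> [gl gg]; split=> [|n i x gx]; first exact: (cj_linear hgr).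
exact/(parity_gr hconn)/gg/(parity_gr hconn).
Qed.

Lemma End_gr_lift pj x : Ext_gr P pj x -> End_gr P pj (ii (rep x)).
Proof.
case: pj => p j gx; split=> [|n i z gz]; first exact: lift_linear.
apply: (rec_degree hgr hconn hXh hX hs) gz => b Xb.
have [e|ne] := eqVneq (deg b) (p, j).
  by rewrite e /= !subrr; apply/(res_gr_alg hconn)/(ctr_x0_gr hs).
rewrite (rep_off hgr hconn hmin gx (degP hXh Xb) ne) !scale0r; apply: gr0; exact: res_grading.
Qed.

Lemma End_gr_htp p j u : End_gr P (p, j) u -> End_gr P (p - 1, j) (T u).
Proof.
move=> [ul ug]; split=> [|n i z gz]; first exact: htp_linear.
apply: (rec_degree hgr hconn hXh hX hs) gz => b Xb.
rewrite opprD opprK addrA; apply: (ctr_gr hs).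
exact/ug/(degP' hXh).
Qed.

Lemma End_gr_opp pj g : End_gr P pj g -> End_gr P pj (fun x => - g x).
Proof.
move=> [gl gg]; split=> [|n i x gx]; first exact: lin_opp.
by apply: (grN (res_grading P)); apply: gg.
Qed.

Lemma lam_gr_aux n : (forall ds xs, (0 < size xs <= n)%N -> List.Forall2 (Ext_gr P) ds xs ->
    End_gr P (\sum_(e <- ds) e + (1 - (size xs)%:Z, 0)) (Ff xs)) ->
  forall ds xs, (size xs <= n.+1)%N -> List.Forall2 (Ext_gr P) ds xs ->
    End_gr P (\sum_(e <- ds) e + (2 - (size xs)%:Z, 0)) (lam xs).
Proof.
move=> IH ds xs le hds; split=> [|k i x gx]; first exact: laml.
apply: (gr_sum (res_grading P)) => m _ _.
have /Forall2_cat_inv[d1 [d2 [e h1 h2]]] : List.Forall2 (Ext_gr P) ds (take m xs ++ drop m xs).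
  by rewrite cat_take_drop.
have sz : (size (take m xs) + size (drop m xs) = size xs)%N.
  by rewrite -size_cat cat_take_drop.
have zero : res_gr P (k - (\sum_(e <- ds) e + (2 - (size xs)%:Z, 0)).1,
     i - (\sum_(e <- ds) e + (2 - (size xs)%:Z, 0)).2) 0 by apply: gr0; apply: res_grading.
case: (take m xs) sz h1 => [|a u] sz h1; first by rewrite Ff_nil /cj (addm0 sgD).
case: (drop m xs) sz h2 => [|c v] sz h2.
  by rewrite Ff_nil /cj (addm0 sgD) Ff0 (addm0 sgD).
have hu : (0 < size (a :: u) <= n)%N by move: sz => /=; lia.
have hv : (0 < size (c :: v) <= n)%N by move: sz => /=; lia.
have [_ h] := End_gr_comp (End_gr_cj (IH _ _ hu h1)) (IH _ _ hv h2).
have {}h := h _ _ _ gx; move: h; rewrite e big_cat -sz /=.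
case: (\sum_(i <- d1) i) => p1 j1; case: (\sum_(i <- d2) i) => p2 j2 h.
by apply: res_gr_eq h _; rewrite /= PoszD; congr (_, _); lia.
Qed.

Lemma Ff_gr ds xs : (0 < size xs)%N -> List.Forall2 (Ext_gr P) ds xs ->
  End_gr P (\sum_(e <- ds) e + (1 - (size xs)%:Z, 0)) (Ff xs).
Proof.
have [n le] := ubnP (size xs); elim: n ds xs le => // n IH ds xs le s0 hds.
have lg : End_gr P (\sum_(e <- ds) e + (2 - (size xs)%:Z, 0)) (lam xs).
  case: n IH le => [|n] IH le; first by move: s0 le; case: (size xs).
  by apply: (@lam_gr_aux n) => // ds' xs' /andP[s' le'] h; apply: IH.
case: xs s0 hds lg {le} => [//|x [|y xs]] _ hds lg.
  inversion hds as [|e ? ds' ? ge gs]; subst; inversion gs; subst.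
  rewrite big_seq1 /= subrr addr0; exact: End_gr_lift.
have -> : Ff [:: x, y & xs] = fun z => - T (lam [:: x, y & xs]) z.
  by apply: funext => z; rewrite (FfE hgr hconn hXh hX hs) sub0r.
apply: End_gr_opp; move: lg.
case: (\sum_(e <- ds) e) => p j; set k := size _ => lg.
have -> : (p, j) + (1 - k%:Z, 0) = (((p, j) + (2 - k%:Z, 0)).1 - 1, ((p, j) + (2 - k%:Z, 0)).2).
  by congr (_, _) => /=; lia.
by apply: End_gr_htp; case: (_ + _) lg.
Qed.

Lemma lam_gr ds xs : List.Forall2 (Ext_gr P) ds xs ->
  End_gr P (\sum_(e <- ds) e + (2 - (size xs)%:Z, 0)) (lam xs).
Proof.
move=> h; apply: (@lam_gr_aux (size xs)) => // ds' xs' /andP[s0 _]; exact: Ff_gr.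
Qed.

End Degrees.

Section Multilinearity.

Lemma lam_multilinear_aux n : (forall xs ys (c : F) x y z, (size xs + size ys < n)%N ->
    Ff (xs ++ (c *: x + y) :: ys) z = c%:A *: Ff (xs ++ x :: ys) z + Ff (xs ++ y :: ys) z) ->
  forall xs ys (c : F) x y z, (size xs + size ys <= n)%N ->
    lam (xs ++ (c *: x + y) :: ys) z =
    c%:A *: lam (xs ++ x :: ys) z + lam (xs ++ y :: ys) z.
Proof.
move=> IH xs ys c x y z le; rewrite !lamE !dec_cat_cons scalerDr addrACA.
have sD : addm (fun y : P => c%:A *: y) by move=> u v; rewrite scalerDr.
rewrite !(dec_addm _ _ sD) -!decD; congr (_ + _); apply: eq_dec => u v e.
  case: u e => [|a u] e; first by rewrite Ff_nil /cj (addm0 sgD) scaler0 addr0.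
  have lt : (size v + size ys < n)%N by apply: leq_trans le; rewrite -e size_cat /=; lia.
  by rewrite (IH _ _ _ _ _ _ lt) (cj_linear hgr (Fl _)).
case/lastP: v e => [|v a] e; first by rewrite Ff_nil /cj !(addm0 sgD) !Ff0 !(addm0 sgD) scaler0 addr0.
have lt : (size xs + size u < n)%N.
  by apply: leq_trans le; rewrite -e size_cat size_rcons /=; lia.
by rewrite /cj (IH _ _ _ _ _ _ lt) sgl.
Qed.

Lemma Ff_multilinear xs ys (c : F) x y z :
  Ff (xs ++ (c *: x + y) :: ys) z = c%:A *: Ff (xs ++ x :: ys) z + Ff (xs ++ y :: ys) z.
Proof.
have [n le] := ubnP (size xs + size ys); elim: n xs ys c x y z le => // n IH xs ys c x y z le.
rewrite !(FfE hgr hconn hXh hX hs) scalerBr addrACA; congr (_ + _).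
  have e0 t : (1 < size t)%N -> Fone t z = 0 by case: t => [|? []].
  case: xs le => [|a xs] le; first case: ys le => [|b ys] le.
  - rewrite /= -(lift_flin hgr hconn hXh hX hs); congr (lift _ _ _ _ z).
    by apply: funext => w; rewrite (repE hgr hconn hmin).
  - by rewrite !e0 //= scaler0 addr0.
  - by rewrite !e0 ?scaler0 ?addr0 // size_cat /= addnS.
rewrite -opprD -(htp_flin hgr hconn hXh hX hs); congr (- _).
apply: (eq_htp hgr hconn hXh hX hs) => b Xb.
by apply: (@lam_multilinear_aux n) => // *; apply: IH.
Qed.

Lemma lam_multilinear xs ys (c : F) x y z :
  lam (xs ++ (c *: x + y) :: ys) z = c%:A *: lam (xs ++ x :: ys) z + lam (xs ++ y :: ys) z.
Proof.
by apply: (@lam_multilinear_aux (size xs + size ys)) => // *; apply: Ff_multilinear.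
Qed.

Lemma Ff_zero xs ys z : Ff (xs ++ 0 :: ys) z = 0.
Proof.
have := Ff_multilinear xs ys (-1) 0 0 z; rewrite scaler0 addr0.
by rewrite !scaleN1r addNr.
Qed.

Definition auglam (xs : seq E) : P -> F^o := fun z => aug (lam xs z).

Lemma auglam_multilinear : multilinear id auglam.
Proof.
move=> xs ys c x y; apply: funext => z; rewrite /auglam lam_multilinear.
by rewrite res_augD (res_aug_alg hgr hconn).
Qed.

Lemma auglam_cochain ds xs : List.Forall2 (Ext_gr P) ds xs ->
  cochain (\sum_(e <- ds) e + (2 - (size xs)%:Z, 0)) (auglam xs).
Proof.
move=> /lam_gr[ll lg]; split.
  split=> [x y|c x|i a x i0 ga]; rewrite /auglam.
  - by rewrite (lin_addm ll) res_augD.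
  - by rewrite (linZ ll) (res_aug_alg hgr hconn).
  - by rewrite (linZ ll) (res_augZ hgr hconn) (augA_pos hgr hconn i0 ga) mul0r.
move=> [n i] x ne gx; apply: (res_aug_degree _ (lg _ _ _ gx)) => -[e1 e2].
by apply: ne; rewrite [RHS]surjective_pairing; congr (_, _); apply/subr0_eq.
Qed.

Lemma auglam_cocycles xs : lspan cocycles (auglam xs).
Proof.
have hE := Ext_grading hgr hconn hmin.
apply: (multilinear_ind auglam_multilinear (lspan_submod _) (homog_span hE) (n := size xs)) => //.
move=> ys _ hy; have [ds hds] := homog_degrees hy.
exact: (cochain_cocycles hgr hconn hmin (auglam_cochain hds)).
Qed.

Lemma auglam_short xs : (size xs <= 1)%N -> auglam xs = 0.
Proof.
case: xs => [|x [|y xs]] // _; apply: funext => z; rewrite /auglam.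
  by rewrite lam_nil (addm0 (@res_augD _ _ _ P)).
by rewrite (lam1 hX) (addm0 (@res_augD _ _ _ P)).
Qed.

(** The transferred operations in the convention of the bar construction, where each has degree one
    and [tau] is the only sign. *)
Definition bb (xs : seq E) : E := Ext_class (auglam xs).

Lemma rep_bb xs : rep (bb xs) = auglam xs.
Proof. exact/(rep_class hgr hconn hmin)/auglam_cocycles. Qed.

Lemma bb_short xs : (size xs <= 1)%N -> bb xs = 0.
Proof.
move=> le; apply: rep_inj; rewrite rep_bb auglam_short //.
by rewrite (addm0 (lin_addm (rep_linear hgr hconn hmin))).
Qed.

Lemma bb_multilinear : multilinear id bb.
Proof.
move=> xs ys c x y; apply: rep_inj; rewrite (rep_linear hgr hconn hmin) !rep_bb.
exact: auglam_multilinear.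
Qed.

Lemma bb_gr ds xs : List.Forall2 (Ext_gr P) ds xs ->
  Ext_gr P (\sum_(e <- ds) e + (2 - (size xs)%:Z, 0)) (bb xs).
Proof.
by move=> h; apply/(Ext_grP hgr hconn hmin); rewrite rep_bb; apply: auglam_cochain.
Qed.

End Multilinearity.

End TransferEquations.

Section TransferEquations.
Variables (F : fieldType) (A : algType F) (gr : nat -> set A).
Hypotheses (hgr : graded_algebra gr) (hconn : connected_algebra gr).
Variables (P : resolution gr) (X : set P).
Hypothesis hXh : X `<=` [set x | exists nj, res_gr P nj x].
Hypothesis hX : is_basis X.
Hypothesis hmin : minimal_resolution P.
Variables (s : P -> P) (x0 : P).
Hypothesis hs : contraction s x0.

Local Notation E := (Ext P).
Local Notation aug := (res_aug P).
Local Notation sg := (@parity F A gr _).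
Local Notation T := (htp X s).
Local Notation ii := (lift X s x0).
Local Notation Ff := (Ff X s x0).
Local Notation lam := (lam X s x0).
Local Notation Fone := (Fone X s x0).

Let sgD : addm (@parity F A gr P) := @parityD F A gr P.
Let sgK (x : P) : sg (sg x) = x := parityK hgr x.
Let Fl := @Ff_linear F A gr P X hX s x0.
Let FD xs : addm (Ff xs) := lin_addm (Fl xs).
Let laml := @lam_linear F A gr hgr P X hX s x0.


Local Notation bb := (bb X s x0).
Local Notation auglam := (auglam X s x0).
Let Fzero := @Ff_zero F A gr hgr hconn P X hXh hX hmin s x0 hs.

(** The coderivation of the tensor coalgebra induced by [bb], followed by [K]. *)
Definition ins (V : zmodType) (K : seq E -> V) (xs : seq E) : V :=
  dec (fun u => dec (fun v w => K (map (@tau F A gr P) u ++ bb v :: w))) xs.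

Lemma ins_addm (V W : zmodType) (g : V -> W) (K : seq E -> V) xs : addm g ->
  g (ins K xs) = ins (fun t => g (K t)) xs.
Proof.
move=> gD; rewrite /ins (dec_addm _ _ gD); apply: eq_dec => u v _.
by rewrite (dec_addm _ _ gD).
Qed.

Lemma insB (V : zmodType) (K L : seq E -> V) xs :
  ins (fun t => K t - L t) xs = ins K xs - ins L xs.
Proof. by rewrite /ins -decB; apply: eq_dec => u v _; rewrite decB. Qed.

Lemma eq_ins (V : zmodType) (K L : seq E -> V) xs : K =1 L -> ins K xs = ins L xs.
Proof. by move=> e; apply: eq_dec => u v _; apply: eq_dec => v1 w _; apply: e. Qed.

Lemma ins_nil (V : zmodType) (K : seq E -> V) : K [:: 0] = 0 -> ins K [::] = 0.
Proof. by move=> K0; rewrite /ins !dec_nil (bb_short hgr hconn hXh hX hmin hs). Qed.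

Lemma ins_linear (K : seq E -> P -> P) xs : (forall t, linear (K t)) ->
  linear (fun z => ins (fun t => K t z) xs).
Proof.
move=> Kl a x y.
have sD : addm (fun y : P => a *: y) by move=> u v; rewrite scalerDr.
rewrite (ins_addm _ _ sD) /ins -decD; apply: eq_dec => u v _.
by rewrite -decD; apply: eq_dec => v1 w _; rewrite Kl.
Qed.

Let DF ys z := ins (fun t => Ff t z) ys - lam ys z.

Let DF_linear ys : linear (DF ys).
Proof. exact/lin_sub/laml/ins_linear/Fl. Qed.

Let DF_nil z : DF [::] z = 0.
Proof. by rewrite /DF ins_nil ?lam_nil ?subr0 //; apply: (Fzero [::]). Qed.

(** Leibniz for compositions, together with the equation dif F = ins F - lam on shorter pieces. The
    triple compositions cancel, and what remains is lam with [bb] inserted in its left or right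
    factor. *)
Lemma dif_lam xs z : (forall ys, (size ys < size xs)%N -> dif (Ff ys) =1 DF ys) ->
  dif (lam xs) z = - ins (fun t => lam t z) xs.
Proof.
move=> IH.
have -> : dif (lam xs) z = dec (fun u v => - cj (DF u) (Ff v z) + Ff u (DF v z)) xs.
  rewrite {1}/dif !lamE (dec_addm _ _ (@res_d_addm _ _ _ P)) (dec_addm _ _ sgD) -decB.
  apply: eq_dec => u v e.
  rewrite -[LHS]/(dif (fun z => cj (Ff u) (Ff v z)) z) (dif_comp hgr); last exact: cj_linear.
  rewrite (dif_cj hgr _ (Fl u)) -[cj (cj _)]/(cj (cj (Ff u))) (cjK hgr).
  have sz : (size u + size v = size xs)%N by rewrite -size_cat e.
  have dl t : linear (dif (Ff t)) by apply: dif_linear.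
  have d0 y : dif (Ff [::]) y = 0 by rewrite /dif /= linear0 (addm0 sgD) subrr.
  case: u e sz => [|a u] e sz; first by rewrite /cj d0 DF_nil.
  case: v e sz => [|c v] e sz.
    rewrite d0 DF_nil /cj -[Ff [::] z]/0 (addm0 sgD).
    by rewrite (addm0 (lin_addm (DF_linear _))) (addm0 (lin_addm (dl _))).
  by rewrite /cj !IH //; move: sz => /=; lia.
have -> : dec (fun u v => - cj (DF u) (Ff v z) + Ff u (DF v z)) xs =
   dec (fun u v => Ff u (ins (fun t => Ff t z) v)) xs -
   dec (fun u v => sg (ins (fun t => Ff t (sg (Ff v z))) u)) xs.
  have -> : dec (fun u v => - cj (DF u) (Ff v z) + Ff u (DF v z)) xs =
    dec (fun u v => (Ff u (ins (fun t => Ff t z) v) - Ff u (lam v z)) +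
      (sg (lam u (sg (Ff v z))) - sg (ins (fun t => Ff t (sg (Ff v z))) u))) xs.
    apply: eq_dec => u v _.
    by rewrite /cj /DF (addmB sgD) opprB (addmB (FD u)) addrC.
  rewrite decD !decB.
  (* Both triple compositions are the same sum over cuts into three pieces, by coassociativity. *)
  have -> : dec (fun u v => sg (lam u (sg (Ff v z)))) xs = dec (fun u v => Ff u (lam v z)) xs.
    transitivity (dec (fun u v => dec (fun u1 u2 => Ff u1 (cj (Ff u2) (Ff v z))) u) xs).
      apply: eq_dec => u v _; rewrite lamE (dec_addm _ _ sgD); apply: eq_dec => u1 u2 _.
      by rewrite /cj sgK.
    rewrite -(dec_coassoc (fun u1 u2 v => Ff u1 (cj (Ff u2) (Ff v z)))).
    by apply: eq_dec => u v _; rewrite lamE (dec_addm _ _ (FD u)).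
  by rewrite addrA subrK.
rewrite -[RHS]opprK opprK -opprB; congr (- _).
transitivity (dec (fun u vw => dec (fun v w =>
   - dec (fun a c => Ff a (Ff (map (@tau F A gr P) c ++ bb v :: w) z)) u +
   dec (fun a c => cj (Ff (map (@tau F A gr P) u ++ bb v :: a)) (Ff c z)) w) vw) xs); last first.
  apply: eq_dec => u vw _; apply: eq_dec => v w _.
  rewrite lamE dec_cat_cons dec_map -decN; congr (_ + _); apply: eq_dec => a c _.
  exact/esym/(Ff_tau hgr hconn hXh hX hmin hs).
transitivity (dec (fun u vw => - dec (fun v w =>
   dec (fun a c => Ff a (Ff (map (@tau F A gr P) c ++ bb v :: w) z)) u) vw +
   dec (fun v w => dec (fun a c => cj (Ff (map (@tau F A gr P) u ++ bb v :: a)) (Ff c z)) w) vw) xs);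
   last first.
  by apply: eq_dec => u vw _; rewrite -decN -decD.
rewrite decD decN [RHS]addrC; congr (_ + - _); last first.
  transitivity (dec (fun u vw => dec (fun a c => dec (fun v w =>
     Ff a (Ff (map (@tau F A gr P) c ++ bb v :: w) z)) vw) u) xs).
    rewrite -(dec_coassoc (fun a c vw => dec (fun v w =>
       Ff a (Ff (map (@tau F A gr P) c ++ bb v :: w) z)) vw)).
    apply: eq_dec => u v _; rewrite (ins_addm _ _ (FD u)).
    by apply: eq_dec => u' v' _.
  by apply: eq_dec => u vw _; rewrite /dec exchange_big.
transitivity (dec (fun u vw => dec (fun a c => dec (fun v w =>
   cj (Ff (map (@tau F A gr P) u ++ bb v :: w)) (Ff c z)) a) vw) xs); last first.
  apply: eq_dec => u vw _.
  by rewrite (dec_coassoc (fun v w c => cj (Ff (map (@tau F A gr P) u ++ bb v :: w)) (Ff c z))).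
rewrite (dec_coassoc (fun u a c => dec (fun v w =>
   cj (Ff (map (@tau F A gr P) u ++ bb v :: w)) (Ff c z)) a)).
apply: eq_dec => u v _; rewrite (ins_addm _ _ sgD); apply: eq_dec => a c _.
by apply: eq_dec.
Qed.

Lemma ins_Fone xs z : ins (fun t => Fone t z) xs = ii (rep (bb xs)) z.
Proof.
have h x u v w : Fone (map (@tau F A gr P) (x :: u) ++ bb v :: w) z = 0.
  by rewrite /=; case: (map _ u ++ _) (size_cat (map (@tau F A gr P) u) (bb v :: w)) => //=; lia.
rewrite /ins dec_first => [|x u v]; last first.
  by rewrite (eq_dec (G' := fun _ _ => 0)) ?dec0 // => v1 w _; apply: h.
by rewrite dec_last.
Qed.

(** The A-infinity morphism equation. Applied to F = Fone - T lam, the homotopy identity yields lam,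
    the lift of aug lam, which equals ins Fone, and T (dif lam) = - ins (T lam). *)
Lemma Ff_dif xs z : dif (Ff xs) z = ins (fun t => Ff t z) xs - lam xs z.
Proof.
move: z; have [n le] := ubnP (size xs); elim: n xs le => // n IH xs le z.
have dl y : dif (lam xs) y = - ins (fun t => lam t y) xs.
  by apply: dif_lam => ys lt w; apply: IH; apply: leq_trans lt le.
have FE t y : Ff t y = Fone t y - T (lam t) y by apply: (FfE hgr hconn hXh hX hs).
rewrite (eq_dif _ (FE xs)) dif_add // dif_opp //.
have -> : dif (Fone xs) z = 0.
  case: xs {le dl} => [|x [|y xs]] /=.
  - by rewrite /dif linear0 (addm0 sgD) subrr.
  - apply: (dif_lift hgr hconn hXh hX hs); first exact: rep_trivial.
    by move=> y; apply: (trivial_min hgr hconn hmin); apply: rep_trivial.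
  - by rewrite /dif linear0 (addm0 sgD) subrr.
have : dif (T (lam xs)) z = lam xs z - ii (auglam xs) z - T (dif (lam xs)) z.
  apply: (addIr (T (dif (lam xs)) z)); rewrite subrK.
  exact: (dif_htp hgr hconn hXh hX hs z (laml xs)).
have -> : T (dif (lam xs)) z = - ins (fun t => T (lam t) z) xs.
  rewrite (eq_htp hgr hconn hXh hX hs (v := fun y => - ins (fun t => lam t y) xs)) => [|b _]; last exact: dl.
  have Tz := T_addm hgr hconn hXh hX hs z.
  transitivity (- T (fun y => ins (fun t => lam t y) xs) z).
    exact: (addmN Tz (fun y => ins (fun t => lam t y) xs)).
  congr (- _); rewrite /ins (T_dec hgr hconn hXh hX hs); apply: eq_dec => u v _.
  exact: (T_dec hgr hconn hXh hX hs (fun v1 w => lam (map (@tau F A gr P) u ++ bb v1 :: w))).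
move=> ->; rewrite (eq_ins _ (fun t => FE t z)) insB ins_Fone rep_bb //.
rewrite add0r; set a := lam xs z; set b := lift _ _ _ _ _; set c := ins _ xs.
by rewrite opprK !opprD opprK -addrA addrC.
Qed.

(** The A-infinity relations: ins lam = - dif lam, and aug (dif lam) = 0 because aug d = 0 and, by
    minimality, aug lam vanishes on boundaries. *)
Lemma ins_bb xs : ins bb xs = 0.
Proof.
apply: rep_inj; rewrite (addm0 (lin_addm (rep_linear hgr hconn hmin))).
have rD := lin_addm (rep_linear hgr hconn hmin).
rewrite (ins_addm _ _ rD); apply: funext => z.
have eD : addm (fun phi : P -> F^o => phi z) by [].
transitivity (ins (fun t => rep (bb t) z) xs).
  exact: (ins_addm (fun t => rep (bb t)) xs eD).
have aD := @res_augD _ _ _ P.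
have -> : ins (fun t => rep (bb t) z) xs = aug (ins (fun t => lam t z) xs).
  rewrite (ins_addm _ _ aD); apply: eq_ins => t; by rewrite rep_bb.
have -> : ins (fun t => lam t z) xs = - dif (lam xs) z.
  by rewrite dif_lam ?opprK // => ys _ w; apply: Ff_dif.
rewrite (addmN aD) /dif (addmB aD) res_aug_d sub0r opprK (aug_parity hgr hconn).
rewrite -[LHS]/(auglam xs (sg (res_d P z))) parity_d (addmN _); last first.
  by case: (cocycles_trivial (auglam_cocycles hgr hconn hXh hX hmin hs xs)).
by rewrite (trivial_min hgr hconn hmin) ?oppr0 //; apply/cocycles_trivial/auglam_cocycles.
Qed.

End TransferEquations.

(** * From the signs of the bar construction to those of the definition *)

Section Twist.
Variables (F : fieldType) (E : lmodType F) (par : E -> E).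
Variable gE : int * int -> set E.
Hypothesis par_linear : linear par.
Hypothesis par_hom : forall p j x, gE (p, j) x -> par x = sgn F p *: x.
Hypothesis par_gr : forall pj x, gE pj x -> gE pj (par x).

(* Removes the Koszul signs between the operations of the definition and those
   of the bar construction: x_1, ..., x_n becomes (-1)^e x_1, ..., x_n with
   e = sum of (n - k) |x_k|. *)
Fixpoint twk (k : nat) (xs : seq E) : seq E :=
  if xs is x :: xs' then iter (size xs' + k) par x :: twk k xs' else [::].

Fixpoint eps (k : nat) (ds : seq (int * int)) : int :=
  if ds is e :: ds' then (size ds' + k)%N%:Z * e.1 + eps k ds' else 0.

Lemma size_twk k xs : size (twk k xs) = size xs.
Proof. by elim: xs => //= x xs ->. Qed.

Lemma twk_cat k xs ys : twk k (xs ++ ys) = twk (size ys + k) xs ++ twk k ys.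
Proof. by elim: xs => //= x xs ->; rewrite size_cat addnA. Qed.

Lemma iter_par_linear n : linear (iter n par).
Proof. by elim: n => [|n IH] a x y //=; rewrite IH par_linear. Qed.

Lemma iter_par_gr n pj x : gE pj x -> gE pj (iter n par x).
Proof. by move=> gx; elim: n => //= n; apply: par_gr. Qed.

Lemma iter_par_hom n p j x : gE (p, j) x -> iter n par x = sgn F (n%:Z * p) *: x.
Proof.
move=> gx; elim: n => [|n IH] /=; first by rewrite mul0r sgn0 scale1r.
by rewrite (par_hom (iter_par_gr n gx)) IH scalerA -sgnD; congr (sgn F _ *: _); lia.
Qed.

Lemma twk_gr k ds xs : List.Forall2 gE ds xs -> List.Forall2 gE ds (twk k xs).
Proof.
elim=> [|e x ds' xs' gx _ IH] /=; first by constructor.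
by constructor=> //; apply: iter_par_gr.
Qed.

Lemma eps_cat k a b : eps k (a ++ b) = eps (size b + k) a + eps k b.
Proof. by elim: a => [|e a IH] /=; rewrite ?add0r // IH size_cat addnA addrA. Qed.

Lemma eps_shift k l ds : eps (k + l) ds = eps k ds + l%:Z * (\sum_(e <- ds) e).1.
Proof.
elim: ds => [|e ds IH] /=; first by rewrite big_nil mulr0.
rewrite IH big_cons /= mulrDr addnA PoszD mulrDl; lia.
Qed.

Section Multi.
Variables (V : lmodType F) (K : seq E -> V).
Hypothesis Km : multilinear id K.

Lemma twk_sign k ds xs zs : List.Forall2 gE ds xs ->
  K (zs ++ twk k xs) = sgn F (eps k ds) *: K (zs ++ xs).
Proof.
move=> h; elim: h zs => [|[p j] x ds' xs' gx h IH] zs /=; first by rewrite scale1r.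
rewrite (iter_par_hom _ gx) (multilinearZ Km) -cat_rcons IH cat_rcons scalerA.
by rewrite -sgnD (Forall2_size h).
Qed.

Lemma tau_sign ds us zs ys : List.Forall2 gE ds us ->
  K (zs ++ map (fun x => - par x) us ++ ys) =
  sgn F ((\sum_(e <- ds) e).1 + (size us)%:Z) *: K (zs ++ us ++ ys).
Proof.
move=> h; elim: h zs => [|[p j] x ds' xs' gx h IH] zs /=.
  by rewrite big_nil /= addr0 scale1r.
rewrite (par_hom gx) -scaleNr (multilinearZ Km) -cat_rcons IH cat_rcons scalerA.
congr (_ *: _); rewrite -[- sgn F p]sgnS -sgnD; congr (sgn F _).
rewrite big_cons /=; lia.
Qed.

End Multi.

End Twist.

Lemma Forall2_take_drop (S T : Type) (R : S -> T -> Prop) ds xs i :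
  List.Forall2 R ds xs ->
  List.Forall2 R (take i ds) (take i xs) /\ List.Forall2 R (drop i ds) (drop i xs).
Proof.
move=> h; elim: h i => [|e x ds' xs' hx h IH] [|i] /=; try by split; constructor.
by have [h1 h2] := IH i; split=> //; constructor.
Qed.

Lemma sum_dec_triples (T : Type) (V : zmodType) (H : seq T -> seq T -> seq T -> V) xs :
  (forall u w, H u [::] w = 0) ->
  \sum_(i < size xs) \sum_(1 <= t < (size xs - i).+1)
    H (take i xs) (take t (drop i xs)) (drop (i + t) xs) =
  dec (fun u => dec (H u)) xs.
Proof.
move=> H0; rewrite /dec big_ord_recr /= drop_size /= big_ord1 /= H0 addr0.
apply: eq_bigr => i _; rewrite size_drop big_ord_recl take0 H0 add0r big_add1 big_mkord.
by apply: eq_bigr => t _; rewrite drop_drop addnC.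
Qed.

Section InsertionSums.
Variables (F : fieldType) (E : lmodType F) (par : E -> E).
Variable gE : int * int -> set E.
Hypothesis par_linear : linear par.
Hypothesis par_hom : forall p j x, gE (p, j) x -> par x = sgn F p *: x.
Hypothesis par_gr : forall pj x, gE pj x -> gE pj (par x).
Variables (b : seq E -> E) (V : lmodType F) (K : seq E -> V).
Hypotheses (bm : multilinear id b) (Km : multilinear id K).
Hypothesis b_gr : forall ds xs, List.Forall2 gE ds xs ->
  gE (\sum_(e <- ds) e + (2 - (size xs)%:Z, 0)) (b xs).
Hypothesis b_nil : b [::] = 0.

Let twist := twk par 0.

Lemma insertion_sum_twist ds xs : List.Forall2 gE ds xs ->
  insertion_sum (fun xs => b (twist xs)) (fun xs => K (twist xs)) ds xs =
  sgn F (eps 0 ds) *: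
    dec (fun u => dec (fun v w => K (map (fun x => - par x) u ++ b v :: w))) xs.
Proof.
move=> h; have sz := Forall2_size h; rewrite -sum_dec_triples; last first.
  by move=> u w; rewrite b_nil (multilinear0 Km).
rewrite scaler_sumr; apply: eq_bigr => i _.
rewrite scaler_sumr; apply: eq_big_nat => t /andP[t1 t2].
have [hu h'] := Forall2_take_drop i h; have [hv hw'] := Forall2_take_drop t h'.
set u := take i xs in hu *; set v := take t (drop i xs) in hv *.
rewrite !drop_drop in hw'; rewrite ![(t + i)%N]addnC in hw'.
set w := drop (i + t) xs in hw' *; set du := take i ds in hu *.
set dv := take t (drop i ds) in hv *; set dw := drop (i + t) ds in hw' *.
have eds : ds = du ++ dv ++ dw.
  by rewrite /du /dv /dw [(i + t)%N]addnC -drop_drop cat_take_drop cat_take_drop.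
have su : size u = i by rewrite size_takel //; have := ltn_ord i; lia.
have sv : size v = t by rewrite size_takel // size_drop; lia.
have sw : size w = (size xs - i - t)%N by rewrite size_drop subnDA.
have gbv := b_gr (twk_gr par_gr 0 hv).
have hall : List.Forall2 gE (du ++ (\sum_(e <- dv) e + (2 - (size (twist v))%:Z, 0)) :: dw)
    (u ++ b (twist v) :: w).
  by apply: List.Forall2_app => //; constructor.
have := twk_sign par_hom par_gr Km 0 [::] hall; rewrite /= -/twist => ->.
have := twk_sign par_hom par_gr bm 0 [::] hv; rewrite /= -/twist => ->.
rewrite (multilinearZ Km) -[map _ u ++ _]cat0s (tau_sign par_hom Km _ _ hu) cat0s !scalerA.
congr (_ *: _); rewrite -!sgnD eds !eps_cat /= size_twk size_cat !addn0.
rewrite (Forall2_size hv) (Forall2_size hw') su sv sw.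
move: (size xs - i - t)%N => j.
have e0 l es : eps l es = eps 0 es + l%:Z * (\sum_(e <- es) e).1 by exact: (eps_shift 0 l).
rewrite (e0 j.+1) (e0 (t + j)%N) (e0 j).
move: (\sum_(e <- du) e).1 (\sum_(e <- dv) e).1 (eps 0 du) (eps 0 dv) (eps 0 dw) => p q a1 a2 a3.
(* The exponents agree once j is added twice, j being the number of arguments to the right of the
   insertion. *)
rewrite -[RHS](sgn_double _ _ j%:Z); congr (sgn F _).
rewrite !PoszD !PoszM; lia.
Qed.

End InsertionSums.

Section MinimalModel.
Variables (F : fieldType) (A : algType F) (gr : nat -> set A).
Hypotheses (hgr : graded_algebra gr) (hconn : connected_algebra gr).
Variables (P : resolution gr) (X : set P).
Hypothesis hXh : X `<=` [set x | exists nj, res_gr P nj x].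
Hypothesis hX : is_basis X.
Hypothesis hmin : minimal_resolution P.
Variables (s : P -> P) (x0 : P).
Hypothesis hs : contraction s x0.
Hypothesis hsX : forall b, X b -> s b = 0.

Local Notation E := (Ext P).
Local Notation aug := (res_aug P).
Local Notation sg := (@parity F A gr _).
Local Notation T := (htp X s).
Local Notation ii := (lift X s x0).
Local Notation Ff := (Ff X s x0).
Local Notation lam := (lam X s x0).
Local Notation bb := (bb X s x0).
Local Notation one := (Ext_one P).

Let sgl := parity_linear hgr (P := P).
Let sgD : addm (@parity F A gr P) := @parityD F A gr P.
Let sgK (x : P) : sg (sg x) = x := parityK hgr x.
Let Fl := @Ff_linear F A gr P X hX s x0.
Let augD := @res_augD F A gr P.
Let Ff_rec := FfE hgr hconn hXh hX hs.
Let parEl := parityE_linear hgr hconn hmin.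
Let parEh := parityE_hom hgr hconn hmin.
Let parEg := parityE_gr hgr hconn hmin.
Let b_short := bb_short hgr hconn hXh hX hmin hs.
Let bmul := bb_multilinear hgr hconn hXh hX hmin hs.
Let bgr := bb_gr hgr hconn hXh hX hmin hs.
Let repL := rep_linear hgr hconn hmin.

Definition twist := twk (@parityE F A gr P) 0.
Definition mm (xs : seq E) : E := bb (twist xs).
Definition ff (xs : seq E) : P -> P := Ff (twist xs).

Lemma size_twist xs : size (twist xs) = size xs. Proof. exact: size_twk. Qed.

Lemma twist_cat (xs ys : seq E) : exists us vs n, forall z : E,
  twist (xs ++ z :: ys) = us ++ iter n (@parityE F A gr P) z :: vs.
Proof.
exists (twk (@parityE F A gr P) (size ys).+1 xs), (twist ys), (size ys) => z.
by rewrite /twist twk_cat /= !addn0.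
Qed.

Lemma mm_multilinear : multilinear id mm.
Proof.
move=> xs ys c x y; have [us [vs [n e]]] := twist_cat xs ys.
by rewrite /mm !e (iter_par_linear parEl) bmul.
Qed.

Lemma ff_multilinear : multilinear (fun c : F => c%:A : A) ff.
Proof.
move=> xs ys c x y; have [us [vs [n e]]] := twist_cat xs ys.
rewrite /ff !e (iter_par_linear parEl); apply: funext => z.
exact: (Ff_multilinear hgr hconn hXh hX hmin hs).
Qed.

Lemma twist_gr ds xs : List.Forall2 (Ext_gr P) ds xs -> List.Forall2 (Ext_gr P) ds (twist xs).
Proof. exact: twk_gr parEg _ _ _. Qed.

Lemma mm_gr ds xs : List.Forall2 (Ext_gr P) ds xs ->
  Ext_gr P (\sum_(e <- ds) e + (2 - (size xs)%:Z, 0)) (mm xs).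
Proof. by move=> /twist_gr/bgr; rewrite size_twist. Qed.

Lemma ff_gr ds xs : (0 < size xs)%N -> List.Forall2 (Ext_gr P) ds xs ->
  End_gr P (\sum_(e <- ds) e + (1 - (size xs)%:Z, 0)) (ff xs).
Proof.
move=> s0 /twist_gr h; have := Ff_gr hgr hconn hXh hX hmin hs _ h; rewrite size_twist.
exact.
Qed.

Lemma iter_parity_one n : iter n (@parityE F A gr P) one = one.
Proof. by elim: n => //= n ->; apply: parityE_one. Qed.

Lemma twist_one xs : one \in xs -> one \in twist xs.
Proof.
elim: xs => //= x xs IH; rewrite !inE => /orP[/eqP <-|/IH ->]; last by rewrite orbT.
by rewrite /twist /= iter_parity_one eqxx.
Qed.

(** As s vanishes on generators, the homotopy identity reads b = aug b x0 + s (d b), which is the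
    recursion defining the lift of the augmentation; so that lift is the identity. *)
Lemma Ff_one z : Ff [:: one] z = z.
Proof.
rewrite Ff1 (rep_one hgr hconn hmin) /lift; symmetry; move: z.
apply: (rec_unique hgr hconn hXh hX hs) => // b Xb.
by rewrite sgK; have := ctr_homotopy hs b; rewrite hsX // linear0 => /esym/eqP;
   rewrite subr_eq0 subr_eq addrC => /eqP.
Qed.

Lemma cj_Ff_one z : cj (Ff [:: one]) z = z.
Proof. by rewrite /cj Ff_one sgK. Qed.

(** Once F vanishes on shorter sequences containing the unit, a cut contributes only if it isolates
    the unit at one end. *)
Lemma lam_one_split xs u v : one \in xs -> u ++ v = xs ->
  (forall ys z, (1 < size ys < size xs)%N -> one \in ys -> Ff ys z = 0) ->
  [\/ forall z, cj (Ff u) (Ff v z) = 0,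
      u = [:: one] /\ size v = (size xs).-1 |
      v = [:: one] /\ size u = (size xs).-1].
Proof.
move=> xs1 e h; have sz : (size u + size v = size xs)%N by rewrite -size_cat e.
have : one \in u ++ v by rewrite e.
rewrite mem_cat => /orP[u1|v1].
  case: v e sz => [|y v] e sz.
    by apply: Or31 => z; rewrite Ff_nil /cj (addm0 sgD) (addm0 (lin_addm (Fl _))) (addm0 sgD).
  case: u u1 e sz => [//|x [|x' u]] u1 e sz.
    by apply: Or32; rewrite -sz; move: u1; rewrite inE => /eqP ->.
  apply: Or31 => z; rewrite /cj h ?(addm0 sgD) //; move: sz => /=; lia.
case: u e sz => [|x u] e sz; first by apply: Or31 => z; rewrite /cj Ff_nil (addm0 sgD).
case: v v1 e sz => [//|y [|y' v]] v1 e sz.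
  apply: Or33; rewrite -sz addn1; split=> //.
  by move: v1; rewrite inE => /eqP ->.
apply: Or31 => z; rewrite (@h (y :: y' :: v)) //; last by move: sz => /=; lia.
by rewrite /cj (addm0 sgD) (addm0 (lin_addm (Fl _))) (addm0 sgD).
Qed.

(** The surviving cuts give T (F v) and T (cj (F u)), both zero. *)
Lemma Ff_unit xs z : (1 < size xs)%N -> one \in xs -> Ff xs z = 0.
Proof.
move: z; have [n le] := ubnP (size xs); elim: n xs le => // n IH xs le z s1 xs1.
have h : T (lam xs) z = 0.
  rewrite [LHS](T_dec hgr hconn hXh hX hs (fun u v z => cj (Ff u) (Ff v z)) xs z).
  rewrite (eq_dec (G' := fun _ _ => 0)) ?dec0 // => u v e.
  have [|||h|[-> _]|[-> _]] := @lam_one_split xs u v.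
  - exact: xs1.
  - exact: e.
  - by move=> ys y /andP[s1' s2]; apply: IH => //; apply: leq_trans s2 le.
  - by apply: (htp_kill hgr hconn hXh hX hs) => b _; rewrite h (addm0 (ctr_addm hs)).
  - rewrite (eq_htp hgr hconn hXh hX hs (v := Ff v)) ?(T_Ff hgr hconn hXh hX hs) // => b _.
    exact: cj_Ff_one.
  - rewrite (eq_htp hgr hconn hXh hX hs (v := cj (Ff u))) ?(T_cj_Ff hgr hconn hXh hX hs) // => b _.
    by rewrite Ff_one.
rewrite Ff_rec h subr0; by case: xs s1 {h le xs1} => [|? []].
Qed.

(** The surviving cuts give the augmentation of F on a sequence of length other than 1, which is
    0. *)
Lemma bb_unit xs : size xs != 2%N -> one \in xs -> bb xs = 0.
Proof.
move=> s2 xs1; have [le|gt] := leqP (size xs) 1; first exact: b_short.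
apply: rep_inj; rewrite (rep_bb hgr hconn hXh hX hmin hs) (addm0 (lin_addm repL)).
apply: funext => z; rewrite /auglam lamE (dec_addm _ _ augD).
rewrite (eq_dec (G' := fun _ _ => 0)) ?dec0 // => u v e.
have [|||h|[eu sv]|[ev su]] := @lam_one_split xs u v.
- exact: xs1.
- exact: e.
- by move=> ys y /andP[s1' _]; apply: Ff_unit.
- by rewrite h (addm0 augD).
- rewrite eu cj_Ff_one (aug_Ff hgr hconn hXh hX hs) // sv; move: s2 gt; lia.
- rewrite ev Ff_one /cj (aug_parity hgr hconn) (aug_Ff hgr hconn hXh hX hs) // su.
  by move: s2 gt; lia.
Qed.

Lemma lam2 x y z : lam [:: x; y] z = cj (Ff [:: x]) (Ff [:: y] z).
Proof.
have e0 : cj (Ff [::]) (Ff [:: x; y] z) = 0 by rewrite /cj Ff_nil (addm0 sgD).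
have e1 : cj (Ff [:: x; y]) (Ff [::] z) = 0.
  by rewrite Ff_nil /cj (addm0 sgD) (addm0 (lin_addm (Fl _))) (addm0 sgD).
by rewrite lamE !dec_cons dec_nil e0 e1 add0r addr0.
Qed.

(** The Yoneda product: y is lifted to a chain map, to which x is applied. *)
Lemma rep_mm2 x y z : rep (mm [:: x; y]) z = rep x (ii (rep y) z).
Proof.
rewrite /mm /twist /= (rep_bb hgr hconn hXh hX hmin hs) /auglam lam2 !Ff1 /cj.
rewrite (aug_parity hgr hconn) (aug_lift hgr hconn hXh hX hs); last exact: rep_trivial.
by rewrite (rep_parity hgr hconn hmin) sgK.
Qed.

Lemma mm_one_l x : mm [:: one; x] = x.
Proof.
apply: rep_inj; apply: funext => z; rewrite rep_mm2 (rep_one hgr hconn hmin).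
by rewrite (aug_lift hgr hconn hXh hX hs) //; exact: rep_trivial.
Qed.

Lemma mm_one_r x : mm [:: x; one] = x.
Proof. by apply: rep_inj; apply: funext => z; rewrite rep_mm2 -Ff1 Ff_one. Qed.

Lemma mm1 x : mm [:: x] = 0. Proof. exact: b_short. Qed.

Lemma mm_relation ds xs : List.Forall2 (Ext_gr P) ds xs -> insertion_sum mm mm ds xs = 0.
Proof.
move=> h.
rewrite (insertion_sum_twist parEh parEg bmul bmul bgr (b_short (xs := [::]) isT) h).
by have := ins_bb hgr hconn hXh hX hmin hs xs; rewrite /ins => ->; rewrite scaler0.
Qed.

Lemma mm_A_infinity : A_infinity_algebra (Ext_gr P) one mm.
Proof.
split.
- split; [exact: Ext_grading|move=> pj c x; exact: Ext_gr_scale].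
- exact: mm_multilinear.
- by move=> ds xs _; apply: mm_gr.
- by move=> ds xs _; apply: mm_relation.
split; [exact: Ext_one_gr|by split; [apply: mm_one_l|apply: mm_one_r]|].
move=> xs s2 xs1; apply: bb_unit; last exact: twist_one.
by rewrite size_twist; apply/eqP.
Qed.

Lemma cj_End pj g z : End_gr P pj g -> cj g z = sgn A pj.1 *: g z.
Proof.
move=> [gl gg]; have cl := cj_linear hgr gl.
move: z; apply: (eq_homog (res_grading P)) => [x y|x y|[n i] x gx].
- exact: (lin_addm cl).
- by rewrite (lin_addm gl) scalerDr.
rewrite /cj (parity_hom gx) (linZ gl) (linZ sgl) (parity_hom (gg _ _ _ gx)) scalerA.
by rewrite sgnD mulrA sgn_sq mul1r sgnN.
Qed.

Lemma dif_End p j g : End_gr P (p, j) g -> dif g = End_d P p g.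
Proof.
move=> hg; apply: funext => z; rewrite /dif /End_d.
by rewrite -(cj_End _ hg).
Qed.

Lemma ffE ds xs z : List.Forall2 (Ext_gr P) ds xs -> ff xs z = sgn A (eps 0 ds) *: Ff xs z.
Proof.
move=> h; pose K (t : seq E) : rscal P := Ff t z.
have Km : multilinear id K.
  by move=> us vs c x y; apply: (Ff_multilinear hgr hconn hXh hX hmin hs).
by have := twk_sign parEh parEg Km 0 [::] h; rewrite sgn_alg.
Qed.

Lemma dif_scale k (g : P -> P) z : dif (fun y => sgn A k *: g y) z = sgn A k *: dif g z.
Proof. by rewrite /dif linearZ (linZ sgl) scalerBr. Qed.

Lemma lam_sum xs z : lam xs z = \sum_(1 <= a < size xs)
  cj (Ff (take a xs)) (Ff (drop a xs) z).
Proof.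
have [->|s0] := eqVneq xs [::]; first by rewrite big_geq // lam_nil.
rewrite lamE /dec -(big_mkord xpredT (fun i => cj (Ff (take i xs)) (Ff (drop i xs) z))).
have n0 : (0 < size xs)%N by case: xs s0.
rewrite big_ltn // take0 big_nat_recr //= drop_size.
have -> : cj (Ff [::]) (Ff (drop 0 xs) z) = 0 by rewrite /cj Ff_nil (addm0 sgD).
have -> : cj (Ff (take (size xs) xs)) (Ff [::] z) = 0.
  by rewrite Ff_nil /cj (addm0 sgD) (addm0 (lin_addm (Fl _))) (addm0 sgD).
by rewrite add0r addr0.
Qed.

Lemma ff_equation ds xs : (0 < size xs)%N -> List.Forall2 (Ext_gr P) ds xs ->
  let n := size xs in
  insertion_sum mm ff ds xs =
  End_d P ((\sum_(e <- ds) e).1 + 1 - n%:Z) (ff xs) +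
  \sum_(1 <= a < n)
    sgn A (a%:Z - 1 + (1 - (n - a)%N%:Z) * (\sum_(e <- take a ds) e).1) *:
    (ff (take a xs) \o ff (drop a xs)).
Proof.
move=> s0 h n; apply: funext => z.
pose K (t : seq E) : rscal P := Ff t z.
have Km : multilinear id K.
  by move=> us vs c x y; apply: (Ff_multilinear hgr hconn hXh hX hmin hs).
have sF (k : int) (y : P) : sgn A k *: y = sgn F k *: (y : rscal P) by rewrite sgn_alg.
have -> : insertion_sum mm ff ds xs z =
    insertion_sum (fun t => bb (twist t)) (fun t => K (twist t)) ds xs :> P.
  rewrite /insertion_sum fct_sumE; apply: eq_bigr => i _; rewrite fct_sumE.
  by apply: eq_bigr => t _; rewrite -sF.
rewrite (insertion_sum_twist parEh parEg bmul Km bgr (b_short (xs := [::]) isT) h).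
rewrite -[dec _ _]/(ins X s x0 (fun t => Ff t z) xs) -sF.
have -> : ins X s x0 (fun t => Ff t z) xs = dif (Ff xs) z + lam xs z.
  by rewrite (Ff_dif hgr hconn hXh hX hmin hs) subrK.
rewrite scalerDr; congr (_ + _).
  have -> : (\sum_(e <- ds) e).1 + 1 - n%:Z = (\sum_(e <- ds) e + (1 - n%:Z, 0)).1 by rewrite /= addrA.
  rewrite -(dif_End (j := (\sum_(e <- ds) e + (1 - n%:Z, 0)).2)); last first.
    by have := ff_gr s0 h; rewrite -/n; case: (_ + _).
  rewrite (eq_dif _ (g := ff xs) (h := fun y => sgn A (eps 0 ds) *: Ff xs y)) ?dif_scale // => y.
  exact: ffE.
rewrite lam_sum scaler_sumr fct_sumE; apply: eq_big_nat => a /andP[a1 a2].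
have [hu hv] := Forall2_take_drop a h; have sz := Forall2_size h.
rewrite [RHS]/(_ *: ff _ (ff _ z)) (ffE _ hu) (ffE _ hv) (linZ (Fl _)).
have su : size (take a xs) = a by rewrite size_takel // ltnW.
have gu : End_gr P (\sum_(e <- take a ds) e + (1 - (size (take a xs))%:Z, 0)) (Ff (take a xs)).
  by apply: (Ff_gr hgr hconn hXh hX hmin hs) hu; rewrite su.
rewrite (cj_End _ gu) !scalerA [RHS]scalerA -!sgnD su.
have -> : eps 0 ds = eps (n - a) (take a ds) + eps 0 (drop a ds).
  by rewrite -{1}(cat_take_drop a ds) eps_cat addn0 size_drop sz.
have e0 l es : eps l es = eps 0 es + l%:Z * (\sum_(e <- es) e).1 by exact: (eps_shift 0 l).
rewrite (e0 (n - a)%N) /= -/n.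
move: (\sum_(e <- take a ds) e).1 (eps 0 (take a ds)) (eps 0 (drop a ds)) => p q r.
move: (n - a)%N => k.
rewrite -[in LHS](sgn_double _ _ (a%:Z - 1 - k%:Z * p)); congr (sgn A _ *: _).
rewrite mulrBl mul1r; lia.
Qed.

Lemma ff_morphism : A_infinity_morphism_to_End mm ff.
Proof.
split; [exact: ff_multilinear|by move=> ds xs; apply: ff_gr|exact: ff_equation|].
split=> [|xs s1 xs1]; first by apply: funext => z; apply: Ff_one.
by apply: funext => z; apply: Ff_unit; rewrite ?size_twist //; apply: twist_one.
Qed.

Lemma ff1 x : ff [:: x] = ii (rep x). Proof. by []. Qed.

(** For a cocycle g the homotopy identity is g = lift (aug g) + dif (T g), which gives surjectivity.
    For injectivity, the augmentation of a boundary of End_A(P) is, up to sign, a trivial map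
    evaluated on boundaries of P. *)
Lemma ff_quasi_isomorphism : quasi_isomorphism_to_End mm ff.
Proof.
move=> p j; split=> [g hg dg|x h gx _ hh e].
  have gl := End_gr_linear hg.
  have hc : cochain (p, j) (fun y => aug (g y)).
    split; first split=> [x y|c x|i a x i0 ga].
    - by rewrite (lin_addm gl) augD.
    - by rewrite (linZ gl) (res_aug_alg hgr hconn).
    - by rewrite (linZ gl) (res_augZ hgr hconn) (augA_pos hgr hconn i0 ga) mul0r.
    move=> [n i] x ne gx; apply: (res_aug_degree _ (hg.2 _ _ _ gx)) => -[e1 e2].
    by apply: ne; congr (_, _); apply: subr0_eq.
  have zc := cochain_cocycles hgr hconn hmin hc.
  exists (Ext_class (fun y => aug (g y))), (T g); split=> //.
  - by apply/(Ext_grP hgr hconn hmin); rewrite (rep_class hgr hconn hmin).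
  - exact: mm1.
  - exact: (End_gr_htp hgr hconn hXh hX hs hg).
  have hT := End_gr_htp hgr hconn hXh hX hs hg.
  apply: funext => z; rewrite ff1 (rep_class hgr hconn hmin) // -(dif_End hT).
  have := dif_htp hgr hconn hXh hX hs z gl.
  rewrite (htp_kill hgr hconn hXh hX hs) => [|b _]; last first.
    by rewrite (dif_End hg) dg (addm0 (ctr_addm hs)).
  by rewrite addr0 => h; rewrite [RHS]addrC -[LHS](subrK (ii (fun y => aug (g y)) z)) -h.
exists 0; first by apply: gr0; apply: (Ext_grading hgr hconn hmin).
rewrite mm1; apply/esym/rep_inj; rewrite (addm0 (lin_addm repL)); apply: funext => z.
have rt := rep_trivial x.
rewrite -(aug_lift hgr hconn hXh hX hs z rt) -ff1 e /End_d (addmB augD) res_aug_d sub0r.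
have hl := End_gr_linear hh.
have tz : trivial_hom gr (fun y => aug (h y)).
  split=> [u v|c u|i a u i0 ga].
  - by rewrite (lin_addm hl) augD.
  - by rewrite (linZ hl) (res_aug_alg hgr hconn).
  - by rewrite (linZ hl) (res_augZ hgr hconn) (augA_pos hgr hconn i0 ga) mul0r.
rewrite (res_augZ hgr hconn) (trivial_min hgr hconn hmin _ tz) mulr0; exact: oppr0.
Qed.

Lemma mm_Ext_algebra : A_infinity_Ext_algebra mm.
Proof.
split; [exact: mm_A_infinity|exact: mm1|].
exists ff; split; [exact: ff_morphism|exact: ff_quasi_isomorphism|move=> x].
rewrite -[RHS](repK x); congr (Ext_class _); apply: funext => z.
by rewrite /= ff1 (aug_lift hgr hconn hXh hX hs) //; exact: rep_trivial.
Qed.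

Lemma cj_ff_parity y z : cj (Ff [:: parityE y]) z = ii (rep y) z.
Proof.
rewrite Ff1 [LHS](lift_parity hgr hconn hXh hX hs); last exact: rep_trivial.
congr (lift _ _ _ _ z); apply: funext => w.
by rewrite (rep_parity hgr hconn hmin) sgK.
Qed.

(** Of the two cuts only the one after x survives: the other one ends with the application of F
    [x, y], whose values have augmentation 0. *)
Lemma rep_mm3 x y w z : rep (mm [:: x; y; w]) z =
  - rep x (sg (T (fun v => ii (rep y) (ii (rep w) v)) z)).
Proof.
have rt := rep_trivial x; have [rD _ _] := rt.
rewrite /mm /twist /= parityEK // (rep_bb hgr hconn hXh hX hmin hs) /auglam lam_sum /=.
rewrite big_ltn // big_nat1 /= augD [X in _ + X = _](_ : _ = 0) ?addr0; last first.
  by rewrite /cj (aug_parity hgr hconn) (aug_Ff hgr hconn hXh hX hs).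
rewrite Ff1 /cj (aug_parity hgr hconn) (aug_lift hgr hconn hXh hX hs) // -(addmN rD).
rewrite -(addmN sgD); congr (rep x (sg _)); rewrite Ff_rec sub0r; congr (- _).
apply: (eq_htp hgr hconn hXh hX hs) => b _.
by rewrite lam2 cj_ff_parity Ff1.
Qed.

End MinimalModel.

(** * Detection of generators by products *)

Section MinimalCoordinates.
Variables (F : fieldType) (A : algType F) (gr : nat -> set A).
Hypotheses (hgr : graded_algebra gr) (hconn : connected_algebra gr).
Variables (P : resolution gr) (X : set P).
Hypothesis hXh : X `<=` [set x | exists nj, res_gr P nj x].
Hypothesis hX : is_basis X.
Hypothesis hmin : minimal_resolution P.
Variables (s : P -> P) (x0 : P).
Hypothesis hs : contraction s x0.
Hypothesis hsX : forall b, X b -> s b = 0.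

Local Notation E := (Ext P).
Local Notation d := (res_d P).
Local Notation aug := (res_aug P).
Local Notation ii := (lift X s x0).
Local Notation crd := (coord X).

Let hg : is_grading (res_gr P) := res_grading P.

Lemma level0_basis b : X b -> lev b = 0%N -> b = (aug b)%:A *: x0.
Proof.
move=> Xb lb; have := ctr_homotopy hs b; rewrite hsX // linear0.
have -> : d b = 0.
  by have := res_d_degree (degP' hXh Xb); rewrite (degE hXh hX Xb) lb; apply: res_nonneg.
by rewrite (addm0 (ctr_addm hs)) subr0 => /esym/eqP; rewrite subr_eq0 => /eqP.
Qed.

Lemma exists_level0 : exists b c, [/\ X b, deg b = (0, 0), c != 0 & x0 = c%:A *: b].
Proof.
have [b [Xb nb]] : exists b, X b /\ crd b x0 != 0.
  apply/not_existsP => h; have : x0 = 0.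
    by apply: (coord0_eq0 hX) => b Xb; apply/eqP/negPn/negP => nb; case: (h b).
  move=> x00; have := ctr_x0_aug hs; rewrite x00 (addm0 (@res_augD _ _ _ P)) => /eqP.
  by rewrite eq_sym oner_eq0.
have l0 : (deg b).1 = 0.
  apply/esym/eqP/negPn/negP => ne.
  by move: nb; rewrite (coord_lev hgr hXh hX Xb (ctr_x0_gr hs) ne) eqxx.
have lb : lev b = 0%N by rewrite /lev l0.
have eb := level0_basis Xb lb; have ab : aug b != 0.
  by apply/eqP => a0; have := basis_neq0 hX Xb; rewrite eb a0 !scale0r eqxx.
exists b, (aug b)^-1; split=> //; last first.
- by rewrite {2}eb scalerA alg_mul scalerA mulVf // !scale1r.
- by rewrite invr_eq0.
- apply: (deg_unique hXh hX Xb); rewrite eb; exact/(res_gr_alg hconn)/(ctr_x0_gr hs).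
Qed.

(** P_0 is free of rank one on [x0], and q is the coordinate; negative levels are zero, so n <= 0 is
    harmless. *)
Lemma exists_x0_coord : exists q : P -> A,
  [/\ addm q, forall z n j, n <= 0 -> res_gr P (n, j) z -> z = q z *: x0,
      forall z i, res_gr P (0, i%:Z) z -> gr i (q z),
      forall a, q (a *: x0) = a & forall a z, q (a *: z) = a * q z].
Proof.
have [b [c [Xb db c0 ex]]] := exists_level0.
pose q z := crd b z * c^-1%:A; have cD := coordD hX b.
have qD : addm q by move=> x y; rewrite /q cD mulrDl.
have qZ a z : q (a *: z) = a * q z by rewrite /q (coordZ hX) mulrA.
have qx : q x0 = 1.
  rewrite /q ex (coordZ hX) (coord_basis hX) // eqxx mulr1 alg_mul scalerA mulfV //.
  exact: scale1r.
have q0 a : q (a *: x0) = a by rewrite qZ qx mulr1.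
exists q; split=> // [z n j n0 gz|z i gz].
  have ql : linear (fun z => q z *: x0) by move=> a x y; rewrite qD qZ scalerDl scalerA.
  have idl : linear (fun z : P => z) by [].
  apply: (lin_eq_gr hgr hXh hX idl ql gz) => b' Xb' l _.
  have lb' : lev b' = 0%N by move: l; rewrite (degE hXh hX Xb'); lia.
  by rewrite (level0_basis Xb' lb') q0.
rewrite /q mul_alg; case: hgr => _ gZ _ _; apply: gZ.
by have := coord_grZ hgr hXh hX Xb gz; rewrite db subr0.
Qed.

Lemma x0_inj a : a *: x0 = 0 -> a = 0.
Proof.
by have [q [qD _ _ qK _]] := exists_x0_coord => h; rewrite -(qK a) h (addm0 qD).
Qed.

Lemma gr00 z : res_gr P (0, 0) z -> z = (aug z)%:A *: x0.
Proof.
have [q [_ qE qg _ _]] := exists_x0_coord => gz.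
have ez := qE _ _ _ (lexx 0) gz; rewrite {1}ez; congr (_ *: _).
have ea := gr0_augA hgr hconn (qg _ 0%N gz).
have -> : aug z = augA gr (q z) by rewrite {1}ez (res_augZ hgr hconn) (ctr_x0_aug hs) mulr1.
exact: ea.
Qed.

Definition dual (b : P) : E := Ext_class (fun x => augA gr (crd b x) : F^o).

Lemma dual_cochain b : X b -> cochain (deg b) (fun x => augA gr (crd b x) : F^o).
Proof.
move=> Xb; split; first split=> [x y|c x|i a x i0 ga].
- by rewrite (coordD hX) (augAD hgr hconn).
- by rewrite (coordZ hX) (augA_algM hgr hconn).
- by rewrite (coordZ hX) (augAM hgr hconn) (augA_pos hgr hconn i0 ga) mul0r.
move=> [n j] x ne gx; have [en|nn] := eqVneq n (deg b).1; last first.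
  by rewrite (coord_lev hgr hXh hX Xb gx nn) (addm0 (augAD hgr hconn)).
have := coord_grZ hgr hXh hX Xb gx; case e : (j - _) => [i|i] /=; last first.
  by move=> ->; rewrite (addm0 (augAD hgr hconn)).
case: i e => [|i] e; last exact: augA_pos.
by case: ne; rewrite en -(subrK (deg b).2 j) e add0r; case: (deg b).
Qed.

Lemma rep_dual b x : X b -> rep (dual b) x = augA gr (crd b x).
Proof.
by move=> Xb; rewrite /dual (rep_class hgr hconn hmin) //;
   apply: (cochain_cocycles hgr hconn hmin (dual_cochain Xb)).
Qed.

Lemma dual_gr b : X b -> Ext_gr P (deg b) (dual b).
Proof.
move=> Xb; apply/(Ext_grP hgr hconn hmin); have -> : rep (dual b) = (fun x => augA gr (crd b x) : F^o).
  by apply: funext => x; apply: rep_dual.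
exact: dual_cochain.
Qed.

Lemma ii_gr pj chi : Ext_gr P pj chi -> End_gr P pj (ii (rep chi)).
Proof. exact: (End_gr_lift hgr hconn hXh hX hmin hs). Qed.

Lemma ii_linear chi : linear (ii (rep chi)). Proof. exact: lift_linear. Qed.

(** The correction term of the recursion passes through level -1 of P, hence vanishes. *)
Lemma ii_bottom p j chi b : Ext_gr P (p, j) chi -> X b -> (deg b).1 = p ->
  ii (rep chi) b = (rep chi b)%:A *: x0.
Proof.
move=> gc Xb lb; rewrite (liftE hgr hconn hXh hX) //.
have gd := parity_gr hconn (res_d_degree (degP' hXh Xb)); rewrite lb in gd.
have := (ii_gr gc).2 _ _ _ gd; rewrite /= addrAC subrr add0r.
move=> h; rewrite (res_nonneg _ h) //.
by rewrite (addm0 (@parityD _ _ _ P)) (addm0 (ctr_addm hs)) addr0.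
Qed.

Lemma ii_bottom_sum p j chi n i x : Ext_gr P (p, j) chi -> n = p -> res_gr P (n, i) x ->
  ii (rep chi) x = (\sum_(b <- csupp X x) crd b x * (rep chi b)%:A) *: x0.
Proof.
move=> gc -> gx; rewrite [x in LHS](csumE hX) (addm_sum (lin_addm (ii_linear chi))) scaler_suml.
apply: eq_big_seq => b bx; have Xb := csuppX hX bx; rewrite (linZ (ii_linear chi)).
have [lb|lb] := eqVneq p (deg b).1; last by rewrite (coord_lev hgr hXh hX Xb gx lb) !(mul0r, scale0r).
by rewrite (ii_bottom gc Xb (esym lb)) scalerA.
Qed.

Lemma ii_dual b n i x : X b -> n = (deg b).1 -> res_gr P (n, i) x ->
  ii (rep (dual b)) x = crd b x *: x0.
Proof.
move=> Xb en gx; have gb := dual_gr Xb; rewrite [deg b]surjective_pairing in gb.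
have xl : linear (fun x => crd b x *: x0).
  by move=> a y z; rewrite (coordD hX) (coordZ hX) scalerDl scalerA.
apply: (lin_eq_gr hgr hXh hX (ii_linear _) xl gx) => b' Xb' lb' _.
rewrite (ii_bottom gb Xb'); last by rewrite lb' en.
rewrite rep_dual // (coord_basis hX) //; case: eqP => _ /=.
  by rewrite (augA1 hgr hconn) scale1r.
by rewrite (addm0 (augAD hgr hconn)) scale0r.
Qed.

Lemma dif_ii chi x : dif (ii (rep chi)) x = 0.
Proof.
apply: (dif_lift hgr hconn hXh hX hs); first exact: rep_trivial.
by move=> y; apply: (trivial_min hgr hconn hmin); apply: rep_trivial.
Qed.

Lemma sgn_scale_eq0 (k : int) (y : P) : sgn A k *: y = 0 -> y = 0.
Proof. by move=> h; rewrite -[y]scale1r -(sgn_sq A k) -scalerA h scaler0. Qed.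

(** The lift is a chain map up to sign, so its zeros are stable under d. *)
Lemma ii_d pj chi x : Ext_gr P pj chi -> ii (rep chi) x = 0 -> ii (rep chi) (d x) = 0.
Proof.
move=> gc e; have := dif_ii chi x; rewrite /dif e linear0 sub0r => /eqP.
rewrite oppr_eq0 => /eqP; rewrite -[LHS]/(cj (ii (rep chi)) (d x)).
by rewrite (cj_End hgr _ (ii_gr gc)); apply: sgn_scale_eq0.
Qed.

(** A cycle of positive level is d (s x), and s x has internal degree j one level up, below all
    generators there. *)
Lemma cycle_eq0 n j x : 0 < n -> res_gr P (n, j) x -> d x = 0 ->
  (forall b, X b -> (deg b).1 = n + 1 -> j < (deg b).2) -> x = 0.
Proof.
move=> n0 gx dx h; have := ctr_homotopy hs x.
rewrite dx (addm0 (ctr_addm hs)) (res_aug_degree _ gx) => [|e]; last first.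
  by case: e => e _; rewrite e ltxx in n0.
by rewrite !scale0r !subr0 (gr_low hgr hXh hX h (ctr_gr hs gx)) linear0 => <-.
Qed.

(** In the lowest internal degree of a level the coordinates are scalars, and dual classes read them
    off. *)
Lemma bottom_eq0 n j x : res_gr P (n, j) x ->
  (forall b, X b -> (deg b).1 = n -> j <= (deg b).2) ->
  (forall phi, Ext_gr P (n, j) phi -> rep phi x = 0) -> x = 0.
Proof.
move=> gx h hphi; apply: (coord0_eq0 hX) => b Xb.
have [en|ne] := eqVneq n (deg b).1; last exact: (coord_lev hgr hXh hX Xb gx ne).
have := h _ Xb (esym en); rewrite le_eqVlt => /orP[/eqP ej|lt]; last first.
  exact: (coord_low hgr hXh hX Xb gx lt).
rewrite (coord_alg hgr hconn hXh hX Xb gx ej) -rep_dual // hphi ?scale0r //.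
by have := dual_gr Xb; rewrite [deg b]surjective_pairing -en -ej.
Qed.

Section ThetaMap.
Variable th : A -> F.
Hypothesis thl : forall c a b, th (c *: a + b) = c * th a + th b.

Let thD : addm th. Proof. by move=> a b; have := thl 1 a b; rewrite scale1r mul1r. Qed.
Let thZ c a : th (c *: a) = c * th a.
Proof. by rewrite -[c *: a]addr0 thl (addm0 thD) addr0. Qed.

Definition thA (b : P) (a : A) : A := (th a)%:A.

Lemma thA_addm b : addm (thA b).
Proof. by move=> x y; rewrite /thA thD scalerDl. Qed.

(* Applying an F-linear th : A -> F to the coordinates does not commute with A,
   but it commutes with maps having scalar coordinates on the generators. *)
Definition theta : P -> P := cmap X thA id.

Lemma theta_addm : addm theta. Proof. by apply: (cmapD hX) => b; apply: thA_addm. Qed.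

Lemma crd_theta b x : X b -> crd b (theta x) = (th (crd b x))%:A.
Proof. by move=> Xb; rewrite /theta coord_cmap //; apply: thA_addm. Qed.

Lemma theta_flin : flin theta.
Proof.
move=> c y z; rewrite theta_addm; congr (_ + _); move: y.
apply: (eq_on_hbasis hgr hX) => [y w|y w|i a b _ Xb]; first by rewrite scalerDr theta_addm.
  by rewrite theta_addm scalerDr.
rewrite scalerA /theta !(cmap_basis hX _ thA_addm) // scalerA; congr (_ *: _).
by rewrite /thA alg_mul thZ alg_mul scalerA.
Qed.

Lemma theta_alg a y : (forall c, X c -> crd c y = (augA gr (crd c y))%:A) ->
  theta (a *: y) = (th a)%:A *: y.
Proof.
move=> h; rewrite {1}[y](csumE hX) scaler_sumr (addm_sum theta_addm) [y in RHS](csumE hX).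
rewrite scaler_sumr; apply: eq_big_seq => c cy; have Xc := csuppX hX cy.
rewrite scalerA /theta cmap_basis //; last exact: thA_addm.
rewrite scalerA; congr (_ *: _); rewrite h // /thA mul_alg thZ alg_mul.
by rewrite scalerA mulrC.
Qed.

Lemma theta_comm (g : P -> P) x : linear g ->
  (forall b, X b -> crd b x != 0 -> forall c, X c -> crd c (g b) = (augA gr (crd c (g b)))%:A) ->
  g (theta x) = theta (g x).
Proof.
move=> gl h; rewrite /theta lin_cmap // -/theta /cmap [x in RHS](csumE hX).
rewrite (addm_sum (lin_addm gl)) (addm_sum theta_addm).
apply: eq_big_seq => b bx; have Xb := csuppX hX bx; rewrite (linZ gl).
have [->|nb] := eqVneq (crd b x) 0; last by rewrite theta_alg //; apply: h.
by rewrite scale0r (addm0 theta_addm) (addm0 (thA_addm b)) scale0r.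
Qed.

(** Coordinates become scalars, so the element moves to the internal degree of the generators it
    involves. *)
Lemma theta_gr n j i x : (forall b, X b -> (deg b).1 = n -> crd b x != 0 -> (deg b).2 = i) ->
  res_gr P (n, j) x -> res_gr P (n, i) (theta x).
Proof.
move=> h gx; apply: (gr_sum hg) => b bx _; have Xb := csuppX hX bx.
have [->|nb] := eqVneq (crd b x) 0.
  by rewrite (addm0 (thA_addm b)) scale0r; apply: gr0.
have en : n = (deg b).1.
  by apply/eqP/negPn/negP => ne; move: nb; rewrite (coord_lev hgr hXh hX Xb gx ne) eqxx.
rewrite en -(h b Xb (esym en) nb); exact/(res_gr_alg hconn)/(degP' hXh).
Qed.

End ThetaMap.

Lemma theta_separate x : (forall th : A -> F,
  (forall c a b, th (c *: a + b) = c * th a + th b) -> forall b, X b -> th (crd b x) = 0) ->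
  x = 0.
Proof.
move=> h; apply: (coord0_eq0 hX) => b Xb; apply/eqP/negPn/negP => nb.
have s0 : submod [set 0 : A] by split=> //= c u v -> ->; rewrite scaler0 addr0.
have [|t [tl _ t1]] := separating_functional (w := crd b x) s0; first exact/eqP.
by have /eqP := h t tl b Xb; rewrite t1 oner_eq0.
Qed.

End MinimalCoordinates.

(** * Detection in the bi-Koszul degrees *)

Section BiKoszulDetection.
Variables (F : fieldType) (A : algType F) (gr : nat -> set A).
Hypotheses (hgr : graded_algebra gr) (hconn : connected_algebra gr).
Variables (P : resolution gr) (X : set P).
Hypothesis hXh : X `<=` [set x | exists nj, res_gr P nj x].
Hypothesis hX : is_basis X.
Hypothesis hmin : minimal_resolution P.
Variables (s : P -> P) (x0 : P).
Hypothesis hs : contraction s x0.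
Hypothesis hsX : forall b, X b -> s b = 0.
Variable d : nat.
Hypothesis hd : (2 <= d)%N.
Hypothesis hdeg : forall b, X b -> (deg b).2 = (bi_Koszul_degrees d (lev b)).1%:Z \/
  (deg b).2 = (bi_Koszul_degrees d (lev b)).2%:Z.

Local Notation E := (Ext P).
Local Notation dP := (res_d P).
Local Notation aug := (res_aug P).
Local Notation sg := (@parity F A gr _).
Local Notation T := (htp X s).
Local Notation ii := (lift X s x0).
Local Notation crd := (coord X).
Local Notation mm := (mm X s x0).

Let hg : is_grading (res_gr P) := res_grading P.
Let degE' := degE hXh hX.
Let iil := @ii_linear F A gr P X hX s x0.
Let iiD chi : addm (ii (rep chi)) := lin_addm (iil chi).
Let ii_gr' := ii_gr hgr hconn hXh hX hmin hs.
Let sgD : addm (@parity F A gr P) := @parityD F A gr P.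

Lemma degrees0 k : bi_Koszul_degrees d (3 * k) = (2 * d * k, 2 * d * k)%N.
Proof. by rewrite /bi_Koszul_degrees mulnC mulnK // modnMl. Qed.
Lemma degrees1 k : bi_Koszul_degrees d (3 * k + 1) = (2 * d * k + 1, 2 * d * k + 1)%N.
Proof. by rewrite /bi_Koszul_degrees mulnC divnMDl // modnMDl /= addn0. Qed.
Lemma degrees2 k : bi_Koszul_degrees d (3 * k + 2) = (2 * d * k + d, 2 * d * k + d + 1)%N.
Proof. by rewrite /bi_Koszul_degrees mulnC divnMDl // modnMDl /= addn0. Qed.

Section Level.
Variable k : nat.
Let K : int := (2 * d * k)%N%:Z.
Let N : int := (3 * k)%N%:Z.

Lemma deg0 b : X b -> (deg b).1 = N -> (deg b).2 = K.
Proof.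
move=> Xb; rewrite degE' // => /eqP; rewrite eqz_nat => /eqP l.
by have := hdeg Xb; rewrite l degrees0 /=; case.
Qed.

Lemma deg1 b : X b -> (deg b).1 = N + 1 -> (deg b).2 = K + 1.
Proof.
move=> Xb; rewrite degE' // => l; have {}l : lev b = (3 * k + 1)%N by move: l; rewrite /N; lia.
by have := hdeg Xb; rewrite l degrees1 /= PoszD -/K; case.
Qed.

Lemma deg2 b : X b -> (deg b).1 = N + 2 -> (deg b).2 = K + d%:Z \/ (deg b).2 = K + d%:Z + 1.
Proof.
move=> Xb; rewrite degE' // => l; have {}l : lev b = (3 * k + 2)%N by move: l; rewrite /N; lia.
by have := hdeg Xb; rewrite l degrees2 /= !PoszD -/K.
Qed.

Lemma deg3 b : X b -> (deg b).1 = N + 3 -> (deg b).2 = K + 2 * d%:Z.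
Proof.
move=> Xb; rewrite degE' // => l; have {}l : lev b = (3 * k.+1)%N by move: l; rewrite /N; lia.
have := hdeg Xb; rewrite l degrees0 /= mulnS /K; case=> ->; lia.
Qed.

Lemma deg4 b : X b -> (deg b).1 = N + 3 + 1 -> (deg b).2 = K + 2 * d%:Z + 1.
Proof.
move=> Xb; rewrite degE' // => l; have {}l : lev b = (3 * k.+1 + 1)%N by move: l; rewrite /N; lia.
have := hdeg Xb; rewrite l degrees1 /= mulnS /K; case=> ->; lia.
Qed.

Let is_chi chi := Ext_gr P (N, K) chi.

Lemma joint_inj0 i x : res_gr P (N, i) x ->
  (forall chi, is_chi chi -> ii (rep chi) x = 0) -> x = 0.
Proof.
move=> gx h; apply: (coord0_eq0 hX) => b Xb.
have [en|ne] := eqVneq N (deg b).1; last exact: (coord_lev hgr hXh hX Xb gx ne).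
apply: (x0_inj hgr hconn hXh hX hs hsX).
rewrite -(ii_dual hgr hconn hXh hX hmin hs Xb en gx); apply: h; rewrite /is_chi en -(deg0 Xb) //.
by have := dual_gr hgr hconn hXh hX hmin Xb; rewrite [deg b]surjective_pairing.
Qed.

(** The lifts vanish on d x too, so d x = 0 by the level below. A nonzero cycle would need a
    generator of level 3k+2 of degree at most 2dk+1, but these degrees start at 2dk+d with d >=
    2. *)
Lemma joint_inj1_bottom x : res_gr P (N + 1, K + 1) x ->
  (forall chi, is_chi chi -> ii (rep chi) x = 0) -> x = 0.
Proof.
move=> gx h; apply: (cycle_eq0 hgr hXh hX hs _ gx) => [||b Xb lb]; first by rewrite /N; lia.
  have gd := res_d_degree gx; rewrite addrK in gd.
  by apply: (joint_inj0 gd) => chi hchi; apply: (ii_d hgr hconn hXh hX hmin hs hchi); apply: h.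
have lb2 : (deg b).1 = N + 2 by rewrite lb -addrA.
by case: (deg2 Xb lb2) => ->; lia.
Qed.

Lemma chi_shift n i j chi x : is_chi chi -> res_gr P (N + n, i) x -> i = K + j ->
  res_gr P (n, j) (ii (rep chi) x).
Proof.
move=> hc gx ei; have := (ii_gr' hc).2 _ _ _ gx; rewrite /= ei.
by rewrite addrAC subrr add0r addrAC subrr add0r.
Qed.

Lemma level1_degree b : X b -> (deg b).1 = 1 -> (deg b).2 = 1.
Proof.
by move=> Xb; rewrite degE' // => l; have := hdeg Xb; case: l => ->; rewrite (degrees1 0) muln0; case.
Qed.

Lemma level2_degree b : X b -> (deg b).1 = 2 -> (deg b).2 = d%:Z \/ (deg b).2 = d%:Z + 1.
Proof.
move=> Xb; rewrite degE' // => l; have := hdeg Xb; case: l => ->; rewrite (degrees2 0) muln0.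
by rewrite /= PoszD.
Qed.

Lemma level3_degree b : X b -> (deg b).1 = 3 -> (deg b).2 = 2 * d%:Z.
Proof.
by move=> Xb; rewrite degE' // => l; have := hdeg Xb; case: l => ->; rewrite (degrees0 1) muln1; case.
Qed.

Lemma level0_degree b : X b -> (deg b).1 = 0 -> (deg b).2 = 0.
Proof. exact: (min_level0 hgr hconn hXh hX hmin). Qed.

Lemma bottom_scalar n i x c : (forall b, X b -> (deg b).1 = n -> i <= (deg b).2) ->
  res_gr P (n, i) x -> X c -> crd c x = (augA gr (crd c x))%:A.
Proof.
move=> h gx Xc; have z : crd c x = 0 -> crd c x = (augA gr (crd c x))%:A.
  by move=> ->; rewrite (addm0 (augAD hgr hconn)) scale0r.
have [en|ne] := eqVneq n (deg c).1; last exact/z/(coord_lev hgr hXh hX Xc gx).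
have := h _ Xc (esym en); rewrite le_eqVlt => /orP[/eqP ej|lt].
  exact: (coord_alg hgr hconn hXh hX Xc gx).
exact/z/(coord_low hgr hXh hX Xc gx).
Qed.

Lemma crd_neq0_level n i x b : res_gr P (n, i) x -> X b -> crd b x != 0 -> (deg b).1 = n.
Proof.
move=> gx Xb; apply: contra_neq_eq => ne.
by apply: (coord_lev hgr hXh hX Xb gx); rewrite eq_sym.
Qed.

(** theta reduces to the degree of the generators. It commutes with the lift of chi, which sends a
    generator of level 3k+1 to bidegree (1, 1), where coordinates are scalars. *)
Lemma joint_inj1 i x : res_gr P (N + 1, i) x ->
  (forall chi, is_chi chi -> ii (rep chi) x = 0) -> x = 0.
Proof.
move=> gx h; apply: (theta_separate hX) => th thl.
suff tx : theta X th x = 0.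
  move=> b Xb; apply: (alg_inj (A := A)); rewrite scale0r -(crd_theta hX thl) // tx.
  exact: addm0 (coordD hX b).
apply: joint_inj1_bottom => [|chi hc].
  by apply: (theta_gr hgr hconn hXh hX thl _ gx) => b Xb lb _; apply: deg1.
rewrite (theta_comm hX thl) ?h // ?(addm0 (theta_addm hX thl)) // => b Xb nb c Xc.
have lb := crd_neq0_level gx Xb nb; have := degP' hXh Xb; rewrite lb (deg1 Xb lb) => gb.
apply: (bottom_scalar _ (chi_shift hc gb erefl) Xc) => b' Xb' lb'.
by rewrite level1_degree.
Qed.

(** The bound on i excludes nonzero cycles: they would be boundaries from level 3k+3, whose
    generators have degree 2dk+2d. *)
Lemma joint_inj2 i x : i < K + 2 * d%:Z -> res_gr P (N + 2, i) x ->
  (forall chi, is_chi chi -> ii (rep chi) x = 0) -> x = 0.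
Proof.
move=> li gx h; apply: (cycle_eq0 hgr hXh hX hs _ gx) => [||b Xb lb]; first by rewrite /N; lia.
  have gd := res_d_degree gx; rewrite -addrA in gd.
  by apply: (joint_inj1 gd) => chi hchi; apply: (ii_d hgr hconn hXh hX hmin hs hchi); apply: h.
by rewrite (deg3 Xb) // lb -addrA.
Qed.

(** m_2 (phi, chi) evaluates phi on the lift of chi at v, an element in the lowest degree of level
    1. *)
Lemma detect1 v : res_gr P (N + 1, K + 1) v ->
  (forall phi chi, Ext_gr P (1, 1) phi -> is_chi chi -> rep (mm [:: phi; chi]) v = 0) -> v = 0.
Proof.
move=> gv h; apply: (joint_inj1 gv) => chi hc.
apply: (bottom_eq0 hgr hconn hXh hX hmin (chi_shift hc gv erefl)) => [b Xb lb|phi hphi].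
  by rewrite level1_degree.
by rewrite -(rep_mm2 hgr hconn hXh hX hmin hs); apply: h.
Qed.

Lemma detect2 v : res_gr P (N + 2, K + d%:Z) v ->
  (forall phi chi, Ext_gr P (2, d%:Z) phi -> is_chi chi -> rep (mm [:: phi; chi]) v = 0) -> v = 0.
Proof.
move=> gv h; apply: (joint_inj2 _ gv) => [|chi hc]; first by lia.
apply: (bottom_eq0 hgr hconn hXh hX hmin (chi_shift hc gv erefl)) => [b Xb lb|phi hphi].
  by case: (level2_degree Xb lb) => ->; lia.
by rewrite -(rep_mm2 hgr hconn hXh hX hmin hs); apply: h.
Qed.

(** Coordinates at generators of degree d+1 are scalars, seen by cochains; those at generators of
    degree d lie in A_1 and are seen by the lifts of E^2_d. *)
Lemma level2_detect z : res_gr P (2, d%:Z + 1) z ->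
  (forall phi, Ext_gr P (2, d%:Z + 1) phi -> rep phi z = 0) ->
  (forall psi, Ext_gr P (2, d%:Z) psi -> ii (rep psi) z = 0) -> z = 0.
Proof.
move=> gz h1 h2; apply: (coord0_eq0 hX) => b Xb.
have [en|ne] := eqVneq 2 (deg b).1; last exact: (coord_lev hgr hXh hX Xb gz ne).
have := dual_gr hgr hconn hXh hX hmin Xb; rewrite [deg b]surjective_pairing -en => gb.
case: (level2_degree Xb (esym en)) => e2; rewrite e2 in gb.
  apply: (x0_inj hgr hconn hXh hX hs hsX).
  by rewrite -(ii_dual hgr hconn hXh hX hmin hs Xb en gz); apply: h2.
rewrite (coord_alg hgr hconn hXh hX Xb gz (esym e2)) -(rep_dual hgr hconn hXh hX hmin) //.
by rewrite h1 // scale0r.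
Qed.

Section Composite.
Variables (psi chi : E).
Hypotheses (hpsi : Ext_gr P (2, d%:Z) psi) (hchi : is_chi chi).

Let u (x : P) : P := ii (rep psi) (ii (rep chi) x).

Lemma u_linear : linear u.
Proof. by move=> a x y; rewrite /u iil iil. Qed.

Lemma u_gr : End_gr P (N + 2, K + d%:Z) u.
Proof. by rewrite [N + 2]addrC [K + _]addrC; apply: (End_gr_comp (ii_gr' hpsi) (ii_gr' hchi)). Qed.

Lemma Tu_gr : End_gr P (N + 1, K + d%:Z) (T u).
Proof.
have -> : N + 1 = N + 2 - 1 by rewrite -addrA.
exact: (End_gr_htp hgr hconn hXh hX hs u_gr).
Qed.

Let w : E := mm [:: psi; chi].

Lemma w_gr : Ext_gr P (N + 2, K + d%:Z) w.
Proof.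
have h : List.Forall2 (Ext_gr P) [:: (2, d%:Z); (N, K)] [:: psi; chi] by repeat constructor.
have := mm_gr hgr hconn hXh hX hmin hs h; rewrite big_cons big_seq1 -/w.
by congr (Ext_gr P _ w); congr (_, _); rewrite /=; lia.
Qed.

Lemma aug_u y : aug (u y) = rep w y.
Proof.
rewrite (rep_mm2 hgr hconn hXh hX hmin hs) /u (aug_lift hgr hconn hXh hX hs) //.
exact: rep_trivial.
Qed.

(** The composite of the two lifts and the lift of the product differ by the boundary of T u, the
    homotopy from which m_3 is computed. *)
Lemma dif_Tu x : dif (T u) x = u x - ii (rep w) x.
Proof.
have du y : dif u y = 0.
  rewrite (dif_comp hgr _ _ (iil psi)) /cj !(dif_ii hgr hconn hXh hX hmin hs).
  by rewrite (addm0 sgD) (addm0 (iiD _)) (addm0 sgD) addr0.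
have := dif_htp hgr hconn hXh hX hs x u_linear.
rewrite (htp_kill hgr hconn hXh hX hs) => [|b _]; last by rewrite du (addm0 (ctr_addm hs)).
by rewrite addr0 => ->; congr (_ - lift _ _ _ _ x); apply: funext => y; apply: aug_u.
Qed.

(** A generator of level 3k+1 has degree 2dk+1 and would land in degree 1 - d < 0 of P_0. *)
Lemma Tu_low i x : res_gr P (N + 1, i) x -> T u x = 0.
Proof.
move=> gx; have z : linear (fun _ : P => 0 : P) by move=> a y y'; rewrite scaler0 addr0.
apply: (lin_eq_gr hgr hXh hX (htp_linear hX _ _) z gx) => b Xb lb _.
have := Tu_gr.2 _ _ _ (degP' hXh Xb); rewrite lb (deg1 Xb lb) /= subrr => gb.
apply: (gr_low hgr hXh hX _ gb) => b' Xb' lb'; rewrite level0_degree //; lia.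
Qed.

Lemma d_Tu i x : res_gr P (N + 2, i) x -> dP (T u x) = u x - ii (rep w) x.
Proof.
move=> gx; rewrite -dif_Tu /dif -[sg _]/(cj (T u) (dP x)) (cj_End hgr _ Tu_gr).
have gd := res_d_degree gx; rewrite -addrA in gd.
by rewrite (Tu_low gd) scaler0 subr0.
Qed.

Lemma u_generator b : X b -> (deg b).1 = N + 2 -> (deg b).2 = K + d%:Z ->
  u b = (rep w b)%:A *: x0.
Proof.
move=> Xb lb eb; have := u_gr.2 _ _ _ (degP' hXh Xb); rewrite lb eb /= !subrr => gb.
by rewrite (gr00 hgr hconn hXh hX hs hsX gb) aug_u.
Qed.

Lemma w_generator b : X b -> (deg b).2 != K + d%:Z -> rep w b = 0.
Proof.
move=> Xb ne; apply: (rep_off hgr hconn hmin w_gr (degP hXh Xb)).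
by apply: contra ne => /eqP ->.
Qed.

Lemma ii_w_generator b : X b -> (deg b).1 = N + 2 -> (deg b).2 != K + d%:Z ->
  ii (rep w) b = 0.
Proof.
by move=> Xb lb ne; rewrite (ii_bottom hgr hconn hXh hX hmin hs w_gr Xb lb) w_generator // !scale0r.
Qed.

End Composite.

Lemma rep_sg_eq0 n i x phi : res_gr P (n, i) x -> rep phi (sg x) = 0 -> rep phi x = 0.
Proof.
move=> gx; rewrite (parity_hom gx) sgn_alg; have [_ pZ _] := rep_trivial phi.
rewrite pZ sgnE; case: odd; rewrite ?expr1 ?expr0 ?mul1r // mulN1r => /eqP.
by rewrite oppr_eq0 => /eqP.
Qed.

(** Up to sign, m_3 (phi, psi, chi) evaluates phi on T u at v, which lies in bidegree (n, j), where
    coordinates are at most scalars. *)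
Lemma mm3_detect psi chi v j : Ext_gr P (2, d%:Z) psi -> is_chi chi ->
  forall n, (forall b, X b -> (deg b).1 = n -> j <= (deg b).2) ->
  res_gr P (N + 1 + n, K + d%:Z + j) v ->
  (forall phi, Ext_gr P (n, j) phi -> rep (mm [:: phi; psi; chi]) v = 0) ->
  T (fun x => ii (rep psi) (ii (rep chi) x)) v = 0.
Proof.
move=> hpsi hchi n hn gv h.
have := (Tu_gr hpsi hchi).2 _ _ _ gv; rewrite [_ + n]addrC [_ + j]addrC /= !addrK => gT.
apply: (bottom_eq0 hgr hconn hXh hX hmin gT) => [b Xb lb|phi hphi]; first exact: hn.
apply: (rep_sg_eq0 gT); apply/eqP; rewrite -oppr_eq0 -(rep_mm3 hgr hconn hXh hX hmin hs).
by apply/eqP; apply: h.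
Qed.

(** The products m_3 make the homotopy vanish at v, so the composite of the lifts of psi and chi
    agrees there with the lift of their product. The product has degree 2dk+d, and the assumption on
    coordinates restricts v to generators of degree 2dk+d+1. *)
Lemma detect2' v : res_gr P (N + 2, K + d%:Z + 1) v ->
  (forall b, X b -> (deg b).2 != K + d%:Z + 1 -> crd b v = 0) ->
  (forall phi chi, Ext_gr P (2, d%:Z + 1) phi -> is_chi chi ->
     rep (mm [:: phi; chi]) v = 0) ->
  (forall phi psi chi, Ext_gr P (1, 1) phi -> Ext_gr P (2, d%:Z) psi -> is_chi chi ->
     rep (mm [:: phi; psi; chi]) v = 0) -> v = 0.
Proof.
move=> gv cv h2 h3; apply: (joint_inj2 _ gv) => [|chi hc]; first by lia.
have gz : res_gr P (2, d%:Z + 1) (ii (rep chi) v).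
  by apply: (chi_shift hc gv); rewrite addrA.
apply: (level2_detect gz) => [phi hphi|psi hpsi].
  by rewrite -(rep_mm2 hgr hconn hXh hX hmin hs); apply: h2.
have T0 : T (fun x => ii (rep psi) (ii (rep chi) x)) v = 0.
  apply: (mm3_detect hpsi hc (n := 1) (j := 1)) => [b Xb lb||phi hphi].
  - by rewrite level1_degree.
  - by rewrite -addrA.
  - exact: h3.
have := d_Tu hpsi hc gv; rewrite T0 linear0 => /esym/eqP; rewrite subr_eq0 => /eqP ->.
rewrite [v](csumE hX) (addm_sum (iiD _)) big_seq big1 // => b bv; have Xb := csuppX hX bv.
rewrite (linZ (iil _)); have [lb|lb] := eqVneq (N + 2) (deg b).1; last first.
  by rewrite (coord_lev hgr hXh hX Xb gv lb) scale0r.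
have [eb|eb] := eqVneq (deg b).2 (K + d%:Z + 1); last by rewrite cv // scale0r.
rewrite (ii_w_generator hpsi hc) ?scaler0 //; rewrite eb; apply/eqP; lia.
Qed.

Section TopDegree.
Variable v : P.
Hypothesis gv : res_gr P (N + 3, K + 2 * d%:Z) v.
Hypothesis chi_v : forall chi, is_chi chi -> ii (rep chi) v = 0.
Hypothesis T_v : forall psi chi, Ext_gr P (2, d%:Z) psi -> is_chi chi ->
  T (fun x => ii (rep psi) (ii (rep chi) x)) v = 0.
Variable th : A -> F.
Hypothesis thl : forall c a b, th (c *: a + b) = c * th a + th b.
Variable q : P -> A.
Hypothesis qD : addm q.
Hypothesis qE : forall z n j, n <= 0 -> res_gr P (n, j) z -> z = q z *: x0.
Hypothesis qg : forall z i, res_gr P (0, i%:Z) z -> gr i (q z).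
Hypothesis qZ : forall a z, q (a *: z) = a * q z.

Let x := dP v.
Let Th := theta X th.
(** For a in A_d, a x0 is the boundary of s (a x0), a combination of generators of level 1. th is
    applied to its coefficients, in A_{d-1}, and the boundary taken again: its coefficient lies in
    A_1. *)
Let lift_coef (a : A) : A := q (dP (Th (s (a *: x0)))).
(** The two cases bring both kinds of generators of level 3k+2 to the common degree 2dk+d+1. *)
Let kap (b : P) (a : A) : A :=
  if (deg b).2 == K + d%:Z + 1 then (th a)%:A else lift_coef a.

Let d_ge2 : 2 <= d%:Z. Proof. by rewrite lez_nat. Qed.
Let sD : addm s := ctr_addm hs.
Let ThD : addm Th := theta_addm hX thl.

Let lift_coefD : addm lift_coef.
Proof. by move=> a b; rewrite /lift_coef scalerDl sD ThD linearD qD. Qed.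

Let lift_coefZ a c : lift_coef (a * c%:A) = lift_coef a * c%:A.
Proof.
rewrite /lift_coef mul_alg -alg_mul -scalerA (flinZ _ _ (ctr_flin hs)).
have ThF : flin Th := theta_flin hgr hX thl.
by rewrite (flinZ _ _ ThF) linearZ qZ alg_mul mul_alg.
Qed.

Let kapD b : addm (kap b).
Proof.
move=> y z; rewrite /kap; case: ifP => _; last exact: lift_coefD.
by rewrite -scalerDl; have := thl 1 y z; rewrite scale1r mul1r => ->.
Qed.

Let gx : res_gr P (N + 2, K + 2 * d%:Z) x.
Proof. by have := res_d_degree gv; rewrite -addrA. Qed.

Let chi_x chi : is_chi chi -> ii (rep chi) x = 0.
Proof. by move=> hc; apply: (ii_d hgr hconn hXh hX hmin hs hc); apply: chi_v. Qed.

Let lev_x b : X b -> crd b x != 0 -> (deg b).1 = N + 2.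
Proof. exact: crd_neq0_level gx. Qed.

Let x_coord b : X b -> crd b x != 0 -> (deg b).2 = K + d%:Z \/ (deg b).2 = K + d%:Z + 1.
Proof. by move=> Xb /(lev_x Xb); apply: deg2. Qed.

Let Th_gr1 i y : res_gr P (1, i) y -> res_gr P (1, 1) (Th y).
Proof.
by move=> gy; apply: (theta_gr hgr hconn hXh hX thl _ gy) => b Xb lb _; apply: level1_degree.
Qed.

Let xi := cmap X kap id x.

Let xi_gr : res_gr P (N + 2, K + d%:Z + 1) xi.
Proof.
apply: (gr_sum hg) => b bx _; have Xb := csuppX hX bx.
have [->|nb] := eqVneq (crd b x) 0; first by rewrite (addm0 (@kapD b)) scale0r; apply: gr0.
have gb := degP' hXh Xb; rewrite (lev_x Xb nb) in gb.
have [eb|eb] := x_coord Xb nb; rewrite eb in gb; last first.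
  by rewrite /kap eb eqxx; apply: (res_gr_alg hconn).
have -> : kap b (crd b x) = lift_coef (crd b x).
  by rewrite /kap eb; case: eqP => //; lia.
have ga : gr d (crd b x).
  have := coord_grZ hgr hXh hX Xb gx; rewrite eb.
  by have -> : K + 2 * d%:Z - (K + d%:Z) = d%:Z by lia.
have gs := ctr_gr hs (res_gr_scale ga (ctr_x0_gr hs)); rewrite add0r in gs.
have gq := qg (i := 1) (res_d_degree (Th_gr1 gs)).
by have := res_gr_scale gq gb; rewrite [_ + (K + _)]addrC.
Qed.

(** The composite of phi with the two lifts is m_2 (phi, chi), a scalar at generators of degree
    2dk+d+1 and 0 at the others. Its vanishing at x is a relation in A between coordinates; th of
    this relation is the claim. *)
Let top_functional phi chi : Ext_gr P (2, d%:Z + 1) phi -> is_chi chi ->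
  rep phi (ii (rep chi) xi) = 0.
Proof.
move=> hphi hc; pose w := mm [:: phi; chi].
have wE y : rep phi (ii (rep chi) y) = rep w y by rewrite (rep_mm2 hgr hconn hXh hX hmin hs).
have gw : Ext_gr P (N + 2, K + d%:Z + 1) w.
  have h : List.Forall2 (Ext_gr P) [:: (2, d%:Z + 1); (N, K)] [:: phi; chi] by repeat constructor.
  have := mm_gr hgr hconn hXh hX hmin hs h; rewrite big_cons big_seq1 -/w.
  by congr (Ext_gr P _ w); congr (_, _); rewrite /=; lia.
have w_off b : X b -> (deg b).2 != K + d%:Z + 1 -> rep w b = 0.
  move=> Xb ne; apply: (rep_off hgr hconn hmin gw (degP hXh Xb)).
  by apply: contra ne => /eqP ->.
have sum0 : \sum_(b <- csupp X x) crd b x * (rep w b)%:A = 0.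
  apply: (x0_inj hgr hconn hXh hX hs hsX); rewrite scaler_suml.
  have e : ii (rep phi) (ii (rep chi) x) = 0 by rewrite chi_x // (addm0 (iiD _)).
  rewrite -[RHS]e [x in RHS](csumE hX) (addm_sum (iiD _)) (addm_sum (iiD _)).
  apply: eq_big_seq => b bx; have Xb := csuppX hX bx; rewrite !(linZ (iil _)).
  have [->|nb] := eqVneq (crd b x) 0; first by rewrite mul0r !scale0r.
  rewrite -scalerA; congr (_ *: _).
  have gb := degP' hXh Xb; rewrite (lev_x Xb nb) in gb.
  have gu := (End_gr_comp (ii_gr' hphi) (ii_gr' hc)).2 _ _ _ gb.
  have e1 : N + 2 - ((2, d%:Z + 1) + (N, K)).1 = 0 by rewrite /=; lia.
  rewrite e1 in gu; have [eb|eb] := x_coord Xb nb; rewrite eb in gu.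
    have e2 : K + d%:Z - ((2, d%:Z + 1) + (N, K)).2 = -1 by rewrite /=; lia.
    rewrite e2 in gu; rewrite w_off //; last by rewrite eb; apply/eqP; lia.
    rewrite (gr_low hgr hXh hX _ gu) ?scale0r ?scale0r // => b' Xb' lb'.
    by rewrite level0_degree.
  have e2 : K + d%:Z + 1 - ((2, d%:Z + 1) + (N, K)).2 = 0 by rewrite /=; lia.
  rewrite e2 in gu; rewrite -wE [RHS](gr00 hgr hconn hXh hX hs hsX gu).
  by rewrite (aug_lift hgr hconn hXh hX hs) //; apply: rep_trivial.
have [rD rZ _] := rep_trivial w; rewrite wE /xi /cmap (addm_sum rD).
have thD : addm th by move=> a b; have := thl 1 a b; rewrite scale1r mul1r.
have thZ a c : th (a * c%:A) = th a * c.
  by rewrite mul_alg -[c *: a]addr0 thl (addm0 thD) addr0 mulrC.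
have := congr1 th sum0; rewrite (addm0 thD) (addm_sum thD) => e; rewrite -[RHS]e.
apply: eq_big_seq => b bx; have Xb := csuppX hX bx; rewrite thZ.
rewrite (trivial_homZ hgr hconn) //; last exact: rep_trivial.
have [eb|eb] := eqVneq (deg b).2 (K + d%:Z + 1); last by rewrite w_off // !mulr0.
by rewrite /kap eb eqxx (augA_alg hgr hconn).
Qed.

(** With y = T u x and w = m_2 (psi, chi), summing over generators gives u xi = [lift_coef al] x0 +
    d (Th y). Since ii w x = al x0 and y = - s (ii w x), the two terms are opposite. *)
Let top_lift psi chi : Ext_gr P (2, d%:Z) psi -> is_chi chi ->
  ii (rep psi) (ii (rep chi) xi) = 0.
Proof.
move=> hpsi hc; pose u y := ii (rep psi) (ii (rep chi) y); pose w := mm [:: psi; chi].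
have ul : linear u := u_linear psi chi.
have Tl : linear (T u) := htp_linear hX s u; pose y := T u x.
have ux : u x = 0 by rewrite /u chi_x // (addm0 (iiD _)).
have dy : dP y = - ii (rep w) x by rewrite (d_Tu hpsi hc gx) -/(u x) ux sub0r.
(* Both u and T u vanish at v, so [dif_Tu] at v leaves only T u on x = d v. *)
have y_w : sgn A (N + 1) *: y = ii (rep w) v.
  have uv : u v = 0 by rewrite /u chi_v // (addm0 (iiD _)).
  have := dif_Tu psi chi v; rewrite -/(u v) uv sub0r.
  rewrite {1}/dif T_v // linear0 sub0r -[sg _]/(cj (T u) x).
  by rewrite (cj_End hgr _ (Tu_gr hpsi hc)) => /oppr_inj.
(* v lies in the lowest degree of level 3k+3, so it is a scalar combination of generators, on which
   s kills the values of lifts. *)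
have sy : s y = 0.
  apply: (@sgn_scale_eq0 _ _ _ _ (N + 1)).
  rewrite sgn_alg -(flinZ _ _ (ctr_flin hs)) -sgn_alg y_w [v](csumE hX) (addm_sum (iiD _)).
  rewrite (addm_sum sD) big_seq big1 // => b bv; have Xb := csuppX hX bv.
  rewrite (bottom_scalar _ gv Xb) => [|b' Xb' lb']; last by rewrite (deg3 Xb').
  rewrite (linZ (iil _)) (flinZ _ _ (ctr_flin hs)) (s_lift hgr hconn hXh hX hs) //.
  exact: scaler0.
have ey : y = - s (ii (rep w) x).
  have := ctr_homotopy hs y; rewrite sy linear0 (aug_htp hgr hconn hXh hX hs) !scale0r subr0.
  by rewrite dy (addmN sD) opprK => /esym/eqP; rewrite addr_eq0 => /eqP.
pose al := \sum_(b <- csupp X x) crd b x * (rep w b)%:A.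
have wx : ii (rep w) x = al *: x0.
  exact: (ii_bottom_sum hgr hconn hXh hX hmin hs (w_gr hpsi hc) erefl gx).
have gy : res_gr P (1, d%:Z) y.
  have := (Tu_gr hpsi hc).2 _ _ _ gx; rewrite /y; congr (res_gr P (_, _) _); rewrite /=; lia.
have dTy : lift_coef al *: x0 = - dP (Th y).
  rewrite /lift_coef -wx; have -> : s (ii (rep w) x) = - y by rewrite ey opprK.
  rewrite (addmN ThD) linearN (addmN qD) scaleNr; congr (- _).
  by rewrite -(qE _ (res_d_degree (Th_gr1 gy))).
(* T u sends generators of level 3k+2 to degrees 0 and 1 of level 1, where coordinates are scalars,
   so theta passes through it. *)
have dTy' : dP (Th y) = \sum_(b <- csupp X x) (th (crd b x))%:A *: dP (T u b).
  rewrite /y /Th -(theta_comm hX thl Tl) => [|b Xb nb c Xc].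
    rewrite /theta lin_cmap // /cmap (addm_sum (@res_d_addm _ _ _ P)).
    by apply: eq_bigr => b _; rewrite linearZ.
  have gb := degP' hXh Xb; rewrite (lev_x Xb nb) in gb.
  have := (Tu_gr hpsi hc).2 _ _ _ gb.
  have -> : N + 2 - (N + 1, K + d%:Z).1 = 1 by rewrite /=; lia.
  have [-> g1|-> g1] := x_coord Xb nb.
    rewrite /= subrr in g1; apply: (bottom_scalar _ g1 Xc) => b' Xb' lb'.
    by rewrite level1_degree.
  rewrite /= addrAC subrr add0r in g1; apply: (bottom_scalar _ g1 Xc) => b' Xb' lb'.
  by rewrite level1_degree.
suff -> : ii (rep psi) (ii (rep chi) xi) = lift_coef al *: x0 + dP (Th y).
  by rewrite dTy addNr.
rewrite -/(u xi) /xi (lin_cmap X kap x ul) /cmap dTy' (addm_sum lift_coefD) scaler_suml -big_split.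
apply: eq_big_seq => b bx; have Xb := csuppX hX bx; rewrite /= lift_coefZ.
have [->|nb] := eqVneq (crd b x) 0.
  rewrite (addm0 (@kapD b)) (addm0 lift_coefD) mul0r !scale0r add0r.
  have -> : th 0 = 0 by have := thl (-1) 0 0; rewrite scaler0 addr0 mulN1r addNr.
  by rewrite !scale0r.
have lb := lev_x Xb nb; have gb := degP' hXh Xb; rewrite lb in gb.
have dTb := d_Tu hpsi hc gb.
(* At generators of degree 2dk+d the composite equals the lift of the product, so d (T u b) = 0; at
   the others the product vanishes and d (T u b) = u b. *)
have [eb|eb] := x_coord Xb nb.
  have ub := u_generator hpsi hc Xb lb eb; rewrite -/(u b) in ub dTb.
  rewrite (ii_bottom hgr hconn hXh hX hmin hs (w_gr hpsi hc) Xb lb) ub subrr in dTb.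
  rewrite dTb scaler0 addr0 ub scalerA /kap eb; case: eqP => [e|//]; lia.
have ne : (deg b).2 != K + d%:Z by rewrite eb; apply/eqP; lia.
rewrite (w_generator hpsi hc Xb ne) scale0r mulr0 scale0r add0r.
by rewrite dTb (ii_w_generator hpsi hc Xb lb ne) subr0 /kap eb eqxx.
Qed.

(** The degree 2dk+d+1 of xi is below 2dk+2d, so [joint_inj2] applies to xi, though its degree bound
    fails for x. *)
Lemma theta_kill b : X b -> (deg b).2 = K + d%:Z + 1 -> th (crd b x) = 0.
Proof.
move=> Xb eb; suff xi0 : xi = 0.
  apply: (alg_inj (A := A)); rewrite scale0r.
  by have := coord_cmap hX x kapD Xb; rewrite -/xi xi0 (addm0 (coordD hX b)) /kap eb eqxx.
apply: (joint_inj2 _ xi_gr) => [|chi hc]; first by lia.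
have gz : res_gr P (2, d%:Z + 1) (ii (rep chi) xi).
  by apply: (chi_shift hc xi_gr); rewrite addrA.
by apply: (level2_detect gz) => [phi hphi|psi hpsi]; [apply: top_functional|apply: top_lift].
Qed.

End TopDegree.

(** It suffices that x = d v is 0, as generators of level 3k+4 have degree 2dk+2d+1. Functionals
    kill the coordinates of x at generators of degree 2dk+d+1; the others belong to a single degree,
    so theta x is homogeneous and commutes with the lifts, as on level 3k+1. *)
Lemma detect3 v : res_gr P (N + 3, K + 2 * d%:Z) v ->
  (forall phi chi, Ext_gr P (3, 2 * d%:Z) phi -> is_chi chi ->
     rep (mm [:: phi; chi]) v = 0) ->
  (forall phi psi chi, Ext_gr P (2, d%:Z) phi -> Ext_gr P (2, d%:Z) psi -> is_chi chi ->
     rep (mm [:: phi; psi; chi]) v = 0) -> v = 0.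
Proof.
move=> gv h2 h3; pose x := dP v.
have gx : res_gr P (N + 2, K + 2 * d%:Z) x.
  by have := res_d_degree gv; rewrite -addrA.
have lev_x b : X b -> crd b x != 0 -> (deg b).1 = N + 2 by apply: crd_neq0_level gx.
have x_coord b : X b -> crd b x != 0 -> (deg b).2 = K + d%:Z \/ (deg b).2 = K + d%:Z + 1.
  by move=> Xb /(lev_x _ Xb); apply: deg2.
suff x_eq0 : x = 0.
  apply: (cycle_eq0 hgr hXh hX hs _ gv x_eq0) => [|b Xb lb]; first by rewrite /N; lia.
  rewrite (deg4 Xb) //; lia.
have chi_v chi : is_chi chi -> ii (rep chi) v = 0.
  move=> hc; apply: (bottom_eq0 hgr hconn hXh hX hmin (chi_shift hc gv erefl)) => [b Xb lb|phi hphi].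
    by rewrite level3_degree.
  by rewrite -(rep_mm2 hgr hconn hXh hX hmin hs); apply: h2.
have chi_x chi : is_chi chi -> ii (rep chi) x = 0.
  by move=> hc; apply: (ii_d hgr hconn hXh hX hmin hs hc); apply: chi_v.
have d_ge2 : 2 <= d%:Z by rewrite lez_nat.
have mm3_v psi chi : Ext_gr P (2, d%:Z) psi -> is_chi chi ->
    T (fun x => ii (rep psi) (ii (rep chi) x)) v = 0.
  move=> hpsi hc; apply: (mm3_detect hpsi hc (n := 2) (j := d%:Z)) => [b Xb lb||phi hphi].
  - by case: (level2_degree Xb lb) => ->; lia.
  - by move: gv; congr (res_gr P (_, _) v); lia.
  - exact: h3.
have x_high b : X b -> (deg b).2 = K + d%:Z + 1 -> crd b x = 0.
  move=> Xb eb; apply/eqP/negPn/negP => /eqP nb.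
  have s0 : submod [set 0 : A] by split=> //= c u w -> ->; rewrite scaler0 addr0.
  have [t [tl _ t1]] := separating_functional s0 nb.
  have [q [qD qE qg _ qZ]] := exists_x0_coord hgr hconn hXh hX hs hsX.
  by have /eqP := theta_kill gv chi_v mm3_v tl qD qE qg qZ Xb eb; rewrite t1 oner_eq0.
apply: (theta_separate hX) => th thl.
suff tx : theta X th x = 0.
  move=> b Xb; apply: (alg_inj (A := A)); rewrite scale0r -(crd_theta hX thl) // tx.
  exact: addm0 (coordD hX b).
have tgr : res_gr P (N + 2, K + d%:Z) (theta X th x).
  apply: (theta_gr hgr hconn hXh hX thl _ gx) => b Xb lb nb.
  by case: (x_coord b Xb nb) => // e; rewrite (x_high b Xb e) eqxx in nb.
apply: (joint_inj2 _ tgr) => [|chi hc]; first by lia.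
rewrite (theta_comm hX thl) ?chi_x // ?(addm0 (theta_addm hX thl)) // => b Xb nb c Xc.
have eb : (deg b).2 = K + d%:Z.
  by case: (x_coord b Xb nb) => // e; rewrite (x_high b Xb e) eqxx in nb.
have := degP' hXh Xb; rewrite (lev_x b Xb nb) eb => gb.
apply: (bottom_scalar _ (chi_shift hc gb erefl) Xc) => b' Xb' lb'.
by case: (level2_degree Xb' lb') => ->; lia.
Qed.

End Level.

End BiKoszulDetection.

(** * Duality with the generators *)

Section FiniteDimension.
Variables (F : fieldType) (V : lmodType F).

Lemma lspan_seq (t : seq V) v : lspan [set x | x \in t] v ->
  exists a : 'I_(size t) -> F, v = \sum_k a k *: t`_k.
Proof.
apply: (lspan_min (W := [set v | exists a : 'I_(size t) -> F, v = \sum_k a k *: t`_k])).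
  split=> [|c _ _ [a ->] [b ->]].
    by exists (fun=> 0); rewrite big1 // => k _; rewrite scale0r.
  exists (fun k => c * a k + b k); rewrite scaler_sumr -big_split; apply: eq_bigr => k _.
  by rewrite scalerDl scalerA.
move=> x /= xt; have lt : (index x t < size t)%N by rewrite index_mem.
exists (fun k => (k == Ordinal lt)%:R); rewrite (bigD1 (Ordinal lt)) //= eqxx scale1r nth_index //.
by rewrite big1 ?addr0 // => k /negPf ->; rewrite scale0r.
Qed.

(** If [l] were longer than [t], the coefficient matrix would have a nonzero left kernel, that is, a
    linear relation. *)
Lemma indep_bound (T : choiceType) (f : T -> V) (t : seq V) (l : seq T) : uniq l ->
  (forall x, x \in l -> lspan [set y | y \in t] (f x)) ->
  (forall c : T -> F, \sum_(x <- l) c x *: f x = 0 -> forall x, x \in l -> c x = 0) ->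
  (size l <= size t)%N.
Proof.
case: l => [//|x0 l0]; set l := x0 :: l0 => ul ft indep.
have /choice[M hM] : forall i : 'I_(size l), exists a : 'I_(size t) -> F,
    f (nth x0 l i) = \sum_k a k *: t`_k.
  by move=> i; apply: lspan_seq; apply: ft; apply: mem_nth.
pose B := (\matrix_(i, k) M i k : 'M[F]_(size l, size t)).
rewrite leqNgt; apply/negP => lt.
have kn : kermx B != 0.
  rewrite -mxrank_eq0 mxrank_ker -lt0n subn_gt0; exact: leq_ltn_trans (rank_leq_col B) lt.
have := nz_row_sub (kermx B); move: kn; rewrite -nz_row_eq0; set u := nz_row _ => un.
move=> /sub_kermxP uB.
pose c x := if insub (index x l) is Some i then u 0 i else 0 : F.
have cE (i : 'I_(size l)) : c (nth x0 l i) = u 0 i.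
  rewrite /c index_uniq //; case: insubP => [j _ ej|]; last by rewrite ltn_ord.
  by congr (u 0 _); apply: val_inj.
have c0 : \sum_(x <- l) c x *: f x = 0.
  rewrite (big_nth x0) big_mkord.
  under eq_bigr => i _ do rewrite cE hM scaler_sumr.
  rewrite exchange_big big1 //= => k _.
  under eq_bigr => i _ do rewrite scalerA.
  have uBk : \sum_i u 0 i * M i k = (u *m B) 0 k.
    by rewrite mxE; apply: eq_bigr => i _; rewrite mxE.
  by rewrite -scaler_suml uBk uB mxE scale0r.
move/eqP: un; apply; apply/rowP => i; rewrite mxE -cE.
by apply: (indep c c0); apply: mem_nth.
Qed.

End FiniteDimension.

Lemma bounded_finite (T : choiceType) (S : set T) (N : nat) :
  (forall l : seq T, uniq l -> (forall x, x \in l -> S x) -> (size l <= N)%N) ->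
  exists l : seq T, [/\ uniq l, forall x, x \in l -> S x & forall x, S x -> x \in l].
Proof.
move=> h; pose Q n := `[< exists l : seq T, [/\ uniq l, forall x, x \in l -> S x & size l = n] >].
have Q0 : exists n, Q n by exists 0%N; apply/asboolP; exists [::].
have QN n : Q n -> (n <= N)%N by move=> /asboolP[l [ul Sl <-]]; apply: h.
case: (ex_maxnP Q0 QN) => n /asboolP[l [ul Sl sl]] maxn; exists l; split=> // x Sx.
apply/negPn/negP => nx; have /maxn : Q n.+1; last by rewrite ltnn.
apply/asboolP; exists (x :: l); split=> /=; rewrite ?nx ?sl // => y.
by rewrite inE => /orP[/eqP -> //|/Sl].
Qed.

Section FiniteBasis.
Variables (F : fieldType) (A : algType F) (gr : nat -> set A).
Hypotheses (hgr : graded_algebra gr) (hconn : connected_algebra gr).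
Hypothesis hfin : locally_finite gr.
Variables (P : resolution gr) (X : set P).
Hypothesis hXh : X `<=` [set x | exists nj, res_gr P nj x].
Hypothesis hX : is_basis X.
Hypothesis hmin : minimal_resolution P.
Variables (s : P -> P) (x0 : P).
Hypothesis hs : contraction s x0.
Variable D : nat -> nat * nat.
Hypothesis hdeg : forall b, X b -> (deg b).2 = (D (lev b)).1%:Z \/
  (deg b).2 = (D (lev b)).2%:Z.

Let gens (n : nat) (j : int) : set P := [set b | X b /\ deg b = (n%:Z, j)].

(** Such a combination is a boundary, so by minimality its coordinates, the scalars c b, have zero
    augmentation. *)
Lemma scalar_comb_indep (l : seq P) (c : P -> F) : uniq l -> (forall b, b \in l -> X b) ->
  res_d P (\sum_(b <- l) (c b)%:A *: b) = 0 -> res_aug P (\sum_(b <- l) (c b)%:A *: b) = 0 ->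
  forall b, b \in l -> c b = 0.
Proof.
move=> ul lX dv av b bl; have Xb := lX b bl.
have := min_cycle_aug hgr hconn hX hmin b hs dv av.
rewrite (addm_sum (coordD hX b)) (bigD1_seq b) //= (coordZ hX) (coord_basis hX _ Xb) eqxx mulr1.
rewrite big_seq_cond big1 ?addr0 ?(augA_alg hgr hconn) // => b' /andP[b'l ne].
by rewrite (coordZ hX) (coord_basis hX _ (lX _ b'l)) (negPf ne) mulr0.
Qed.

(** The generators of level n have at most two internal degrees and A is locally finite, so finitely
    many products a b span. *)
Lemma finite_component n : (forall j, exists l : seq P, forall b, gens n j b -> b \in l) ->
  forall j, exists t : seq (rscal P), forall x, res_gr P (n%:Z, j) x -> lspan [set y | y \in t] (x : rscal P).
Proof.
move=> fin j.
have [l1 h1] := fin (D n).1%:Z; have [l2 h2] := fin (D n).2%:Z.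
have /choice[t0 ht0] := hfin.
pose t (b : P) := if j - (deg b).2 is Posz i then t0 i else [::].
pose t' : seq (rscal P) := flatten [seq [seq a *: b | a <- t b] | b <- l1 ++ l2].
have sm := lspan_submod [set y | y \in t'].
exists t' => x gx; rewrite [x](csumE hX); apply: (submod_sum sm) => b bx _.
have Xb := csuppX hX bx.
have [nb|nb] := eqVneq n%:Z (deg b).1; last first.
  by rewrite (coord_lev hgr hXh hX Xb gx nb) scale0r; case: sm.
have bl : b \in l1 ++ l2.
  have lb : lev b = n by move: nb; rewrite (degE hXh hX Xb) => /eqP; rewrite eqz_nat => /eqP.
  rewrite mem_cat; apply/orP; have := hdeg Xb; rewrite lb; case=> e; [left; apply: h1|right; apply: h2].
    by split=> //; rewrite nb -e; case: (deg b).
  by split=> //; rewrite nb -e; case: (deg b).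
have := coord_grZ hgr hXh hX Xb gx; case e : (j - _) => [i|i] /=; last first.
  by move=> ->; rewrite scale0r; case: sm.
move=> /ht0; move: (coord X b x) => a.
apply: (@lspan_min _ _ _ [set a | lspan [set y | y \in t'] (a *: b : rscal P)]).
  split=> [|c u v hu hv]; first by rewrite /= scale0r; case: sm.
  rewrite /= scalerDl -alg_mul -scalerA.
  exact: sm.2.
move=> a' a't /=; apply: sub_lspan => /=; apply/flattenP.
exists [seq a *: b | a <- t b]; first by apply/mapP; exists b.
by apply/mapP; exists a' => //; rewrite /t e.
Qed.

(** By induction on the level: d embeds the scalar span of the generators of bidegree (n+1, j) into
    the finite-dimensional component (n, j), and the augmentation embeds that of level 0 into F. *)
Lemma finite_generators n j : exists l : seq P,
  [/\ uniq l, forall b, b \in l -> gens n j b & forall b, gens n j b -> b \in l].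
Proof.
elim: n j => [|n IH] j.
  apply: (@bounded_finite _ _ 1) => l ul lX.
  apply: (@indep_bound F F^o _ (fun b => res_aug P b) [:: 1] l ul) => [b _|c e].
    exists 1%N, (fun=> res_aug P b), (fun=> 1); split=> [k|]; first exact: mem_head.
    by rewrite big_ord1; rewrite -[RHS]/(_ * _) mulr1.
  have lX' b : b \in l -> X b by move=> /lX[].
  apply: scalar_comb_indep => //; last first.
    rewrite (addm_sum (@res_augD _ _ _ P)) -[RHS]e; apply: eq_bigr => b _.
    exact: (res_aug_alg hgr hconn).
  rewrite linear_sum big_seq big1 // => b bl; rewrite linearZ /=.
  have [Xb db] := lX b bl; have := res_d_degree (degP' hXh Xb); rewrite db.
  by move=> /res_nonneg ->; rewrite ?scaler0.
have [i|t ht] := @finite_component n _ j.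
  by have [l [_ _ h]] := IH i; exists l.
apply: (@bounded_finite _ _ (size t)) => l ul lX.
apply: (@indep_bound F (rscal P) _ (fun b => res_d P b) t l ul) => [b bl|c e].
  have [Xb db] := lX b bl; apply: ht; have := res_d_degree (degP' hXh Xb); rewrite db /=.
  by have -> : n.+1%:Z - 1 = n%:Z by lia.
apply: scalar_comb_indep => //.
- by move=> b /lX[].
- rewrite linear_sum -[RHS]e; apply: eq_bigr => b _; by rewrite linearZ.
rewrite (addm_sum (@res_augD _ _ _ P)) big_seq big1 // => b bl.
have [Xb db] := lX b bl; rewrite (res_aug_alg hgr hconn) (res_aug_degree _ (degP hXh Xb)) ?mulr0 //.
by rewrite db.
Qed.

Lemma trivial_hom_coord (phi : P -> F^o) x : trivial_hom gr phi ->
  phi x = \sum_(b <- csupp X x) augA gr (coord X b x) * phi b.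
Proof.
move=> h; have [pD _ _] := h; rewrite {1}[x](csumE hX) (addm_sum pD).
by apply: eq_bigr => b _; rewrite (trivial_homZ hgr hconn).
Qed.

Lemma Ext_gr_zero pj x : (forall b, X b -> deg b != pj) -> Ext_gr P pj x -> x = 0.
Proof.
move=> h gx; apply: rep_inj; rewrite (addm0 (lin_addm (rep_linear hgr hconn hmin))).
apply: funext => y; rewrite trivial_hom_coord; last exact: rep_trivial.
rewrite big_seq big1 // => b /(csuppX hX) Xb.
by rewrite (rep_off hgr hconn hmin gx (degP hXh Xb) (h b Xb)) mulr0.
Qed.

(** A functional t vanishing on [S] but not at x is evaluation at the combination v of generators
    with coefficients t (dual b), an element of P because there are finitely many of them; the
    hypothesis gives v = 0. *)
Lemma Ext_gr_generated (n : nat) j (S : set (Ext P)) : S `<=` Ext_gr P (n%:Z, j) ->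
  (forall v, res_gr P (n%:Z, j) v -> (forall b, X b -> deg b != (n%:Z, j) -> coord X b v = 0) ->
     (forall w, S w -> rep w v = 0) -> v = 0) ->
  Ext_gr P (n%:Z, j) `<=` lspan S.
Proof.
move=> hS h x gx; apply: contrapT => nx.
have [t [tl tS t1]] := separating_functional (lspan_submod S) nx.
have [l [ul lg gl]] := finite_generators n j.
have lX b : b \in l -> X b by move=> /lg[].
pose v := \sum_(b <- l) (t (dual X b))%:A *: b.
have tD : addm t by move=> u w; have := tl 1 u w; rewrite scale1r mul1r.
have tZ c u : t (c *: u) = c * t u by rewrite -[c *: u]addr0 tl (addm0 tD) addr0.
have repS := rep_linear hgr hconn hmin.
have tE w : Ext_gr P (n%:Z, j) w -> t w = rep w v.
  move=> gw; pose w' := \sum_(b <- l) (rep w b : F) *: dual X b.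
  have w'E b : X b -> rep w' b = if b \in l then rep w b else 0.
    move=> Xb; have E b' : b' \in l ->
        rep ((rep w b' : F) *: dual X b') b = rep w b' * (b == b')%:R.
      move=> b'l; rewrite (repZ hgr hconn hmin) (rep_dual hgr hconn hXh hX hmin _ (lX _ b'l)).
      rewrite (coord_basis hX _ Xb); case: eqP => _; rewrite ?(augA1 hgr hconn) //.
      by rewrite (addm0 (augAD hgr hconn)).
    rewrite (addm_sum (lin_addm repS)) fct_sumE (eq_big_seq _ E); case: ifPn => [bl|nl].
      rewrite (bigD1_seq b) //= eqxx mulr1 big1 ?addr0 // => b' ne.
      by rewrite eq_sym (negPf ne) mulr0.
    rewrite big_seq big1 // => b' b'l.
    by case: eqP => [e|_]; rewrite ?mulr0 //; rewrite e b'l in nl.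
  have -> : w = w'.
    apply: rep_inj; apply: funext; apply: (eq_on_hbasis hgr hX).
    - by case: (rep_trivial w).
    - by case: (rep_trivial w').
    move=> i a b ga Xb; rewrite !(trivial_homZ hgr hconn _ _ (rep_trivial _)).
    congr (_ * _); rewrite w'E //; case: ifPn => // nl.
    apply: (rep_off hgr hconn hmin gw (degP hXh Xb)).
    by apply: contra nl => /eqP e; apply: gl.
  have [pD pZ _] := rep_trivial w'.
  rewrite (addm_sum tD) /v (addm_sum pD); apply: eq_big_seq => b bl.
  by rewrite tZ pZ (w'E _ (lX _ bl)) bl mulrC.
have v0 : v = 0.
  apply: h => [|b Xb nb|w Sw].
  - apply: (gr_sum (res_grading P)) => b bl _; apply: (res_gr_alg hconn).
    by have [Xb <-] := lg b bl; apply: degP hXh _ Xb.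
  - rewrite /v (addm_sum (coordD hX b)) big_seq big1 // => b' b'l.
    rewrite (coordZ hX) (coord_basis hX _ (lX _ b'l)); case: eqP => [e|_]; last by rewrite mulr0.
    by have [_ e'] := lg _ b'l; rewrite -e e' eqxx in nb.
  - by rewrite -tE; [apply: tS; apply: sub_lspan|apply: hS].
have := tE _ gx; rewrite t1 v0; have [pD _ _] := rep_trivial x; rewrite (addm0 pD) => /eqP.
by rewrite oner_eq0.
Qed.

End FiniteBasis.

(** * Bidegrees of the products *)

Section PositionwiseInduction.
Variables (F : fieldType) (E V : lmodType F).
Variable g : seq E -> V.
Hypothesis gm : multilinear id g.

Lemma multilinear_spans (T : Type) (H : T -> set E) (W : set V) ts xs : submod W ->
  List.Forall2 (fun t => lspan (H t)) ts xs ->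
  (forall ys, List.Forall2 H ts ys -> W (g ys)) -> W (g xs).
Proof.
move=> sW h; suff: forall zs, (forall ys, List.Forall2 H ts ys -> W (g (zs ++ ys))) ->
    W (g (zs ++ xs)) by move=> /(_ [::]).
elim: h => [|t x {}ts {}xs hx h IH] zs hW; first by apply: hW; constructor.
apply: (lspan_min (W := [set x | W (g (zs ++ x :: xs))]) _ _ hx) => [|y Hy].
  split=> [|c u v hu hv] /=; first by rewrite (multilinear0 gm); case: sW.
  by rewrite gm; apply: sW.2.
by rewrite /= -cat_rcons; apply: IH => ys hys; rewrite cat_rcons; apply: hW; constructor.
Qed.

End PositionwiseInduction.

Lemma pieceE : ((E0 == E0) = true) * ((E1 == E1) = true) * ((E2d == E2d) = true) *
  ((E2d1 == E2d1) = true) * ((E0 == E1) = false) * ((E0 == E2d) = false) *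
  ((E0 == E2d1) = false) * ((E1 == E0) = false) * ((E1 == E2d) = false) *
  ((E1 == E2d1) = false) * ((E2d == E0) = false) * ((E2d == E1) = false) *
  ((E2d == E2d1) = false) * ((E2d1 == E0) = false) * ((E2d1 == E1) = false) *
  ((E2d1 == E2d) = false).
Proof. by do !split; apply/eqP. Qed.

Lemma perm_pieces (w w' : seq piece) :
  (forall a, count_mem a w = count_mem a w') -> perm_eq w w'.
Proof. by move=> h; apply/allP => a _; rewrite /= h. Qed.

Lemma size_pieces (w : seq piece) : size w =
  (count_mem E0 w + count_mem E1 w + count_mem E2d w + count_mem E2d1 w)%N.
Proof. by elim: w => [//|a w /= ->]; case: a; do !case: eqP => // _; lia. Qed.

Section PieceDegrees.
Variable d : nat.
Hypothesis hd : (2 <= d)%N.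

Definition piece_res (a : piece) : nat :=
  match a with E0 => 0 | E1 => 1 | _ => 2 end.

Definition piece_low (a : piece) : nat :=
  match a with E0 => 0 | E1 => 1 | E2d => d | E2d1 => d.+1 end.

Definition piece_deg (a : piece) (k : nat) : int * int :=
  ((3 * k + piece_res a)%N%:Z, (2 * d * k + piece_low a)%N%:Z).

(** With n0, n2, n3 factors in E^[0], E^[2]_(d), E^[2]_(d+1), a product has cohomological degree n2
    + n3 + 2 - n0 modulo 3: a factor of E^[1] adds 1, which the degree 2 - n of m_n takes back.
    Every row of the table satisfies this and the equation of lower degrees. *)
Lemma allowed_balance w r : allowed d w r -> exists a k,
  [/\ piece_res a = r,
      (count_mem E2d w + count_mem E2d1 w + 2 = count_mem E0 w + 3 * k + r)%N
    & (count_mem E1 w + d * count_mem E2d w + d.+1 * count_mem E2d1 w =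
       2 * d * k + piece_low a)%N].
Proof.
case=> -[w0 r0] hin [/permP/= hw /= ->]; rewrite !hw {w hw}.
move: hin; rewrite !inE -!cats1.
have pick (a : piece) k n0 n1 n2 n3 r' : piece_res a = r' ->
    (n2 + n3 + 2 = n0 + 3 * k + r')%N -> (n1 + d * n2 + d.+1 * n3 = 2 * d * k + piece_low a)%N ->
    exists a k, [/\ piece_res a = r', (n2 + n3 + 2 = n0 + 3 * k + r')%N
      & (n1 + d * n2 + d.+1 * n3 = 2 * d * k + piece_low a)%N].
  by move=> *; exists a, k.
repeat (case/orP); move=> /eqP[-> ->]; rewrite ?count_cat ?count_nseq /= ?count_nseq /= !pieceE.
all: first [ by apply: (pick E0 0%N) => //=; lia | by apply: (pick E0 1%N) => //=; lia
  | by apply: (pick E0 2%N) => //=; lia | by apply: (pick E1 0%N) => //=; lia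
  | by apply: (pick E1 1%N) => //=; lia | by apply: (pick E2d 0%N) => //=; lia
  | by apply: (pick E2d 1%N) => //=; lia | by apply: (pick E2d1 0%N) => //=; lia
  | by apply: (pick E2d1 1%N) => //=; lia ].
Qed.

(** Conversely, the degree equations produce the table. Eliminating k and k' leaves an equation with
    positive coefficients in the multiplicities; it bounds those of [E0], [E2d] and [E2d1]
    independently of d and determines that of [E1], so finitely many cases remain. *)
Lemma balance_allowed w a k k' :
  (count_mem E2d w + count_mem E2d1 w + 2 + 3 * k = count_mem E0 w + 3 * k' + piece_res a)%N ->
  (count_mem E1 w + d * count_mem E2d w + d.+1 * count_mem E2d1 w + 2 * d * k =
       2 * d * k' + piece_low a)%N -> allowed d w (piece_res a).
Proof.
(* 2d times the first equation minus 3 times the second. *)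
move=> h1 h2; have h3 := congr1 (muln (2 * d)) h1.
have {}h3 : (3 * count_mem E1 w + d * count_mem E2d w + (d + 3) * count_mem E2d1 w +
  2 * d * count_mem E0 w + 2 * d * piece_res a = 4 * d + 3 * piece_low a)%N by lia.
(* What the first equation still says: its residue modulo 3. *)
have {h1 h2} [t h1] : exists t : int, (count_mem E2d w)%:Z + (count_mem E2d1 w)%:Z + 2 =
  (count_mem E0 w)%:Z + 3 * t + (piece_res a)%:Z by exists (k'%:Z - k%:Z); lia.
have ex w0 : (w0, piece_res a) \in reduced_table d ->
    (forall x, count_mem x w = count_mem x w0) -> allowed d w (piece_res a).
  by move=> h c; exists (w0, piece_res a) => //; split=> //; apply: perm_pieces.
have {}ex w0 : (w0, piece_res a) \in reduced_table d ->
    [&& count_mem E0 w == count_mem E0 w0, count_mem E1 w == count_mem E1 w0,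
    count_mem E2d w == count_mem E2d w0 & count_mem E2d1 w == count_mem E2d1 w0] ->
    allowed d w (piece_res a).
  by move=> h /and4P[/eqP c0 /eqP c1 /eqP c2 /eqP c3]; apply: ex h _; case.
move: (count_mem E0 w) (count_mem E1 w) (count_mem E2d w) (count_mem E2d1 w) h1 h3 ex.
move=> n0 n1 n2 n3 h1 h3 ex.
have b0 : (n0 < 3)%N by case: a h3 {ex h1} => /=; nia.
have b2 : (n2 < 5)%N by case: a h3 {ex h1} => /=; nia.
have b3 : (n3 < 4)%N by case: a h3 {ex h1} => /=; nia.
move: ex h1 h3; case: a => /=; case: n0 b0 => [|[|[|//]]] _;
  case: n2 b2 => [|[|[|[|[|//]]]]] _; case: n3 b3 => [|[|[|[|//]]]] _ ex h1 h3.
all: try by exfalso; lia.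
all: let go w0 := (apply: (ex w0); [by rewrite !inE -?cats1 eqxx ?orbT |
    by rewrite -?cats1 ?count_cat ?count_nseq /= ?count_nseq /= !pieceE; lia]) in
  first [go [:: E0; E0] | go [:: E0; E1] | go [:: E2d; E2d1] | go [:: E0; E2d]
  | go [:: E0; E2d1] | go [:: E0; E2d; E2d] | go [:: E1; E2d; E2d] | go [:: E0; E1; E2d]
  | go [:: E2d; E2d; E2d] | go [:: E2d1; E2d; E2d] | go [:: E2d; E2d; E2d; E2d]
  | go [:: E1; E2d; E2d; E2d] | go (rcons (nseq d.-1 E1) E2d1) | go (nseq d E1)
  | go (rcons (nseq d E1) E2d) | go (nseq d.+1 E1)].
Qed.

Lemma allowed_size w r : allowed d w r -> size w \in [:: 2; 3; 4; d; d.+1]%N.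
Proof.
case=> -[w0 r0] hin [/perm_size/= -> _]; move: hin; rewrite !inE.
repeat (case/orP); move=> /eqP[-> _]; rewrite /= ?size_rcons ?size_nseq; lia.
Qed.

End PieceDegrees.

Section Homogeneous.
Variable d : nat.
Hypothesis hd : (2 <= d)%N.
Variables (F : fieldType) (E : lmodType F) (gE : int * int -> set E) (m : seq E -> E).
Hypothesis hg : is_grading gE.
Hypothesis hgm : forall ds xs, (0 < size xs)%N -> List.Forall2 gE ds xs ->
  gE (\sum_(e <- ds) e + (2 - (size xs)%:Z, 0)) (m xs).

Definition homog_piece (a : piece) : set E := [set x | exists k, gE (piece_deg d a k) x].

Lemma pieces_gr w xs : (0 < size xs)%N -> List.Forall2 homog_piece w xs ->
  exists k : nat, gE ((3 * k + count_mem E2d w + count_mem E2d1 w + 2)%N%:Z - (count_mem E0 w)%:Z,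
    (2 * d * k + count_mem E1 w + d * count_mem E2d w + d.+1 * count_mem E2d1 w)%N%:Z) (m xs).
Proof.
move=> s0 h; suff [k [ds [hds e]]] : exists (k : nat) ds, List.Forall2 gE ds xs /\
    \sum_(e <- ds) e = ((3 * k + count_mem E1 w + 2 * count_mem E2d w + 2 * count_mem E2d1 w)%N%:Z,
    (2 * d * k + count_mem E1 w + d * count_mem E2d w + d.+1 * count_mem E2d1 w)%N%:Z).
  exists k; have := hgm s0 hds; congr (gE _ (m xs)); rewrite e; congr (_, _); last by rewrite /= addr0.
  rewrite /= -(Forall2_size h) size_pieces.
  move: (count_mem E0 w) (count_mem E1 w) (count_mem E2d w) (count_mem E2d1 w) => n0 n1 n2 n3; lia.
elim: h {s0} => [|a x w' xs' [k hx] _ [k' [ds [hds e]]]].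
  exists 0%N, [::]; split; first exact: List.Forall2_nil.
  by rewrite big_nil; apply: injective_projections; rewrite /=; lia.
exists (k + k')%N, (piece_deg d a k :: ds); split; first by constructor.
rewrite big_cons e; case: a {hx} => /=; rewrite !pieceE; apply: injective_projections; rewrite /=; lia.
Qed.

Definition supported := forall nj x, gE nj x -> x <> 0 -> exists a k, nj = piece_deg d a k.

Hypothesis hsup : supported.

Lemma pieces_zero_or_allowed w xs : (0 < size xs)%N -> List.Forall2 homog_piece w xs ->
  m xs = 0 \/ exists a k, allowed d w (piece_res a) /\ gE (piece_deg d a k) (m xs).
Proof.
move=> s0 /(pieces_gr s0)[k hk].
have [->|/eqP nz] := eqVneq (m xs) 0; first by left.
right; have [a [k' e]] := hsup hk nz; exists a, k'; rewrite -e; split=> //.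
case: e => e1 e2; apply: (@balance_allowed d hd w a k k'); move: e1 e2;
  move: (count_mem E0 w) (count_mem E1 w) (count_mem E2d w) (count_mem E2d1 w) => n0 n1 n2 n3; lia.
Qed.

Lemma allowed_res w r xs : (0 < size xs)%N -> List.Forall2 homog_piece w xs ->
  allowed d w r -> m xs <> 0 -> forall a k, gE (piece_deg d a k) (m xs) -> piece_res a = r.
Proof.
move=> s0 h hr nz a k gx; have [k' gx'] := pieces_gr s0 h.
have [a' [t [ra e1 _]]] := allowed_balance hd hr.
have e : piece_deg d a k = (((3 * k' + count_mem E2d w + count_mem E2d1 w + 2)%N%:Z - (count_mem E0 w)%:Z,
    (2 * d * k' + count_mem E1 w + d * count_mem E2d w + d.+1 * count_mem E2d1 w)%N%:Z)).
  by apply/eqP/negPn/negP => ne; apply: nz; apply: (gr_disjoint hg gx gx' ne).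
case: e => + _; move: e1; move: (count_mem E0 w) (count_mem E2d w) (count_mem E2d1 w) => n0 n2 n3.
by case: a {gx}; case: a' ra => /= <-; lia.
Qed.

End Homogeneous.


Section ReducedStructure.
Variables (d : nat) (F : fieldType) (E : lmodType F) (gE : int * int -> set E) (m : seq E -> E).
Hypothesis hd : (2 <= d)%N.
Hypothesis hg : is_grading gE.
Hypothesis hgm : forall ds xs, (0 < size xs)%N -> List.Forall2 gE ds xs ->
  gE (\sum_(e <- ds) e + (2 - (size xs)%:Z, 0)) (m xs).
Hypothesis mlin : multilinear id m.
Hypothesis hsup : supported d gE.

Local Notation Hp := (homog_piece d gE).

Lemma lspan_sub_eq (S S' : set E) : S `<=` lspan S' -> S' `<=` lspan S -> lspan S = lspan S'.
Proof. by move=> h h'; apply/seteqP; split; apply: lspan_min => //; apply: lspan_submod. Qed.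

Lemma residue_gr a k : gE (piece_deg d a k) `<=` residue_part gE (piece_res a).
Proof. by move=> x gx; apply: sub_lspan; exists k, (2 * d * k + piece_low d a)%N%:Z. Qed.

Lemma span_or0 (S : set E) x : (x <> 0 -> S x) -> lspan S x.
Proof.
by move=> h; have [->|/eqP/h] := eqVneq x 0; [case: (lspan_submod S)|apply: sub_lspan].
Qed.

Lemma residue_piece r k j x : gE ((3 * k + r)%N%:Z, j) x -> x <> 0 -> (r < 3)%N ->
  exists2 a, piece_res a = r & Hp a x.
Proof.
move=> gx nz lr; have [a [k' e]] := hsup gx nz; exists a; last by exists k'; rewrite -e.
by case: e => + _; case: a => /=; lia.
Qed.

Lemma piece_partE a : piece_part d gE a = lspan (Hp a).
Proof.
have aux r a' : (forall b, piece_res b = r -> b = a') -> (r < 3)%N ->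
    residue_part gE r `<=` lspan (Hp a').
  move=> hb lr; apply: lspan_min => [|x [k [j gx]]]; first exact: lspan_submod.
  by apply: span_or0 => nz; have [b /hb <-] := residue_piece gx nz lr.
have aux' a' : lspan (Hp a') `<=` residue_part gE (piece_res a').
  by apply: lspan_min => [|x [k /residue_gr]]; first exact: lspan_submod.
case: a => //; apply/seteqP; split; try exact: (aux' E0); try exact: (aux' E1).
  by apply: aux => // -[].
by apply: aux => // -[].
Qed.

Lemma residue2E : residue_part gE 2 = lspan (E2_part d gE d `|` E2_part d gE d.+1).
Proof.
apply: lspan_sub_eq => x.
  move=> [k [j gx]]; apply: span_or0 => nz; have [a ra ha] := residue_piece gx nz isT.
  by case: a ra ha => // _ ha; [left|right]; apply: sub_lspan.
by case=> hx; apply: (lspan_min (lspan_submod _) _ hx) => y [k gy];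
   apply: sub_lspan; exists k; eexists; apply: gy.
Qed.

Lemma homog_pieces_span x : lspan [set x | exists a, Hp a x] x.
Proof.
move: x; apply: (homog_ind hg) => [|u v hu hv|nj x gx].
- by case: (lspan_submod [set x | exists a, Hp a x]).
- exact: (submodD (lspan_submod _)).
by apply: span_or0 => nz; have [a [k e]] := hsup gx nz; exists a, k; rewrite -e.
Qed.

Lemma pieces_of xs : (forall x, x \in xs -> exists a, Hp a x) ->
  exists w, List.Forall2 Hp w xs.
Proof.
elim: xs => [|x xs IH] h; first by exists [::]; apply: List.Forall2_nil.
have [a ha] := h x (mem_head _ _).
have [|w hw] := IH; first by move=> y hy; apply: h; rewrite inE hy orbT.
by exists (a :: w); apply: List.Forall2_cons.
Qed.

Lemma zero_submod : submod [set 0 : E].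
Proof. by split=> //= c u v -> ->; rewrite scaler0 addr0. Qed.

(** Multilinearity reduces each clause to homogeneous elements of the pieces, where a nonzero
    product has an admissible bidegree and so comes from an allowed word. *)
Lemma reduced_of_supported : reduced d gE m.
Proof.
split; first exact: residue2E.
- move=> xs s0 ns; apply: (multilinear_ind mlin zero_submod homog_pieces_span _ erefl).
  move=> ys sy /pieces_of[w hw]; have sy0 : (0 < size ys)%N by rewrite sy.
  have [//|[a [k [/(allowed_size hd) hs _]]]] := pieces_zero_or_allowed hd hgm hsup sy0 hw.
  by rewrite (Forall2_size hw) sy (negPf ns) in hs.
- move=> w xs s0 h na; have sw := Forall2_size h.
  apply: (multilinear_spans (H := Hp) (ts := w) mlin zero_submod) => [|ys hw].
    by apply: List.Forall2_impl h => a x; rewrite piece_partE.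
  have sy0 : (0 < size ys)%N by rewrite -(Forall2_size hw) sw.
  by have [//|[a [k [/na]]]] := pieces_zero_or_allowed hd hgm hsup sy0 hw.
move=> w xs r h ha.
have sw : (0 < size w)%N by move: (allowed_size hd ha); case: (w) => //; rewrite !inE; lia.
apply: (multilinear_spans (H := Hp) (ts := w) mlin (lspan_submod _)) => [|ys hw].
  by apply: List.Forall2_impl h => a x; rewrite piece_partE.
have sy0 : (0 < size ys)%N by rewrite -(Forall2_size hw).
have [e|/eqP nz] := eqVneq (m ys) 0.
  by rewrite e; case: (lspan_submod [set x | exists k j, gE ((3 * k + r)%N%:Z, j) x]).
have [//|[a [k [_ gx]]]] := pieces_zero_or_allowed hd hgm hsup sy0 hw.
rewrite -(allowed_res hd hg hgm sy0 hw ha nz gx); exact: residue_gr gx.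
Qed.

End ReducedStructure.

(** * From a bi-Koszul resolution to a reduced, finitely generated structure *)

Section BiKoszulExt.
Variables (F : fieldType) (A : algType F) (gr : nat -> set A).
Hypotheses (hgr : graded_algebra gr) (hconn : connected_algebra gr).
Hypothesis hfin : locally_finite gr.
Variables (P : resolution gr) (X : set P).
Hypothesis hXh : X `<=` [set x | exists nj, res_gr P nj x].
Hypothesis hX : is_basis X.
Hypothesis hmin : minimal_resolution P.
Variables (s : P -> P) (x0 : P).
Hypothesis hs : contraction s x0.
Hypothesis hsX : forall b, X b -> s b = 0.
Variable d : nat.
Hypothesis hd : (2 <= d)%N.
Hypothesis hdeg : forall b, X b -> (deg b).2 = (bi_Koszul_degrees d (lev b)).1%:Z \/
  (deg b).2 = (bi_Koszul_degrees d (lev b)).2%:Z.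

Local Notation E := (Ext P).
Local Notation mm := (mm X s x0).

Lemma generator_deg b : X b -> exists a k, deg b = piece_deg d a k.
Proof.
move=> Xb; have e1 := degE hXh hX Xb; have := hdeg Xb; move: (lev b) e1 => n.
have en := divn_eq n 3; have := ltn_pmod n (isT : 0 < 3)%N.
move: (n %/ 3)%N (n %% 3)%N en => k r -> {n}; rewrite mulnC.
case: (deg b) => p j /=; case: r => [|[|[|//]]] _ ->; rewrite ?addn0.
- by rewrite degrees0; case=> ->; exists E0, k; rewrite /piece_deg !addn0.
- by rewrite degrees1; case=> ->; exists E1, k.
rewrite degrees2; case=> ->; first by exists E2d, k.
by exists E2d1, k; rewrite /piece_deg /= -addnA addn1.
Qed.

Lemma Ext_supported : supported d (Ext_gr P).
Proof.
move=> nj x gx nz; apply: contrapT => h; apply: nz.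
apply: (Ext_gr_zero hgr hconn hXh hX hmin _ gx) => b Xb; apply/eqP => e; apply: h.
by rewrite -e; apply: generator_deg.
Qed.

Let products (p : nat) : set E := [set y | exists (ks : seq nat) (xs : seq E),
  [/\ size xs \in [:: 2; 3]%N, all (leq 1) ks, (sumn ks)%:Z + 2 - (size xs)%:Z = p%:Z,
      List.Forall2 (fun k => coh_part (Ext_gr P) k%:Z) ks xs & y = mm xs]].

Let mlin := mm_multilinear hgr hconn hXh hX hmin hs.

Lemma products_coh_part p : products p `<=` coh_part (Ext_gr P) p%:Z.
Proof.
move=> _ [ks [xs [_ _ ep h ->]]].
pose H k := [set x | exists j, Ext_gr P (Posz k, j) x].
apply: (multilinear_spans (H := H) (ts := ks) mlin (lspan_submod _) h) => ys hy.
have [ds [hds e]] : exists ds, List.Forall2 (Ext_gr P) ds ys /\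
    (\sum_(e <- ds) e).1 = (sumn ks)%:Z.
  elim: hy => [|k x ks' xs' [j gx] _ [ds [hds e]]].
    by exists [::]; split; [apply: List.Forall2_nil|rewrite big_nil].
  exists ((k%:Z, j) :: ds); split; first exact: List.Forall2_cons.
  by rewrite big_cons /= e.
apply: sub_lspan; eexists; have := mm_gr hgr hconn hXh hX hmin hs hds.
have -> : size ys = size xs by rewrite -(Forall2_size hy) (Forall2_size h).
have -> : p%:Z = (\sum_(e0 <- ds) e0 + (2 - (size xs)%:Z, 0)).1.
  by rewrite /= e addrA.
rewrite [in X in X -> _](surjective_pairing (_ + _)); exact.
Qed.

(** [L] lists the bidegrees of the factors of the products in use; these products stay in E^p_j, and
    duality turns spanning into detection of v. *)
Lemma products_span (p : nat) j (L : seq (seq (nat * int))) :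
  (forall ds, ds \in L -> [/\ size ds \in [:: 2; 3]%N, all (fun e => 1 <= e.1)%N ds,
     (sumn [seq e.1 | e <- ds])%:Z + 2 - (size ds)%:Z = p%:Z & \sum_(e <- ds) e.2 = j]) ->
  (forall v, res_gr P (p%:Z, j) v ->
     (forall b, X b -> deg b != (p%:Z, j) -> coord X b v = 0) ->
     (forall ds xs, ds \in L -> List.Forall2 (fun e => Ext_gr P (e.1%:Z, e.2)) ds xs ->
        rep (mm xs) v = 0) -> v = 0) ->
  Ext_gr P (p%:Z, j) `<=` lspan (products p).
Proof.
move=> hL hv; pose S := [set y | exists ds xs, [/\ ds \in L,
  List.Forall2 (fun e => Ext_gr P (e.1%:Z, e.2)) ds xs & y = mm xs]].
have gS : S `<=` Ext_gr P (p%:Z, j).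
  move=> _ [ds [xs [/hL[_ _ e1 e2] h ->]]].
  have h' : List.Forall2 (Ext_gr P) [seq (e.1%:Z, e.2) | e <- ds] xs.
    by elim: h => [|e x ds' xs' gx _ IH]; [apply: List.Forall2_nil|apply: List.Forall2_cons].
  have := mm_gr hgr hconn hXh hX hmin hs h'; congr (Ext_gr P _ (mm xs)).
  have -> : \sum_(e <- [seq (e.1%:Z, e.2) | e <- ds]) e = ((sumn [seq e.1 | e <- ds])%:Z, j).
    rewrite big_map -e2; elim: (ds) => [|[n i] l IH]; first by rewrite !big_nil.
    by rewrite !big_cons IH /= PoszD.
  by rewrite -(Forall2_size h) -e1; apply: injective_projections; rewrite /= ?addr0 ?addrA.
have SG : S `<=` products p.
  move=> _ [ds [xs [/hL[e0 e1 e2 _] h ->]]].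
  exists [seq e.1 | e <- ds], xs; rewrite -(Forall2_size h) all_map.
  split; [exact: e0|exact: e1|exact: e2| |by []].
  elim: h => [|[n i] x ds' xs' gx _ IH]; first exact: List.Forall2_nil.
  by apply: List.Forall2_cons IH; apply: sub_lspan; exists i.
have gen := Ext_gr_generated hgr hconn hfin hXh hX hmin hs hdeg gS.
move=> x /gen gx; apply: (lspan_min (lspan_submod _) _ (gx _)) => [y /SG|v gv cv h].
  exact: sub_lspan.
by apply: hv => // ds xs dsL hxs; apply: h; exists ds, xs.
Qed.

Lemma Ext_finitely_generated : finitely_generated (Ext_gr P) mm [:: 2; 3]%N 3.
Proof.
move=> p lp; apply/seteqP; split; last first.
  by apply: lspan_min; [apply: lspan_submod|apply: products_coh_part].
apply: lspan_min => [|x [j gx]]; first exact: lspan_submod.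
have [->|/eqP nz] := eqVneq x 0; first by case: (lspan_submod (products p)).
have [a [k [ep ej]]] := Ext_supported gx nz; move: x gx {nz}; rewrite -/(products p).
have det1 := @detect1 _ _ _ hgr hconn _ _ hXh hX hmin _ _ hs hsX _ hd hdeg k.
have det2 := @detect2 _ _ _ hgr hconn _ _ hXh hX hmin _ _ hs hsX _ hd hdeg k.
have det2' := @detect2' _ _ _ hgr hconn _ _ hXh hX hmin _ _ hs hsX _ hd hdeg k.
(* E^{3k} is reached from E^{3(k-1)}; p > 3 makes k >= 2, so that this factor too has positive
   degree. *)
have det3 := @detect3 _ _ _ hgr hconn _ _ hXh hX hmin _ _ hs hsX _ hd hdeg k.-1.
have F2 e e' x y : Ext_gr P (Posz e.1, e.2) x -> Ext_gr P (Posz e'.1, e'.2) y ->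
    List.Forall2 (fun e => Ext_gr P (Posz e.1, e.2)) [:: e; e'] [:: x; y].
  by move=> ? ?; repeat constructor.
have F3 e e' e3 x y z : Ext_gr P (Posz e.1, e.2) x -> Ext_gr P (Posz e'.1, e'.2) y ->
    Ext_gr P (Posz e3.1, e3.2) z ->
    List.Forall2 (fun e => Ext_gr P (Posz e.1, e.2)) [:: e; e'; e3] [:: x; y; z].
  by move=> ? ? ?; repeat constructor.
case: a ep ej => -[/= ep] ej.
- pose ds2 := [:: (2%N, d%:Z); (2%N, d%:Z); ((3 * k.-1)%N, (2 * d * k.-1)%N%:Z)].
  apply: (@products_span _ _ [:: [:: (3%N, 2 * d%:Z); ((3 * k.-1)%N, (2 * d * k.-1)%N%:Z)]; ds2]).
    move=> ds; rewrite !inE => /orP[] /eqP ->; rewrite !big_cons big_nil /=; split=> //; nia.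
  move=> v gv _ h; apply: det3 => [|phi chi h1 h2|phi psi chi h1 h2 h3].
  + by move: gv; congr (res_gr P (_, _) v); rewrite ?ej; nia.
  + by apply: h (mem_head _ _) _; apply: F2.
  + by apply: (h ds2); [rewrite !inE eqxx orbT|apply: F3].
- apply: (@products_span _ _ [:: [:: (1%N, 1); ((3 * k)%N, (2 * d * k)%N%:Z)]]).
    move=> ds; rewrite !inE => /eqP ->; rewrite !big_cons big_nil /=; split=> //; lia.
  move=> v gv _ h; apply: det1 => [|phi chi h1 h2].
  + by move: gv; congr (res_gr P (_, _) v); lia.
  + by apply: h (mem_head _ _) _; apply: F2.
- apply: (@products_span _ _ [:: [:: (2%N, d%:Z); ((3 * k)%N, (2 * d * k)%N%:Z)]]).
    move=> ds; rewrite !inE => /eqP ->; rewrite !big_cons big_nil /=; split=> //; lia.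
  move=> v gv _ h; apply: det2 => [|phi chi h1 h2].
  + by move: gv; congr (res_gr P (_, _) v); lia.
  + by apply: h (mem_head _ _) _; apply: F2.
pose ds2 := [:: (1%N, 1); (2%N, d%:Z); ((3 * k)%N, (2 * d * k)%N%:Z)].
apply: (@products_span _ _ [:: [:: (2%N, d%:Z + 1); ((3 * k)%N, (2 * d * k)%N%:Z)]; ds2]).
  move=> ds; rewrite !inE => /orP[] /eqP ->; rewrite !big_cons big_nil /=; split=> //; lia.
move=> v gv cv h; apply: det2' => [|b Xb ne|phi chi h1 h2|phi psi chi h1 h2 h3].
+ by move: gv; congr (res_gr P (_, _) v); lia.
+ apply: cv => //; apply: contra ne => /eqP ->; rewrite /= ej; apply/eqP; lia.
+ by apply: h (mem_head _ _) _; apply: F2.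
+ by apply: (h ds2); [rewrite !inE eqxx orbT|apply: F3].
Qed.

End BiKoszulExt.

Section LowDegrees.
Variables (d : nat) (F : fieldType) (E : lmodType F) (gE : int * int -> set E).
Hypothesis hd : (2 <= d)%N.
Hypothesis hg : is_grading gE.
Hypothesis hgZ : forall pj (c : F) x, gE pj x -> gE pj (c *: x).
Hypothesis hsup : supported d gE.

Lemma gr_submod pj : submod (gE pj).
Proof. by split=> [|c u v gu gv]; [apply: (gr0 hg)|apply: (grD hg) => //; apply: hgZ]. Qed.

Lemma coh_part_single (p : nat) j :
  (forall a k, (piece_deg d a k).1 = p%:Z -> (piece_deg d a k).2 = j) ->
  coh_part gE p%:Z = gE (p%:Z, j).
Proof.
move=> h; apply/seteqP; split; last by move=> x gx; apply: sub_lspan; exists j.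
apply: lspan_min => [|x [i gx]]; first exact: gr_submod.
have [->|/eqP nz] := eqVneq x 0; first exact: (gr0 hg).
have [a [k e]] := hsup gx nz; have := h a k; rewrite -e /= => /(_ erefl) <-; exact: gx.
Qed.

Lemma coh_part1 : coh_part gE 1 = gE (1, 1).
Proof. by apply: coh_part_single => -[] k /= [] e; nia. Qed.

Lemma coh_part3 : coh_part gE 3 = gE (3, (2 * d)%N%:Z).
Proof. by apply: coh_part_single => -[] k /= [] e; nia. Qed.

Lemma coh_part2 : coh_part gE 2 =
  [set x + y | x in gE (2, d%:Z) & y in gE (2, d.+1%:Z)].
Proof.
apply/seteqP; split; last first.
  move=> _ [x gx [y gy <-]].
  by apply: (submodD (lspan_submod _)); apply: sub_lspan; [exists d%:Z|exists d.+1%:Z].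
apply: lspan_min => [|x [i gx]].
  split; first by exists 0; [apply: (gr0 hg)|exists 0; [apply: (gr0 hg)|rewrite addr0]].
  move=> c _ _ [u1 h1 [u2 h2 <-]] [v1 h3 [v2 h4 <-]].
  exists (c *: u1 + v1); first exact: (gr_submod _).2.
  exists (c *: u2 + v2); first exact: (gr_submod _).2.
  by rewrite scalerDr addrACA.
have [->|/eqP nz] := eqVneq x 0.
  by exists 0; [apply: (gr0 hg)|exists 0; [apply: (gr0 hg)|rewrite addr0]].
have [a [k [e1 e2]]] := hsup gx nz; have [ei|ei] : i = d%:Z \/ i = d.+1%:Z.
- by case: a e1 e2 => /= e1 ->; [nia|nia|left; nia|right; nia].
- by exists x; [rewrite -ei|exists 0; [apply: (gr0 hg)|rewrite addr0]].
by exists 0; [apply: (gr0 hg)|exists x; [rewrite -ei|rewrite add0r]].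
Qed.

End LowDegrees.

Section Forward.
Variables (F : fieldType) (A : algType F) (gr : nat -> set A).
Hypotheses (hgr : graded_algebra gr) (hconn : connected_algebra gr).

(** The scalar part of the coordinate at b vanishes on components of internal degree other than that
    of b, hence on their A-span, but it is 1 at b. *)
Lemma term_degree (P : resolution gr) (X : set P) (n : nat) (D : nat * nat) (b : P) :
  X `<=` [set x | exists nj, res_gr P nj x] -> is_basis X ->
  @res_term F A gr P n = lspan (res_gr P (n%:Z, D.1%:Z) `|` res_gr P (n%:Z, D.2%:Z)) ->
  X b -> lev b = n -> (deg b).2 = D.1%:Z \/ (deg b).2 = D.2%:Z.
Proof.
move=> hXh hX ht Xb lb; apply: contrapT => /not_orP[n1 n2].
have gb := degP' hXh Xb; rewrite (degE hXh hX Xb) lb in gb.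
have : @res_term F A gr P n b by apply: sub_lspan; exists (deg b).2.
rewrite ht => hb.
have W0 : augA gr (coord X b b) = 0.
  apply: (@lspan_min _ _ _ [set y | augA gr (coord X b y) = 0] _ _ _ hb).
    split=> [|c u v hu hv] /=; first by rewrite (addm0 (coordD hX b)) (addm0 (augAD hgr hconn)).
    by rewrite (coordD hX) (coordZ hX) (augAD hgr hconn) (augAM hgr hconn) hu hv mulr0 addr0.
  have aux j y : (deg b).2 <> j -> res_gr P (n%:Z, j) y -> augA gr (coord X b y) = 0.
    move=> nj gy; have := coord_grZ hgr hXh hX Xb gy; case e: (j - _) => [[|i]|i].
    - by move/eqP: e; rewrite subr_eq0 => /eqP e; rewrite e in nj.
    - by apply: (augA_pos hgr hconn).
    by move=> ->; rewrite (addm0 (augAD hgr hconn)).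
  by move=> y [gy|gy]; [apply: aux gy|apply: aux gy].
have := W0; rewrite (coord_basis hX _ Xb) eqxx (augA1 hgr hconn) => /eqP; by rewrite oner_eq0.
Qed.

Lemma bi_Koszul_Ext (hfin : locally_finite gr) d (hd : (2 <= d)%N) : bi_Koszul gr d ->
  exists (P : resolution gr) (m : seq (Ext P) -> Ext P),
    [/\ A_infinity_Ext_algebra m,
        reduced d (Ext_gr P) m,
        finitely_generated (Ext_gr P) m [:: 2; 3]%N 3
      & [/\ coh_part (Ext_gr P) 1 = Ext_gr P (1, 1),
            coh_part (Ext_gr P) 2 =
              [set x + y | x in Ext_gr P (2, d%:Z) & y in Ext_gr P (2, d.+1%:Z)]
          & coh_part (Ext_gr P) 3 = Ext_gr P (3, (2 * d)%N%:Z)]].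
Proof.
move=> [P hmin hterm]; have [X hXh hX] := res_free P.
have [s [x0 [hs hsX]]] := min_contraction hgr hconn hXh hX hmin.
have hdeg b (Xb : X b) := term_degree hXh hX (hterm (lev b)) Xb erefl.
have sup := Ext_supported hgr hconn hXh hX hmin hdeg.
have hg := Ext_grading hgr hconn hmin.
have hgZ := Ext_gr_scale hgr hconn hmin.
exists P, (mm X s x0); split.
- exact: (mm_Ext_algebra hgr hconn hXh hX hmin hs).
- apply: reduced_of_supported => //.
    by move=> ds xs _; apply: mm_gr.
  exact: (mm_multilinear hgr hconn hXh hX hmin hs).
- exact: (Ext_finitely_generated hgr hconn hfin hXh hX hmin hs hsX hd hdeg).
by split; [apply: (coh_part1 hd hg hgZ sup)|apply: (coh_part2 hd hg hgZ sup)|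
  apply: (coh_part3 hd hg hgZ sup)].
Qed.

End Forward.

(** * The support of a finitely generated reduced structure *)

Section SupportFromGeneration.
Variables (d : nat) (F : fieldType) (E : lmodType F) (gE : int * int -> set E) (m : seq E -> E).
Hypothesis hd : (2 <= d)%N.
Hypothesis hg : is_grading gE.
Hypothesis hgZ : forall pj (c : F) x, gE pj x -> gE pj (c *: x).
Hypothesis hgm : forall ds xs, (0 < size xs)%N -> List.Forall2 gE ds xs ->
  gE (\sum_(e <- ds) e + (2 - (size xs)%:Z, 0)) (m xs).
Hypothesis mlin : multilinear id m.
Hypothesis hred : reduced d gE m.

Lemma hcomp0_submod pj : submod [set y | hcomp gE pj y = 0].
Proof.
split=> [|c u v hu hv] /=; first exact: (addm0 (hcompD hg _)).
rewrite (hcompD hg) hv addr0 (hcomp_map (g := fun y => c *: y) (f := id) pj u hg hg).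
- by rewrite hu scaler0.
- by move=> x y; rewrite scalerDr.
- by [].
- by move=> k x; apply: hgZ.
Qed.

Lemma homog_piece_part a : homog_piece d gE a `<=` piece_part d gE a.
Proof.
by move=> x [k gx]; case: a gx => gx; apply: sub_lspan; exists k; try (eexists; apply: gx); apply: gx.
Qed.

Lemma reduced_pieces w xs : (0 < size xs)%N -> List.Forall2 (homog_piece d gE) w xs ->
  m xs = 0 \/ exists a k, gE (piece_deg d a k) (m xs).
Proof.
move=> s0 h; have [_ _ hz _] := hred.
have [[r hr]|na] := pselect (exists r, allowed d w r); last first.
  left; apply: (hz w) => // [|r hr]; last by apply: na; exists r.
  by apply: List.Forall2_impl h => a x; apply: homog_piece_part.
right; have [a [t [ra e1 e2]]] := allowed_balance hd hr.
have [k gx] := pieces_gr hd hgm s0 h; exists a, (k + t)%N.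
move: gx; congr (gE _ (m xs)); move: e1 e2 => /=.
move: (count_mem E0 w) (count_mem E1 w) (count_mem E2d w) (count_mem E2d1 w) => n0 n1 n2 n3.
rewrite /piece_deg ra => e1 e2; congr (_, _); lia.
Qed.

Definition supported_at (p : nat) := forall j x, gE (p%:Z, j) x -> x <> 0 ->
  exists a k, (p%:Z, j) = piece_deg d a k.

(** The factors have positive degrees with sum p for m_2 and p + 1 for m_3, so each has degree below
    p and induction applies; products of admissible elements are admissible, so the component of x
    elsewhere is zero. *)
Lemma supported_step p :
  (forall q, (0 < q < p)%N -> supported_at q) ->
  coh_part gE p%:Z `<=` lspan [set y | exists (ks : seq nat) (xs : seq E),
        [/\ size xs \in [:: 2; 3]%N, all (leq 1) ks,
          (sumn ks)%:Z + 2 - (size xs)%:Z = p%:Z,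
          List.Forall2 (fun k => coh_part gE k%:Z) ks xs
        & y = m xs]] ->
  supported_at p.
Proof.
move=> IH hgen j x gx nz; apply: contrapT => nE; apply: nz.
suff : hcomp gE (p%:Z, j) x = 0 by rewrite (hcomp_id hg gx).
have W : submod [set y | hcomp gE (p%:Z, j) y = 0] := hcomp0_submod _.
have cx : coh_part gE p%:Z x by apply: sub_lspan; exists j.
apply: (lspan_min W _ (hgen _ cx)) => _ [ks [xs [sx pk ep h ->]]].
pose H (k : nat) := [set x | exists a, homog_piece d gE a x].
have hks : all (fun k => 0 < k < p)%N ks.
  move: sx pk ep; rewrite -(Forall2_size h) !inE => /orP[] /eqP;
    case: (ks) => [|k1 [|k2 [|k3 [|]]]] //= _; lia.
apply: (multilinear_spans (H := H) (ts := ks) mlin W) => [|ys hys].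
  elim: h hks {sx pk ep} => [|k y ks' xs' hy _ IH'] /=; first by move=> _; apply: List.Forall2_nil.
  move=> /andP[kp /IH' h']; apply: List.Forall2_cons h'.
  apply: (lspan_min (lspan_submod _) _ hy) => z [i gz]; apply: span_or0 => nz.
  by have [a [k' e]] := IH _ kp _ _ gz nz; exists a, k'; rewrite -e.
have [w hw] : exists w, List.Forall2 (homog_piece d gE) w ys.
  apply: pieces_of => y; elim: hys => [|k x' ks' xs' hx _ IH'] //.
  by rewrite inE => /orP[/eqP ->|/IH'].
have sy : (0 < size ys)%N.
  by rewrite -(Forall2_size hys) (Forall2_size h); move: sx; rewrite !inE => /orP[] /eqP ->.
have [-> /=|[a [k ga]] /=] := reduced_pieces sy hw; first by rewrite (addm0 (hcompD hg _)).
rewrite (hcomp_hom hg _ ga); case: eqP => // e; case: nE; exists a, k.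
by rewrite e.
Qed.

Lemma supported_pos (hfg : finitely_generated gE m [:: 2; 3]%N 3) :
  coh_part gE 1 = gE (1, 1) ->
  coh_part gE 2 = [set x + y | x in gE (2, d%:Z) & y in gE (2, d.+1%:Z)] ->
  coh_part gE 3 = gE (3, (2 * d)%N%:Z) ->
  forall p, (0 < p)%N -> supported_at p.
Proof.
move=> h1 h2 h3; elim/ltn_ind => p IH p0.
have single (q : nat) j : coh_part gE q%:Z = gE (q%:Z, j) -> (exists a k, (q%:Z, j) = piece_deg d a k) ->
    supported_at q.
  move=> e ha i x gx nz; suff -> : i = j by [].
  apply: contrapT => ne; apply: nz; have : coh_part gE q%:Z x by apply: sub_lspan; exists i.
  by rewrite e => gx'; apply: (gr_disjoint hg gx gx'); apply/eqP => -[].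
case: p IH p0 => [//|[|[|[|p]]]] IH _.
- by apply: (single 1%N _ h1); exists E1, 0%N; rewrite /piece_deg /= !muln0.
- move=> j x gx nz; apply: contrapT => ne; apply: nz.
  have : coh_part gE 2 x by apply: sub_lspan; exists j.
  rewrite h2 => -[y gy [z gz ey]]; move: gx; rewrite -ey => gx.
  rewrite -(hcomp_id hg gx) (hcompD hg) (hcomp_hom hg _ gy) (hcomp_hom hg _ gz).
  case: eqP => [[e]|_]; first by case: ne; exists E2d, 0%N; rewrite e /piece_deg /= !muln0.
  case: eqP => [[e]|_]; first by case: ne; exists E2d1, 0%N; rewrite e /piece_deg /= !muln0.
  exact: addr0.
- by apply: (single 3%N _ h3); exists E0, 1%N; rewrite /piece_deg /= !muln1 !addn0.
apply: supported_step => [q /andP[q0 qp]|]; first exact: IH.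
by rewrite hfg.
Qed.

End SupportFromGeneration.

(** * Comparison with a minimal resolution *)

Section CompareResolutions.
Variables (F : fieldType) (A : algType F) (gr : nat -> set A).
Hypotheses (hgr : graded_algebra gr) (hconn : connected_algebra gr).

Section AugmentationLift.
Variables (P : resolution gr) (X : set P).
Hypothesis hXh : X `<=` [set x | exists nj, res_gr P nj x].
Hypothesis hX : is_basis X.
Variables (Q : resolution gr) (s : Q -> Q) (x0 : Q).
Hypothesis hs : contraction s x0.

(** The comparison map over the identity of F, as the lift of the augmentation, a cochain of
    bidegree (0, 0). *)
Let g : P -> Q := lift X s x0 (res_aug P).

Lemma aug_lift_gr nj x : res_gr P nj x -> res_gr Q nj (g x).
Proof.
case: nj => n j gx; rewrite -[n]subr0 -[j]subr0.
apply: (rec_degree hgr hconn hXh hX hs) gx => b Xb; rewrite !subr0.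
have [e|/eqP ne] := eqVneq (deg b) (0, 0).
  by rewrite e; apply: (res_gr_alg hconn); apply: ctr_x0_gr hs.
rewrite (res_aug_degree ne (degP hXh Xb)) !scale0r; exact: (gr0 (res_grading Q)).
Qed.

Lemma aug_lift_parity x : parity (g (parity x)) = g x.
Proof.
rewrite (lift_parity hgr hconn hXh hX hs); last exact: res_aug_hom.
by congr (lift _ _ _ _ x); apply: funext => y; apply: (aug_parity hgr).
Qed.

Lemma aug_lift_d x : res_d Q (g x) = g (res_d P x).
Proof.
have := dif_lift hgr hconn hXh hX hs x (res_aug_hom P) (@res_aug_d _ _ _ P).
by rewrite /dif aug_lift_parity => /eqP; rewrite subr_eq0 => /eqP.
Qed.

End AugmentationLift.

Lemma exists_some_contraction (Q : resolution gr) : exists s x0, contraction (P := Q) s x0.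
Proof.
have [|//|v|s [x0 [hs _]]] := @exists_contraction _ _ _ hgr hconn Q set0; last by exists s, x0.
- by [].
by move=> /(lspan_min (W := [set 0])) -> //; split=> //= c u w -> ->; rewrite scaler0 addr0.
Qed.

(** The class is that of phi g, with phi dual to b. Since g h is homotopic to the identity and Q is
    minimal, phi g h = phi, so phi g is 1 at h b. A coboundary at h b is a trivial map of Q
    evaluated on d b, hence 0 by minimality. *)
Lemma min_generator_Ext (P Q : resolution gr) (Y : set Q) b :
  Y `<=` [set x | exists nj, res_gr Q nj x] -> is_basis Y -> minimal_resolution Q -> Y b ->
  exists2 x, Ext_gr P (deg b) x & x <> 0.
Proof.
move=> hYh hY hmin Yb; have [X hXh hX] := res_free P.
have [s [x0 hs]] := exists_some_contraction P.
have [t [y0 ht]] := exists_some_contraction Q.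
pose g : P -> Q := lift X t y0 (res_aug P); pose h : Q -> P := lift Y s x0 (res_aug Q).
pose phi := (fun x => augA gr (coord Y b x) : F^o) : Q -> F^o.
have gl : linear g := lift_linear hX _ _ _; have hl : linear h := lift_linear hY _ _ _.
have [hphi phi_off] : cochain (deg b) phi := dual_cochain hgr hconn hYh hY Yb.
have [pD pZ p0] := hphi.
have gd x : res_d Q (g x) = g (res_d P x) := aug_lift_d hXh hX ht x.
have hd x : res_d P (h x) = h (res_d Q x) := aug_lift_d hYh hY hs x.
have pmin (N : resolution gr) (psi : N -> F^o) (k : Q -> N) x : linear k -> trivial_hom gr psi ->
    psi (k (res_d Q x)) = 0.
  move=> kl [qD qZ q0].
  apply: (trivial_min hgr hconn hmin x (phi := fun y => psi (k y))); split=> [y z|c y|i a y i0 ga].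
  - by rewrite (lin_addm kl) qD.
  - by rewrite (linZ kl) qZ.
  - by rewrite (linZ kl) (q0 i).
have gh x : phi (g (h x)) = phi x.
  pose u y := y - g (h y); have ul : linear u.
    by apply: lin_sub => //; apply: lin_comp.
  have au : (fun y => res_aug Q (u y)) = (fun=> 0).
    apply: funext => y; rewrite (addmB (@res_augD _ _ _ Q)).
    rewrite (aug_lift hgr hconn hXh hX ht _ (res_aug_hom P)).
    by rewrite (aug_lift hgr hconn hYh hY hs _ (res_aug_hom Q)) subrr.
  have du y : dif u y = 0.
    rewrite /dif /u linearB (addmB (@parityD _ _ _ Q)).
    rewrite gd hd (parityK hgr).
    have -> : h (parity (res_d Q y)) = parity (h (res_d Q y)).
      by rewrite -[LHS](parityK hgr) (aug_lift_parity hYh hY hs).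
    by rewrite (aug_lift_parity hXh hX ht) subrr.
  have := dif_htp hgr hconn hYh hY ht x ul.
  rewrite (htp_kill hgr hconn hYh hY ht) => [|c Yc]; last by rewrite du (addm0 (ctr_addm ht)).
  rewrite addr0 au (_ : lift _ _ _ _ x = 0) ?subr0; last first.
    have := lift_flin hgr hconn hYh hY ht (-1) (fun=> 0) (fun=> 0) x.
    by rewrite scaleN1r scaleNr scale1r addNr mulr0 addr0.
  move=> e; apply/esym/eqP; rewrite -subr_eq0 -(addmB pD) -/(u x) -e; apply/eqP.
  have Tl := htp_linear hY t u; rewrite /dif (addmB pD) (pmin Q phi id) // sub0r.
  rewrite (pmin Q phi (fun z => parity (htp Y t u (parity z)))) ?oppr0 //.
  have sl : linear (@parity _ _ _ Q) := @parity_linear _ _ _ hgr Q.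
  exact: (lin_comp sl (lin_comp Tl sl)).
pose psi := (phi \o g) : P -> F^o.
have tpsi : trivial_hom gr psi.
  split=> [y z|c y|i a y i0 ga] /=.
  - by rewrite /psi /= (lin_addm gl) pD.
  - by rewrite /psi /= (linZ gl) pZ.
  - by rewrite /psi /= (linZ gl) (p0 i).
have cpsi : cocycle (deg b) psi.
  split; first split=> // ni x ne gx.
    by apply: phi_off ne _; apply: (aug_lift_gr hXh hX ht).
  by move=> x; rewrite /psi /= -gd; apply: (pmin Q phi id).
exists (Ext_class psi); first by exists psi.
move=> /esym e0; have c0 : lspan [set phi | exists pj, cocycle pj phi] psi.
  by apply: sub_lspan; exists (deg b).
have z0 : lspan [set phi | exists pj, cocycle (P := P) pj phi] 0.
  by case: (lspan_submod [set phi | exists pj, cocycle (P := P) pj phi]).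
have {}e0 : Ext_class psi = Ext_class (0 : P -> F^o).
  rewrite -e0; have := coh_class_linear
    [set phi \o res_d P | phi in [set phi | exists pj, cochain (P := P) pj phi]] (-1) z0 z0.
  by rewrite !scaleN1r oppr0 add0r addNr => /esym.
have /(lspan_min (W := [set chi : P -> F^o | chi (h b) = 0])) := (coh_classP _ c0 z0).1 e0.
rewrite subr0 => hb; have : psi (h b) = 0.
  apply: hb => [|_ [chi [pj [tchi _]] <-]] /=.
    by split=> // c v w /= hv hw; rewrite !fctE hv hw scaler0 addr0.
  by rewrite hd; apply: (pmin P chi h).
rewrite /psi /= gh /phi (coord_basis hY) // eqxx (augA1 hgr hconn) => /eqP.
by rewrite oner_eq0.
Qed.

End CompareResolutions.

(** * Existence of minimal resolutions *)

Section MaximalIndependent.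
Variables (F : fieldType) (V : lmodType F) (T : choiceType) (f : T -> V).
Variables (W : set V) (T0 : set T).
Hypothesis hW : submod W.

Definition indep_mod (C : set T) := forall (s : seq T) (c : T -> F), uniq s ->
  (forall t, t \in s -> C t) -> W (\sum_(t <- s) c t *: f t) -> forall t, t \in s -> c t = 0.

(** A relation involves finitely many elements, so it lies in one member of a chain and Zorn
    applies; if f t were outside the span, t could be adjoined to a maximal C. *)
Lemma exists_max_indep : exists C, [/\ C `<=` T0, indep_mod C
  & forall t, T0 t -> lspan ((f @` C) `|` W) (f t)].
Proof.
have [|C [[CT0 iC] maxC]] := @Zorn_bigcup T [set C | C `<=` T0 /\ indep_mod C].
  move=> D DP tD; split=> [t [C DC Ct]|s c us sD]; first by have [h _] := DP _ DC; apply: h.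
  case: s us sD => [//|t0 s] us sD.
  have [C DC sC] : exists2 C, D C & forall t, t \in t0 :: s -> C t.
    elim: s t0 sD {us} => [|t' s IH] t sD; have [C DC Ct] := sD t (mem_head _ _).
      by exists C => // t''; rewrite inE => /eqP ->.
    have [|C' DC' hC'] := IH t'; first by move=> t'' ht; apply: sD; rewrite inE ht orbT.
    have [CC|CC] := tD _ _ DC DC'.
      by exists C' => // t''; rewrite inE => /orP[/eqP ->|/hC' //]; apply: CC.
    by exists C => // t''; rewrite inE => /orP[/eqP -> //|/hC'/CC].
  by have [_ h] := DP _ DC; apply: h.
exists C; split=> // t T0t; apply: contrapT => nt.
have nC : ~ C t by move=> Ct; apply: nt; apply: sub_lspan; left; exists t.
apply: (maxC (C `|` [set t])).
  by split=> [x Cx|h]; [left|apply: nC; apply: h; right].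
split=> [x [/CT0 //|->] //|s c us sC hs].
have lC := lspan_submod ((f @` C) `|` W).
have fC x : C x -> lspan ((f @` C) `|` W) (f x) by move=> Cx; apply: sub_lspan; left; exists x.
have ct : t \in s -> c t = 0.
  move=> ts; apply: contrapT => /eqP nz; apply: nt.
  move: hs; rewrite (bigD1_seq t) //= => hs.
  have h1 : lspan ((f @` C) `|` W) (c t *: f t).
    rewrite -[_ *: _](addrK (\sum_(i <- s | i != t) c i *: f i)); apply: (submodB lC).
      by apply: sub_lspan; right.
    apply: (submod_sum lC) => x xs xt; apply: (submodZ lC); apply: fC.
    by case: (sC x xs) => // e; rewrite e eqxx in xt.
  by rewrite -[f t]scale1r -(mulVf nz) -scalerA; apply: (submodZ lC).
have hs' : W (\sum_(x <- [seq x <- s | x != t]) c x *: f x).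
  rewrite big_filter; have [ts|ts] := boolP (t \in s).
    by move: hs; rewrite (bigD1_seq t) //= ct // scale0r add0r.
  have -> : \sum_(x <- s | x != t) c x *: f x = \sum_(x <- s) c x *: f x; last by [].
  rewrite big_seq_cond [RHS]big_seq; apply: eq_bigl => x.
  by case: (boolP (x \in s)) => //= xs; apply/eqP => e; rewrite -e xs in ts.
have iC' := iC _ c (filter_uniq _ us) _ hs'.
move=> x xs; have [e|xt] := eqVneq x t; first by rewrite e ct // -e.
apply: iC'; last by rewrite mem_filter xt.
move=> y; rewrite mem_filter => /andP[yt ys].
by case: (sC y ys) => // e; rewrite e eqxx in yt.
Qed.

End MaximalIndependent.

Section HomogeneousSums.
Variables (I : eqType) (V : zmodType) (g : I -> set V).
Hypothesis g0 : forall i, g i 0.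
Hypothesis gB : forall i x y, g i x -> g i y -> g i (x - y).

Definition hsum (v : V) := exists r : seq (I * V),
  (forall p, p \in r -> g p.1 p.2) /\ v = \sum_(p <- r) p.2.

Lemma hsum0 : hsum 0.
Proof. by exists [::]; rewrite big_nil. Qed.

Lemma hsumD u v : hsum u -> hsum v -> hsum (u + v).
Proof.
move=> [r [hr ->]] [t [ht ->]]; exists (r ++ t); rewrite big_cat; split=> // p.
by rewrite mem_cat => /orP[/hr|/ht].
Qed.

Lemma hsum_gr i v : g i v -> hsum v.
Proof. by move=> gv; exists [:: (i, v)]; rewrite big_seq1; split=> // p; rewrite inE => /eqP ->. Qed.

Lemma is_grading_hsum : (forall v, hsum v) ->
  (forall (s : seq I) (c : I -> V), uniq s -> (forall i, g i (c i)) ->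
     \sum_(i <- s) c i = 0 -> forall i, i \in s -> c i = 0) -> is_grading g.
Proof.
move=> hs hu; split=> // v; have [r [hr ->]] := hs v.
have gN i x : g i x -> g i (- x) by move=> gx; rewrite -[- x]sub0r; apply: gB.
exists (undup [seq p.1 | p <- r]), (fun i => \sum_(p <- r | p.1 == i) p.2); split.
  move=> i; rewrite big_seq_cond; apply: (big_ind (g i)) => // [x y gx gy|p /andP[pr /eqP <-]].
    by rewrite -[y]opprK; apply: gB => //; apply: gN.
  exact: hr.
rewrite (exchange_big_dep predT) //=; apply: eq_big_seq => p pr.
rewrite big_mkcond (bigD1_seq p.1) ?undup_uniq ?mem_undup ?map_f //= eqxx big1 ?addr0 // => i ne.
by rewrite eq_sym (negPf ne).
Qed.

End HomogeneousSums.

Section GradedFree.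
Variables (F : fieldType) (A : algType F) (gr : nat -> set A).
Hypothesis hgr : graded_algebra gr.
Variables (M : lmodType A) (B : set M).
Hypothesis hB : is_basis B.
Variable dg : M -> int * int.

Let hA : is_grading gr. Proof. by case: hgr. Qed.

Definition grz (z : int) : set A := if z is Posz i then gr i else [set 0].

Lemma grz0 z : grz z 0.
Proof. by case: z => // i; apply: (gr0 hA). Qed.

Lemma grzB z a b : grz z a -> grz z b -> grz z (a - b).
Proof. by case: z => [i|i] /=; [apply: (grB hA)|move=> -> ->; rewrite subrr]. Qed.

Lemma grzM i z a b : gr i a -> grz z b -> grz (i%:Z + z) (a * b).
Proof.
by case: z => [k|k] ga /= gb; [case: hgr => _ _ _; apply|rewrite gb mulr0; apply: grz0].
Qed.

Definition fgr (nj : int * int) : set M := [set x | forall b, B b ->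
  if (dg b).1 == nj.1 then grz (nj.2 - (dg b).2) (coord B b x) else coord B b x = 0].

Lemma fgr0 nj : fgr nj 0.
Proof. by move=> b Bb; rewrite (addm0 (coordD hB b)); case: ifP => // _; apply: grz0. Qed.

Lemma fgrB nj x y : fgr nj x -> fgr nj y -> fgr nj (x - y).
Proof.
move=> gx gy b Bb; rewrite (addmB (coordD hB b)); move: (gx b Bb) (gy b Bb).
by case: ifP => _; [apply: grzB|move=> -> ->; rewrite subrr].
Qed.

Lemma fgr_scale i a n j x : gr i a -> fgr (n, j) x -> fgr (n, i%:Z + j) (a *: x).
Proof.
move=> ga gx b Bb; rewrite (coordZ hB); move: (gx b Bb) => /=; case: ifP => _.
  by rewrite -addrA; apply: grzM.
by move=> ->; rewrite mulr0.
Qed.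

Lemma fgr_basis b : B b -> fgr (dg b) b.
Proof.
move=> Bb c Bc; rewrite (coord_basis hB) //; have [->|ne] := eqVneq b c; last first.
  by case: ifP => // _; apply: grz0.
by rewrite eqxx subrr; case: hgr.
Qed.

Lemma fgr_grading : is_grading fgr.
Proof.
apply: (is_grading_hsum fgr0 fgrB) => [x|s c us gc s0 i is_].
  rewrite [x](csumE hB) big_seq; apply: (big_ind (hsum fgr)) => [|u v|b bx].
  - exact: hsum0.
  - exact: hsumD.
  have Bb := csuppX hB bx; move: (coord B b x); apply: (homog_ind hA) => [|u v hu hv|i a ga].
  - by rewrite scale0r; apply: hsum0.
  - by rewrite scalerDl; apply: hsumD.
  by have := fgr_basis Bb; rewrite [dg b]surjective_pairing => /(fgr_scale ga)/hsum_gr.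
apply: (coord0_eq0 hB) => b Bb; have := congr1 (coord B b) s0.
rewrite (addm_sum (coordD hB b)) (addm0 (coordD hB b)) (bigD1_seq i) //=.
have := gc i b Bb; case: eqP => [e1|_ -> //]; case e2 : (_ - _) => [n|n] /=; last by move=> ->.
move=> gi /(congr1 (hcomp gr n)); rewrite (hcompD hA) (addm0 (hcompD hA n)) (hcomp_id hA gi).
rewrite (addm_sum (hcompD hA n)) big1 ?addr0 // => k ki.
have := gc k b Bb; case: eqP => [e3|_ ->]; last by rewrite (addm0 (hcompD hA n)).
case e4 : (_ - _) => [n'|n'] /=; last by move=> ->; rewrite (addm0 (hcompD hA n)).
move=> gk; rewrite (hcomp_hom hA _ gk); case: eqP => // e5.
case/eqP: ki; apply: injective_projections; first by rewrite -e1 -e3.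
by apply: (addIr (- (dg b).2)); rewrite e2 e4 e5.
Qed.

Lemma fgr_linear (N : lmodType A) (gN : int * int -> set N) (f : M -> N) (e : int) : linear f ->
  is_grading gN -> (forall i a n j x, gr i a -> gN (n, j) x -> gN (n, i%:Z + j) (a *: x)) ->
  (forall b, B b -> gN ((dg b).1 + e, (dg b).2) (f b)) ->
  forall n j x, fgr (n, j) x -> gN (n + e, j) (f x).
Proof.
move=> fl hN gNZ gf n j x gx; rewrite [x](csumE hB) (addm_sum (lin_addm fl)).
apply: (gr_sum hN) => b bx _; have Bb := csuppX hB bx; rewrite (linZ fl).
move: (gx b Bb) => /=; case: eqP => [<-|_ ->]; last by rewrite scale0r; apply: (gr0 hN).
case ej : (j - _) => [i|i] /=; last by move=> ->; rewrite scale0r; apply: (gr0 hN).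
by move=> ga; have := gNZ _ _ _ _ _ ga (gf b Bb); rewrite -ej subrK.
Qed.

End GradedFree.

(* A label stands for a free generator; it records its homological and internal
   degrees and its boundary, a combination of labels. *)
Inductive label (A : Type) := Label of nat & nat & seq (A * label A).

HB.instance Definition _ (A : Type) := gen_eqMixin (label A).
HB.instance Definition _ (A : Type) := gen_choiceMixin (label A).

Section Labels.
Variables (F : fieldType) (A : algType F) (gr : nat -> set A).
Hypotheses (hgr : graded_algebra gr) (hconn : connected_algebra gr).

Local Notation lab := (label A).
Local Notation U := (lab -> A^o).

Definition lvl (l : lab) := let: Label n _ _ := l in n.
Definition ldeg (l : lab) := let: Label _ j _ := l in j.
Definition lrep (l : lab) := let: Label _ _ r := l in r.

Definition delta (l : lab) : U := fun l' => (l == l')%:R.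
Definition lcomb (r : seq (A * lab)) : U := \sum_(p <- r) p.1 *: delta p.2.
Definition lbd (l : lab) : U := lcomb (lrep l).
Definition lcomb_bd (r : seq (A * lab)) : U := \sum_(p <- r) p.1 *: lbd p.2.

Definition lhomog (L : set lab) (j : nat) (r : seq (A * lab)) := forall p, p \in r ->
  [/\ L p.2, (ldeg p.2 <= j)%N & gr (j - ldeg p.2) p.1].

(** Level 0 has a single generator, so its augmentation is the sum of the scalar parts of the
    coefficients. *)
Definition lcycle (n : nat) (r : seq (A * lab)) :=
  if n is 0 then \sum_(p <- r) augA gr p.1 = 0 else lcomb_bd r = 0.

Definition cycles n L j : set U :=
  [set x | exists r, [/\ lhomog L j r, lcycle n r & x = lcomb r]].

Definition decomposables n L j : set (rscal U) :=
  lspan [set x : rscal U | exists i a k,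
    [/\ (0 < i <= j)%N, gr i a, cycles n L (j - i) k & x = a *: (k : U)]].

(** One potential generator of level n+1 for each expression of a homogeneous cycle of level n, its
    boundary being stored in the label. *)
Definition candidates n L j : set lab :=
  [set l | exists r, [/\ lhomog L j r, lcycle n r & l = Label n.+1 j r]].

Lemma exists_generators n L j : exists C : set lab, [/\ C `<=` candidates n L j,
  indep_mod (lbd : lab -> rscal U) (decomposables n L j) C
  & forall l, candidates n L j l ->
      lspan ((lbd : lab -> rscal U) @` C `|` decomposables n L j) (lbd l : rscal U)].
Proof. by apply: exists_max_indep; apply: lspan_submod. Qed.

Definition generators n L j : set lab := projT1 (cid (exists_generators n L j)).

Definition next_level n L : set lab := [set l | exists j, generators n L j l].

Fixpoint level n : set lab :=
  if n is n'.+1 then next_level n' (level n') else [set Label 0 0 [::]].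

Lemma level_succ n l : level n.+1 l -> [/\ lvl l = n.+1, generators n (level n) (ldeg l) l,
  lhomog (level n) (ldeg l) (lrep l) & lcycle n (lrep l)].
Proof.
move=> [j gl]; have [hC _ _] := projT2 (cid (exists_generators n (level n) j)).
by have [r [h1 h2 e]] := hC _ gl; rewrite e in gl *.
Qed.

Lemma level_lvl n l : level n l -> lvl l = n.
Proof. by case: n => [->|n /level_succ[]]. Qed.

Lemma lcomb_bd_cat r r' : lcomb_bd (r ++ r') = lcomb_bd r + lcomb_bd r'.
Proof. exact: big_cat. Qed.

Lemma lcomb_bd_scale a r : lcomb_bd [seq (a * p.1, p.2) | p <- r] = a *: lcomb_bd r.
Proof.
by rewrite /lcomb_bd big_map scaler_sumr; apply: eq_bigr => p _; rewrite /= scalerA.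
Qed.

(* Graded Nakayama: generators modulo decomposables span, by induction on the degree. *)
Lemma level_exact n j x : cycles n (level n) j x ->
  exists2 r, lhomog (level n.+1) j r & x = lcomb_bd r.
Proof.
elim/ltn_ind: j x => j IH x [r [hr zr ->]].
pose R : set (rscal U) := [set x | exists2 r, lhomog (level n.+1) j r & x = lcomb_bd r].
have sR : submod R.
  split=> [|c _ _ [r1 h1 ->] [r2 h2 ->]]; first by exists [::]; rewrite /lcomb_bd ?big_nil.
  exists ([seq (c%:A * p.1, p.2) | p <- r1] ++ r2).
    move=> p; rewrite mem_cat => /orP[/mapP[q qr ->]|/h2 //].
    have [h3 h4 h5] := h1 q qr; split=> //=; rewrite alg_mul.
    by case: hgr => _ + _ _; apply.
  by rewrite lcomb_bd_cat lcomb_bd_scale.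
have [hC _ hspan] := projT2 (cid (exists_generators n (level n) j)).
have hl : candidates n (level n) j (Label n.+1 j r) by exists r.
apply: (lspan_min (W := R) sR _ (hspan _ hl)) => y [[l gl <-]|hy].
  have [r' [_ _ e]] := hC _ gl.
  exists [:: (1, l)]; last by rewrite /lcomb_bd big_seq1 scale1r.
  move=> p; rewrite inE => /eqP -> /=; split; first by exists j.
    by rewrite e.
  by rewrite e /= subnn; case: hgr.
apply: (lspan_min (W := R) sR _ hy) => z [i [a [k [/andP[i0 ij] ga hk ->]]]].
have [|r' hr' ->] := IH (j - i)%N _ k hk; first by lia.
exists [seq (a * p.1, p.2) | p <- r']; last by rewrite lcomb_bd_scale.
move=> _ /mapP[p pr ->]; have [h1 + +] := hr' p pr; move: h1; case: p {pr} => c l /=.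
move: (ldeg l) => t h1 h2 h3; split=> //=; first by lia.
have -> : (j - t = i + (j - i - t))%N by lia.
by case: hgr => _ _ _; apply.
Qed.

End Labels.

Section LabelModule.
Variables (F : fieldType) (A : algType F) (gr : nat -> set A).
Hypotheses (hgr : graded_algebra gr) (hconn : connected_algebra gr).

Local Notation lab := (label A).
Local Notation U := (lab -> A^o).
Local Notation level := (level gr).

(** The labels reached by the construction; the resolution is free on these, inside the functions
    from all labels to A. *)
Definition good : set lab := [set l | level (lvl l) l].

Lemma level_good n l : level n l -> good l.
Proof. by move=> h; rewrite /good /= (level_lvl h). Qed.

Lemma good_level n l : good l -> lvl l = n -> level n l.
Proof. by move=> h <-. Qed.

Definition lmod : lmodType A := lspan_sub [set delta l | l in good].

Definition mk (u : U) : lmod := insubd 0 u.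

Lemma val_mk u : lspan [set delta l | l in good] u -> val (mk u) = u.
Proof. by move=> h; apply: insubdK; apply/asboolP. Qed.

Definition el (l : lab) : lmod := mk (delta l).

Lemma val_el l : good l -> val (el l) = delta l.
Proof. by move=> h; apply: val_mk; apply: sub_lspan; exists l. Qed.

Lemma val_elE l l' : good l -> val (el l) l' = (l == l')%:R.
Proof. by move=> h; rewrite val_el. Qed.

Lemma val_scale a (x : lmod) : val (a *: x) = a *: (val x : U).
Proof. by rewrite linearZ. Qed.

Lemma val_sum (I : Type) (r : seq I) (f : I -> lmod) :
  val (\sum_(i <- r) f i) = \sum_(i <- r) (val (f i) : U).
Proof. by rewrite raddf_sum. Qed.

Lemma valZ a (x : lmod) l : val (a *: x) l = a * val x l.
Proof. by rewrite linearZ. Qed.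

Lemma valD (x y : lmod) l : val (x + y) l = val x l + val y l.
Proof. by rewrite raddfD. Qed.

Lemma val_linear l : linear ((fun x => val x l) : lmod -> A^o).
Proof. by move=> a x y; rewrite valD valZ. Qed.

Lemma el_eq l l' : good l -> good l' -> (el l == el l') = (l == l').
Proof.
move=> gl gl'; apply/eqP/eqP => [e|-> //]; have := val_elE l' gl; rewrite e val_elE // eqxx.
by case: eqP => // _ /eqP; rewrite oner_eq0.
Qed.

Definition lbasis : set lmod := [set el l | l in good].

Lemma lbasisP : is_basis lbasis.
Proof.
split=> [|s c us sB s0 y ys].
  apply/seteqP; split=> // x _; have /asboolP[n [a [y [Sy ex]]]] := valP x.
  exists n, a, (fun k => mk (y k)); split=> [k|].
    by have [l gl <-] := Sy k; exists l.
  apply: val_inj; rewrite val_sum ex; apply: eq_bigr => k _.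
  by rewrite val_scale val_mk //; apply: sub_lspan.
have [l gl ey] := sB y ys; have := congr1 (fun x : lmod => val x l) s0.
rewrite (addm_sum (lin_addm (@val_linear l))) (addm0 (lin_addm (@val_linear l))) => e.
have E x : x \in s -> val (c x *: x) l = c x * (x == y)%:R.
  by move=> /sB[l' gl' <-]; rewrite valZ val_elE // -ey el_eq.
move: e; rewrite (eq_big_seq _ E) (bigD1_seq y ys us) eqxx mulr1 big1 => [|x /negPf ->]; last exact: mulr0.
by rewrite /= addr0.
Qed.

Lemma coord_el l x : good l -> coord lbasis (el l) x = val x l.
Proof.
move=> gl; move: x; apply: (eq_on_basis lbasisP (coord_linear lbasisP _) (@val_linear l)).
by move=> _ [l' gl' <-]; rewrite (coord_basis lbasisP); [rewrite el_eq // val_elE|exists l'].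
Qed.

Definition lab_of (b : lmod) : lab := xget (Label 0 0 [::]) [set l | good l /\ el l = b].

Lemma el_lab l : good l -> lab_of (el l) = l.
Proof.
move=> gl; apply: xget_unique => // l' [gl' /eqP]; by rewrite el_eq // => /eqP.
Qed.

Definition ldg (b : lmod) : int * int := ((lvl (lab_of b))%:Z, (ldeg (lab_of b))%:Z).

Definition ecomb (r : seq (A * lab)) : lmod := \sum_(p <- r) p.1 *: el p.2.

Definition labs_good (r : seq (A * lab)) := forall p, p \in r -> good p.2.

Lemma val_ecomb r : labs_good r -> val (ecomb r) = lcomb r.
Proof.
move=> h; rewrite /ecomb /lcomb val_sum; apply: eq_big_seq => p pr.
by rewrite val_scale val_el //; apply: h.
Qed.

Definition ldiff : lmod -> lmod := ext lbasis (fun b => ecomb (lrep (lab_of b))).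

Lemma ldiff_linear : linear ldiff. Proof. exact: (ext_linear lbasisP). Qed.

Lemma ldiff_el l : good l -> ldiff (el l) = ecomb (lrep l).
Proof. by move=> gl; rewrite /ldiff (ext_basis lbasisP) ?el_lab //; exists l. Qed.

Lemma good0 : good (Label 0 0 [::]). Proof. by []. Qed.

Lemma lhomog_good n j r : lhomog gr (level n) j r -> labs_good r.
Proof. by move=> h p /h[/level_good]. Qed.

Lemma lrep_good l : good l -> labs_good (lrep l).
Proof.
case en : (lvl l) => [|n] gl; have := good_level gl en; first by move=> ->.
by move=> /level_succ[_ _ /lhomog_good].
Qed.

Lemma ldiff_ecomb r : labs_good r -> val (ldiff (ecomb r)) = lcomb_bd r.
Proof.
move=> h; rewrite /ecomb /lcomb_bd (addm_sum (lin_addm ldiff_linear)) val_sum.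
apply: eq_big_seq => p pr; rewrite (linZ ldiff_linear) val_scale ldiff_el; last exact: h.
by rewrite val_ecomb //; apply/lrep_good/h.
Qed.

Definition laug (x : lmod) : F^o := augA gr (val x (Label 0 0 [::])).

Lemma laug_trivial : trivial_hom gr laug.
Proof.
split=> [x y|c x|i a x i0 ga]; rewrite /laug.
- exact: (augAD hgr hconn).
- by rewrite valZ (augA_algM hgr hconn).
- by rewrite valZ (augAM hgr hconn) (augA_pos hgr hconn i0 ga) mul0r.
Qed.

Lemma laug_ecomb r : labs_good r ->
  laug (ecomb r) = \sum_(p <- r | p.2 == Label 0 0 [::]) augA gr p.1.
Proof.
move=> h; have [lD _ _] := laug_trivial; rewrite /ecomb (addm_sum lD) [RHS]big_mkcond.
apply: eq_big_seq => p pr; rewrite /laug valZ val_elE; last exact: h.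
by case: eqP => _; rewrite ?mulr1 ?mulr0 // (addm0 (augAD hgr hconn)).
Qed.

Definition lclosed n (x : lmod) := if n is 0%N then laug x = 0 else ldiff x = 0.

Lemma lcycleP n j r : lhomog gr (level n) j r -> lcycle gr n r <-> lclosed n (ecomb r).
Proof.
move=> h; have gr_ := lhomog_good h; case: n h => [|n] h /=.
  rewrite laug_ecomb // big_seq [in X in _ <-> X]big_seq_cond.
  rewrite (eq_bigl (fun p => (p \in r) && (p.2 == Label 0 0 [::]))) // => p.
  by case pr: (p \in r) => //=; have [-> _ _] := h p pr; rewrite eqxx.
split=> [e|e]; last by rewrite -ldiff_ecomb // e.
by apply: val_inj; rewrite ldiff_ecomb // e.
Qed.

Lemma ldiff_ecomb0 j r : lhomog gr (level 0) j r -> ldiff (ecomb r) = 0.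
Proof.
move=> h; rewrite /ecomb (addm_sum (lin_addm ldiff_linear)) big_seq big1 // => p pr.
have [-> _ _] := h p pr; rewrite (linZ ldiff_linear) (ldiff_el good0) /ecomb big_nil; exact: scaler0.
Qed.

Lemma el_closed n l : level n.+1 l -> lclosed n (ldiff (el l)).
Proof.
move=> h; rewrite ldiff_el; last exact: level_good h.
by have [_ _ h1 h2] := level_succ h; apply/(lcycleP h1).
Qed.

Lemma ldiff_ldiff x : ldiff (ldiff x) = 0.
Proof.
have z : linear (fun _ : lmod => 0 : lmod) by move=> a y y'; rewrite scaler0 addr0.
move: x; apply: (eq_on_basis lbasisP (lin_comp ldiff_linear ldiff_linear) z) => _ [l gl <-].
rewrite -[LHS]/(ldiff (ldiff (el l))).
case en : (lvl l) => [|[|n]]; have hl := good_level gl en.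
- by rewrite hl (ldiff_el good0) /ecomb big_nil (addm0 (lin_addm ldiff_linear)).
- by rewrite ldiff_el //; have [_ _ h1 _] := level_succ hl; apply: ldiff_ecomb0 h1.
exact: (el_closed hl).
Qed.

Lemma laug_ldiff x : laug (ldiff x) = 0.
Proof.
have [lD lZ l0] := laug_trivial.
rewrite [x](csumE lbasisP) (addm_sum (lin_addm ldiff_linear)) (addm_sum lD) big_seq big1 // => b bx.
rewrite (linZ ldiff_linear) (trivial_homZ hgr hconn _ _ laug_trivial).
suff -> : laug (ldiff b) = 0 by rewrite mulr0.
have [l gl <-] := csuppX lbasisP bx; case en : (lvl l) => [|[|n]]; have hl := good_level gl en.
- by rewrite hl (ldiff_el good0) /ecomb big_nil (addm0 lD).
- exact: (el_closed hl).
have [_ _ h1 _] := level_succ hl; rewrite ldiff_el // laug_ecomb; last exact: lhomog_good h1.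
rewrite big_seq_cond big1 // => p /andP[pr /eqP e]; have [h _ _] := h1 p pr.
by have := level_lvl h; rewrite e.
Qed.

Local Notation lgr := (fgr gr lbasis ldg).

Lemma el_gr l : good l -> lgr ((lvl l)%:Z, (ldeg l)%:Z) (el l).
Proof.
move=> gl; have := @fgr_basis _ _ _ hgr _ _ lbasisP ldg (el l).
by rewrite /ldg el_lab //; apply; exists l.
Qed.

Lemma ecomb_gr n j r : lhomog gr (level n) j r -> lgr (n%:Z, j%:Z) (ecomb r).
Proof.
move=> h; apply: (gr_sum (fgr_grading hgr lbasisP ldg)) => p pr _; have [h1 h2 h3] := h p pr.
have := fgr_scale hgr lbasisP h3 (el_gr (level_good h1)).
by rewrite (level_lvl h1) -PoszD subnK.
Qed.

Lemma gr_ecomb n j x : lgr (n%:Z, j%:Z) x ->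
  exists r, [/\ uniq [seq p.2 | p <- r], lhomog gr (level n) j r & x = ecomb r].
Proof.
move=> gx; pose t := [seq b <- csupp lbasis x | coord lbasis b x != 0].
have tB b : b \in t -> exists2 l, good l & b = el l.
  by rewrite mem_filter => /andP[_ /(csuppX lbasisP)[l gl <-]]; exists l.
exists [seq (coord lbasis b x, lab_of b) | b <- t]; split.
- rewrite -map_comp map_inj_in_uniq; first by apply/filter_uniq/(csupp_uniq lbasisP).
  move=> b b' /tB[l gl ->] /tB[l' gl' ->] /=; by rewrite !el_lab // => ->.
- move=> _ /mapP[b bt ->] /=; have [l gl eb] := tB b bt.
  have := gx b; rewrite eb /ldg el_lab // => /(_ (ex_intro2 _ _ l gl erefl)) /=.
  move: bt; rewrite mem_filter eb => /andP[nz _]; case: eqP => [[e]|_ e]; last by rewrite e eqxx in nz.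
  case ej : (_ - _) => [i|i] /= h; last by rewrite h eqxx in nz.
  split; first exact: good_level.
  - by move: ej; move: (ldeg l) => t' ej; lia.
  - by move: ej h; move: (ldeg l) => t' ej; have -> : (j - t')%N = i by lia.
rewrite /ecomb big_map [LHS](csumE lbasisP) big_filter [RHS]big_mkcond; apply: eq_big_seq => b bx.
have [l gl <-] := csuppX lbasisP bx; rewrite el_lab //.
by case: eqP => [->|_]; rewrite ?scale0r.
Qed.

Lemma gr_negative j x n : lgr (n, Negz j) x -> x = 0.
Proof.
move=> gx; apply: (coord0_eq0 lbasisP) => b Bb; have := gx b Bb; case: eqP => // _.
rewrite /ldg /=; case e : (_ - _) => [i|i] //; move: e; move: (ldeg _) => t e; lia.
Qed.

Lemma gr_neg_level n j x : n < 0 -> lgr (n, j) x -> x = 0.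
Proof.
move=> n0 gx; apply: (coord0_eq0 lbasisP) => b Bb; have := gx b Bb; case: eqP => //= e.
by move: n0; rewrite -e.
Qed.

Lemma lexact n j x : lgr (n%:Z, j) x -> lclosed n x ->
  exists2 y, lgr (n%:Z + 1, j) y & ldiff y = x.
Proof.
case: j => [j|j] gx zx; last first.
  exists 0; first exact: (fgr0 hgr lbasisP).
  by rewrite (gr_negative gx) (addm0 (lin_addm ldiff_linear)).
have [r [_ hr er]] := gr_ecomb gx; rewrite er in zx.
have [|r' hr' e] := level_exact hgr (n := n) (j := j) (x := lcomb r).
  by exists r; split=> //; apply/(lcycleP hr).
exists (ecomb r'); first by have := ecomb_gr hr'; rewrite -addn1 PoszD.
apply: val_inj; rewrite er (ldiff_ecomb (lhomog_good hr')) (val_ecomb (lhomog_good hr)).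
by rewrite e.
Qed.

(** At labels of degree j the coefficients are scalars, and the other terms have decomposable
    boundaries; so the scalars satisfy a relation modulo decomposables between chosen generators and
    vanish. Distinct labels make the coefficient of a label meaningful. *)
Lemma bottom_coef n j r : lhomog gr (level n) j r -> uniq [seq p.2 | p <- r] ->
  lcycle gr n r -> forall p, p \in r -> ldeg p.2 = j -> p.1 = 0.
Proof.
move=> h ur zr p pr ej; have aug0 : augA gr p.1 = 0 -> p.1 = 0.
  move=> e; have [_ _] := h p pr; rewrite ej subnn => /(gr0_augA hgr hconn) ->.
  by rewrite e scale0r.
apply: aug0; case: n h zr => [|n] h zr.
  (* Level 0 has one label, so [r] has at most one term and [lcycle] says that its scalar part is
     0. *)
  have r1 q : q \in r -> q.2 = Label 0 0 [::] by move=> /h[].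
  case: r ur r1 pr zr {h} => [//|q [|q' r]] ur r1.
    by rewrite inE => /eqP ->; rewrite /lcycle big_seq1.
  by move: ur; rewrite /= (r1 q) ?(r1 q') ?inE ?eqxx ?orbT.
(* The scalar coefficient of l in [r], found by position; a label absent from [r] gets the default
   0. *)
pose c l := augA gr (nth (0, l) r (index l [seq q.2 | q <- r])).1.
have cE q : q \in r -> c q.2 = augA gr q.1.
  move=> qr; rewrite /c; have ir : (index q r < size r)%N by rewrite index_mem.
  rewrite -{2}(nth_index q qr) -(nth_map _ q.2) // index_uniq ?size_map //.
  by rewrite nth_index.
have [_ indep _] := projT2 (cid (exists_generators gr n (level n) j)).
pose t := [seq q <- r | ldeg q.2 == j].
rewrite -cE //; apply: (indep [seq q.2 | q <- t] c); last first.
- by apply/mapP; exists p => //; rewrite mem_filter ej eqxx.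
- rewrite big_map.
  have -> : \sum_(q <- t) c q.2 *: (lbd q.2 : rscal U) =
      - \sum_(q <- r | ldeg q.2 != j) q.1 *: lbd q.2.
    apply/eqP; rewrite -subr_eq0 opprK; apply/eqP; rewrite -[RHS]zr /lcomb_bd.
    rewrite [RHS](bigID (fun q => ldeg q.2 == j)) /= big_filter; congr (_ + _).
    rewrite big_seq_cond [RHS]big_seq_cond; apply: eq_bigr => q /andP[qr /eqP ejq].
    have [_ _] := h q qr; rewrite ejq subnn => /(gr0_augA hgr hconn) e.
    by rewrite (cE q qr) [in RHS]e.
  have sD := lspan_submod [set x : rscal U | exists i a k,
    [/\ (0 < i <= j)%N, gr i a, cycles gr n (level n) (j - i) k & x = a *: (k : U)]].
  apply: (submodN sD); apply: (submod_sum sD) => q qr ne; have [h1 h2 h3] := h q qr.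
  apply: sub_lspan; exists (j - ldeg q.2)%N, q.1, (lbd q.2); split=> //.
    by rewrite subn_gt0 ltn_neqAle ne h2 leq_subr.
  by rewrite subKn //; have [_ _ h4 h5] := level_succ h1; exists (lrep q.2).
- move=> _ /mapP[q + ->]; rewrite mem_filter => /andP[/eqP ejq /h[h1 _ _]].
  by have [_ + _ _] := level_succ h1; rewrite ejq.
exact: subseq_uniq (map_subseq _ (filter_subseq _ _)) ur.
Qed.

(** The boundary of a generator is rewritten with distinct labels; by [bottom_coef] its nonzero
    coefficients have positive degree. *)
Lemma lminimal x : lspan [set y : lmod | exists i a z,
    [/\ (0 < i)%N, gr i a & y = a *: z]] (ldiff x).
Proof.
set D := [set y | _]; have sD := lspan_submod D.
rewrite [x](csumE lbasisP) (addm_sum (lin_addm ldiff_linear)).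
apply: (submod_sum sD) => b bx _; rewrite (linZ ldiff_linear); apply: (submodZ sD).
have [l gl <-] := csuppX lbasisP bx; case en : (lvl l) => [|n]; have hl := good_level gl en.
  by rewrite hl (ldiff_el good0) /ecomb big_nil; case: sD.
have [_ _ h1 h2] := level_succ hl; rewrite ldiff_el //.
have [r [ur hr er]] := gr_ecomb (ecomb_gr h1); rewrite er.
have zr : lcycle gr n r by apply/(lcycleP hr); rewrite -er; apply/(lcycleP h1).
apply: (submod_sum sD) => p pr _; have [h3 h4 h5] := hr p pr.
have [e|ne] := eqVneq (ldeg p.2) (ldeg l).
  by rewrite (bottom_coef hr ur zr pr e) scale0r; case: sD.
apply: sub_lspan; exists (ldeg l - ldeg p.2)%N, p.1, (el p.2); split=> //.
by rewrite subn_gt0 ltn_neqAle ne.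
Qed.

End LabelModule.

Section ExistsMinimalResolution.
Variables (F : fieldType) (A : algType F) (gr : nat -> set A).
Hypotheses (hgr : graded_algebra gr) (hconn : connected_algebra gr).

Local Notation M := (lmod gr).
Local Notation lgr := (fgr gr (@lbasis _ _ gr) (@ldg _ _ gr)).

HB.instance Definition _ := GRing.isLinear.Build A M M *:%R (@ldiff _ _ gr) (@ldiff_linear _ _ gr).

Lemma exists_min_resolution : exists Q : resolution gr, minimal_resolution Q.
Proof.
have hB := @lbasisP _ _ gr; have hg := fgr_grading hgr hB (@ldg _ _ gr).
have gZ : forall i a n j x, gr i a -> lgr (n, j) x -> lgr (n, i%:Z + j) (a *: x).
  by move=> i a n j x; apply: fgr_scale.
have gneg : forall n j x, (n < 0)%R -> lgr (n, j) x -> x = 0 by move=> n j x; apply: gr_neg_level.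
have free : exists2 X : set M, X `<=` [set x | exists nj, lgr nj x] & is_basis X.
  by exists (@lbasis _ _ gr) => // _ [l gl <-]; eexists; apply: el_gr.
have dgr : forall n j x, lgr (n, j) x -> lgr (n - 1, j) (ldiff x).
  have h := fgr_linear hB (dg := @ldg _ _ gr) (e := -1) (@ldiff_linear _ _ gr) hg gZ.
  apply: h => _ [l gl <-].
  rewrite /ldg el_lab // ldiff_el //; case en : (lvl l) => [|n]; have hl := good_level gl en.
    by rewrite hl /ecomb big_nil; apply: (gr0 hg).
  have [_ _ h _] := level_succ hl; have := ecomb_gr hgr h.
  by congr (lgr (_, _) _); rewrite /=; lia.
have augd : forall nj x, nj <> (0, 0) -> lgr nj x -> laug x = 0.
  move=> nj x ne gx; rewrite /laug -coord_el //; have := gx (el gr (Label 0 0 [::])).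
  rewrite /ldg el_lab // => /(_ (ex_intro2 _ _ (Label 0 0 [::]) (good0 gr) erefl)) /=.
  have z : augA gr 0 = 0 := addm0 (augAD hgr hconn).
  case: nj {gx} ne => p [[|j]|j] ne /=; rewrite ?subr0 /=; case: eqP => [e1|_ -> //] /=.
  - by case: ne; rewrite -e1.
  - exact: augA_pos.
  - by move=> ->.
have augs : exists x : M, laug x = 1.
  by exists (el gr (Label 0 0 [::])); rewrite /laug val_elE // eqxx (augA1 hgr hconn).
have ex0 : forall j (x : M), lgr (0, j) x -> laug x = 0 -> exists2 y, lgr (1, j) y & ldiff y = x.
  by move=> j x gx ax; have [|y] := lexact hgr hconn (n := 0%N) gx; [|exists y].
have exn : forall n j (x : M), (0 < n)%R -> lgr (n, j) x -> ldiff x = 0 ->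
    exists2 y, lgr (n + 1, j) y & ldiff y = x.
  by move=> [[|n]|n] // j x _ gx dx; apply: (lexact hgr hconn (n := n.+1) gx).
exists (@Resolution F A gr M lgr (@ldiff _ _ gr) (@laug _ _ gr) hg gZ gneg free dgr
  (laug_trivial hgr hconn) augd augs (laug_ldiff hgr hconn) (ldiff_ldiff hgr hconn) ex0 exn).
by move=> x; apply: (lminimal hgr hconn).
Qed.

End ExistsMinimalResolution.

(** * From a finitely generated reduced structure to a bi-Koszul resolution *)

Section Reverse.
Variables (F : fieldType) (A : algType F) (gr : nat -> set A).
Hypotheses (hgr : graded_algebra gr) (hconn : connected_algebra gr).
Variables (d : nat) (hd : (2 <= d)%N).

Lemma term_generated (Q : resolution gr) (Y : set Q) (n : nat) (D : nat * nat) :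
  Y `<=` [set x | exists nj, res_gr Q nj x] -> is_basis Y ->
  (forall b, Y b -> lev b = n -> (deg b).2 = D.1%:Z \/ (deg b).2 = D.2%:Z) ->
  @res_term F A gr Q n = lspan (res_gr Q (n%:Z, D.1%:Z) `|` res_gr Q (n%:Z, D.2%:Z)).
Proof.
move=> hYh hY hD; apply/seteqP; split; apply: lspan_min; try exact: lspan_submod; last first.
  by move=> x [gx|gx]; apply: sub_lspan; eexists; apply: gx.
have sD := lspan_submod (res_gr Q (n%:Z, D.1%:Z) `|` res_gr Q (n%:Z, D.2%:Z)).
move=> x [j gx]; rewrite [x](csumE hY); apply: (submod_sum sD) => b bx _; have Yb := csuppX hY bx.
have [e|ne] := eqVneq n%:Z (deg b).1; last first.
  by rewrite (coord_lev hgr hYh hY Yb gx ne) scale0r; case: sD.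
apply: (submodZ sD); apply: sub_lspan; have gb := degP' hYh Yb; rewrite -e in gb.
have lb : lev b = n by move/eqP: e; rewrite (degE hYh hY Yb) eqz_nat => /eqP.
by case: (hD b Yb lb) => e2; rewrite e2 in gb; [left|right].
Qed.

Lemma piece_degrees n j a k : (Posz n, j) = piece_deg d a k ->
  j = (bi_Koszul_degrees d n).1%:Z \/ j = (bi_Koszul_degrees d n).2%:Z.
Proof.
case: a => -[-> ->]; rewrite /= ?addn0.
- by rewrite degrees0; left.
- by rewrite degrees1; left.
- by rewrite degrees2; left.
- by rewrite degrees2 addnS addn1; right.
Qed.

Lemma Ext_bi_Koszul (P : resolution gr) (m : seq (Ext P) -> Ext P) :
  A_infinity_Ext_algebra m -> reduced d (Ext_gr P) m ->
  finitely_generated (Ext_gr P) m [:: 2; 3]%N 3 ->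
  coh_part (Ext_gr P) 1 = Ext_gr P (1, 1) ->
  coh_part (Ext_gr P) 2 = [set x + y | x in Ext_gr P (2, d%:Z) & y in Ext_gr P (2, d.+1%:Z)] ->
  coh_part (Ext_gr P) 3 = Ext_gr P (3, (2 * d)%N%:Z) ->
  bi_Koszul gr d.
Proof.
move=> [[[hg hgZ] mlin hgm _ _] _ _] hred hfg h1 h2 h3.
have sup := supported_pos hd hg hgZ hgm mlin hred hfg h1 h2 h3.
have [Q hmin] := exists_min_resolution hgr hconn; have [Y hYh hY] := res_free Q.
exists Q => // n; apply: (term_generated hYh hY) => b Yb lb.
(* The support statement covers positive cohomological degrees; on level 0 minimality gives internal
   degree 0. *)
have e1 := degE hYh hY Yb; rewrite lb in e1; case: n lb e1 => [|n] lb e1.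
  by rewrite (min_level0 hgr hconn hYh hY hmin Yb e1) (degrees0 d 0) muln0; left.
have [x gx nz] := min_generator_Ext hgr hconn P hYh hY hmin Yb.
rewrite [deg b]surjective_pairing e1 in gx.
by have [a [k]] := sup _ (ltn0Sn n) _ _ gx nz; apply: piece_degrees.
Qed.

End Reverse.

Theorem theorem3p6 (F : fieldType) (A : algType F) (gr : nat -> set A)
    (d : nat) (hgr : graded_algebra gr) (hconn : connected_algebra gr)
    (hfin : locally_finite gr) (hgen : generated_in_degree1 gr)
    (hd : (2 <= d)%N) :
  bi_Koszul gr d <->
  exists (P : resolution gr) (m : seq (Ext P) -> Ext P),
    [/\ A_infinity_Ext_algebra m,
        reduced d (Ext_gr P) m,
        finitely_generated (Ext_gr P) m [:: 2; 3]%N 3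
      & [/\ coh_part (Ext_gr P) 1 = Ext_gr P (1, 1),
            coh_part (Ext_gr P) 2 =
              [set x + y | x in Ext_gr P (2, d%:Z) & y in Ext_gr P (2, d.+1%:Z)]
          & coh_part (Ext_gr P) 3 = Ext_gr P (3, (2 * d)%N%:Z)]].
Proof.
split; first exact: bi_Koszul_Ext.
by move=> [P [m [hm hred hfg [h1 h2 h3]]]]; apply: (Ext_bi_Koszul hgr hconn hd hm).
Qed.
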